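(* Under the standing assumptions in the context, there are constants $c_{10},c_{11}>0$ such that the following holds. For $j=1,2$ let $\mathcal F_j\in\mathcal W'$ and $(\mathbf u_j,p_j)\in\mathcal W$ with $\mathcal A(\mathbf u_j,p_j)=\mathcal F_j$. Let $M=1+\sum_{j=1}^2(\|\pi_1\mathcal F_j\|_{V'}^{r-1}+\|\pi_2\mathcal F_j\|_{Z'})$, $\beta=\|\pi_1(\mathcal F_1-\mathcal F_2)\|_{V'}$, $\gamma=\|\pi_2(\mathcal F_1-\mathcal F_2)\|_{Z'}$. Then $$\|(\mathbf u_1,p_1)-(\mathbf u_2,p_2)\|_{\mathcal W}\le c_{10}\big(\beta+M^{s-2}\beta^{r-1}+\gamma+M^{r(s-2)}\gamma^{r-1}\big),$$ and $$\|(\mathbf u_1,p_1)-(\mathbf u_2,p_2)\|_{\mathcal W}\le c_{11}\big(1+\|\mathcal F_1\|_{\mathcal W'}+\|\mathcal F_2\|_{\mathcal W'}\big)^{r(s-2)}\big(\|\mathcal F_1-\mathcal F_2\|_{\mathcal W'}^{r-1}+\|\mathcal F_1-\mathcal F_2\|_{\mathcal W'}\big).$$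
   Context: $n\ge2$, $\Omega\subset\mathbb R^n$ open bounded with $C^1$ boundary. $F:\mathbb R^n\to\mathbb R^n$ satisfies $F(0)=0$ and, for constants $s>2$, $c_1,c_2>0$ and all $x,y$: $|F(x)-F(y)|\le c_1(1+|x|^{s-2}+|y|^{s-2})|x-y|$ and $(F(x)-F(y))\cdot(x-y)\ge c_2|x-y|^s$. Let $r=s/(s-1)$. $V=\mathbf W_s(\mathrm{div},\Omega)=\{\mathbf v\in(L^s(\Omega))^n:\operatorname{div}\mathbf v\in L^s(\Omega)\}$ with norm $(\|\mathbf v\|_{L^s}^s+\|\operatorname{div}\mathbf v\|_{L^s}^s)^{1/s}$, $Z=L^r(\Omega)$, and $\mathcal W=V\times Z$ with norm $\|(\mathbf u,p)\|_{\mathcal W}=\|\mathbf u\|_V+\|p\|_Z$. Set $a(\mathbf u,\mathbf v)=\int_\Omega F(\mathbf u)\cdot\mathbf v\,dx$, $b(\mathbf v,q)=\int_\Omega(\operatorname{div}\mathbf v)q\,dx$, and $\mathcal A:\mathcal W\to\mathcal W'$ by $\langle\mathcal A(\mathbf u,p),(\mathbf v,q)\rangle=a(\mathbf u,\mathbf v)-b(\mathbf v,p)+b(\mathbf u,q)$. For $\mathcal F\in\mathcal W'$, $\pi_1\mathcal F\in V'$ and $\pi_2\mathcal F\in Z'$ are $(\pi_1\mathcal F)(\mathbf v)=\mathcal F(\mathbf v,0)$ and $(\pi_2\mathcal F)(q)=\mathcal F(0,q)$. *)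

(* Defs.v *)
From HB Require Import structures.
From mathcomp Require Import all_boot all_order all_algebra.
From mathcomp Require Import all_classical all_reals all_analysis.
Set Implicit Arguments. Unset Strict Implicit. Unset Printing Implicit Defensive.
Import Order.TTheory GRing.Theory Num.Theory.
Import numFieldNormedType.Exports.
Local Open Scope classical_set_scope.
Local Open Scope ring_scope.

Section defs.
Variable R : realType.

Definition dotp n (x y : 'rV[R]_n) : R := \sum_(i < n) x 0 i * y 0 i.
Definition enorm n (x : 'rV[R]_n) : R := Num.sqrt (dotp x x).

(** points of R^n as tuples (for the product sigma-algebra) *)
Definition rV_of_tuple n (t : n.-tuple R) : 'rV[R]_n := \row_(i < n) tnth t i.

(** Lebesgue integral on R^n of a nonnegative function, as the iterated
    one-dimensional Lebesgue integral (Tonelli). *)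
Fixpoint intn (n : nat) : (n.-tuple R -> \bar R) -> \bar R :=
  match n return (n.-tuple R -> \bar R) -> \bar R with
  | 0 => fun f => f [tuple]
  | m.+1 => fun f =>
      (\int[@lebesgue_measure R]_x intn (fun t => f (cons_tuple x t)))%E
  end.

Definition intO n (O : set 'rV[R]_n) (g : 'rV[R]_n -> \bar R) : \bar R :=
  intn (fun t => if rV_of_tuple t \in O then g (rV_of_tuple t) else 0%E).

Definition RintO n (O : set 'rV[R]_n) (f : 'rV[R]_n -> R) : R :=
  fine (intO O (fun x => (Num.max (f x) 0)%:E))
  - fine (intO O (fun x => (Num.max (- f x) 0)%:E)).

Definition measO n (O : set 'rV[R]_n) (f : 'rV[R]_n -> R) : Prop :=
  measurable_fun [set: n.-tuple R]
    (fun t => if rV_of_tuple t \in O then f (rV_of_tuple t) else 0).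

Definition inLp n (O : set 'rV[R]_n) (p : R) (f : 'rV[R]_n -> R) : Prop :=
  measO O f /\ (intO O (fun x => (`|f x| `^ p)%:E) < +oo)%E.
Definition Lpnorm n (O : set 'rV[R]_n) (p : R) (f : 'rV[R]_n -> R) : R :=
  fine (intO O (fun x => (`|f x| `^ p)%:E)) `^ p^-1.

Definition inLpvec n (O : set 'rV[R]_n) (p : R) (u : 'rV[R]_n -> 'rV[R]_n) :=
  (forall i, measO O (fun x => u x 0 i)) /\
  (intO O (fun x => (enorm (u x) `^ p)%:E) < +oo)%E.
Definition Lpvecnorm n (O : set 'rV[R]_n) (p : R) (u : 'rV[R]_n -> 'rV[R]_n) :=
  fine (intO O (fun x => (enorm (u x) `^ p)%:E)) `^ p^-1.

Fixpoint iterD n (l : seq 'rV[R]_n) (f : 'rV[R]_n -> R) : 'rV[R]_n -> R :=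
  match l with
  | [::] => f
  | v :: l' => fun x => 'D_v (iterD l' f) x
  end.
Definition smooth n (f : 'rV[R]_n -> R) : Prop :=
  forall l : seq 'rV[R]_n, continuous (iterD l f) /\
    forall v x, derivable (iterD l f) x v.
Definition test_fun n (O : set 'rV[R]_n) (phi : 'rV[R]_n -> R) : Prop :=
  smooth phi /\ exists K, compact K /\ K `<=` O /\ forall x, ~ K x -> phi x = 0.
Definition grad n (phi : 'rV[R]_n -> R) (x : 'rV[R]_n) : 'rV[R]_n :=
  \row_(i < n) 'D_(delta_mx 0 i) phi x.

Definition weak_div n (O : set 'rV[R]_n) (u : 'rV[R]_n -> 'rV[R]_n)
    (g : 'rV[R]_n -> R) : Prop :=
  forall phi, test_fun O phi ->
    RintO O (fun x => dotp (u x) (grad phi x)) = - RintO O (fun x => g x * phi x).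

(** V = W_s(div, Omega): u together with its weak divergence du *)
Definition inV n (O : set 'rV[R]_n) (s : R) u du : Prop :=
  inLpvec O s u /\ inLp O s du /\ weak_div O u du.
Definition normV n (O : set 'rV[R]_n) (s : R) u du : R :=
  (Lpvecnorm O s u `^ s + Lpnorm O s du `^ s) `^ s^-1.

Definition conj_exp (s : R) : R := s / (s - 1).
Definition inW n (O : set 'rV[R]_n) (s : R) u du q : Prop :=
  inV O s u du /\ inLp O (conj_exp s) q.
Definition normW n (O : set 'rV[R]_n) (s : R) u du q : R :=
  normV O s u du + Lpnorm O (conj_exp s) q.

(** functionals on W (acting on representatives (v, q)) *)
Definition functional n := ('rV[R]_n -> 'rV[R]_n) -> ('rV[R]_n -> R) -> R.

Definition in_Wdual n (O : set 'rV[R]_n) (s : R) (G : functional n) : Prop :=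
  (forall (a : R) v1 dv1 q1 v2 dv2 q2,
     inW O s v1 dv1 q1 -> inW O s v2 dv2 q2 ->
     G (fun x => a *: v1 x + v2 x) (fun x => a * q1 x + q2 x)
     = a * G v1 q1 + G v2 q2) /\
  exists C : R, forall v dv q, inW O s v dv q -> `|G v q| <= C * normW O s v dv q.

Definition normWd n (O : set 'rV[R]_n) (s : R) (G : functional n) : R :=
  sup [set y | exists v dv q, inW O s v dv q /\ normW O s v dv q <= 1
                              /\ y = `|G v q| ].
Definition normVd n (O : set 'rV[R]_n) (s : R) (G : functional n) : R :=
  sup [set y | exists v dv, inV O s v dv /\ normV O s v dv <= 1
                            /\ y = `|G v (fun=> 0)| ].
Definition normZd n (O : set 'rV[R]_n) (s : R) (G : functional n) : R :=
  sup [set y | exists q, inLp O (conj_exp s) q /\ Lpnorm O (conj_exp s) q <= 1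
                         /\ y = `|G (fun=> 0) q| ].

Definition fsub n (G1 G2 : functional n) : functional n :=
  fun v q => G1 v q - G2 v q.

Definition solves n (O : set 'rV[R]_n) (s : R) (F : 'rV[R]_n -> 'rV[R]_n)
    u du p (G : functional n) : Prop :=
  inW O s u du p /\
  forall v dv q, inW O s v dv q ->
    RintO O (fun x => dotp (F (u x)) (v x)) - RintO O (fun x => dv x * p x)
    + RintO O (fun x => du x * q x) = G v q.

Definition C1fun n (g : 'rV[R]_n -> R) : Prop :=
  forall i : 'I_n, (forall x, derivable g x (delta_mx 0 i)) /\
    continuous (fun x => 'D_(delta_mx 0 i) g x).
(* near each boundary point, after reorienting the axes (new last axis along
   the unit vector nu), Omega is the region above the graph of a C^1 function
   gam of the remaining coordinates (the projection onto nu^perp). *)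
Definition C1_boundary n (O : set 'rV[R]_n) : Prop :=
  forall x0, (closure O `\` O) x0 ->
    exists (rho : R) (nu : 'rV[R]_n) (gam : 'rV[R]_n -> R),
      0 < rho /\ enorm nu = 1 /\ C1fun gam /\
      forall x, ball x0 rho x ->
        (O x <-> gam (x - dotp x nu *: nu) < dotp x nu).

End defs.

(* Main.v *)
Require Import Defs.
From HB Require Import structures.
From mathcomp Require Import all_boot all_order all_algebra.
From mathcomp Require Import all_classical all_reals all_analysis.
From mathcomp Require Import measurable_realfun ring lra.
Import Order.TTheory GRing.Theory Num.Theory.
Import numFieldNormedType.Exports.
Local Open Scope classical_set_scope.
Local Open Scope ring_scope.

(** Put [w = u1 - u2] and [e = p1 - p2].  Testing the difference of the two
    problems with [q = |div w|^(s-2) div w] gives [|div w| <= gamma]; testing it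
    with [(w, e)] and using the monotonicity of [F] gives
    [c2 |w|^s <= beta (|w| + gamma) + gamma |e|].  The pressure is controlled by
    an inf-sup inequality: a field with prescribed bounded divergence
    [f >= 0] is [(int_(-oo)^(x1) f, 0, ..., 0)], no boundary condition being
    imposed on [V], and one takes for [f] the truncations of [(e^+)^(r-1)]
    and [(e^-)^(r-1)].  Hence [|e| <= C (beta + |F(u1) - F(u2)|_r)], where
    Hoelder's inequality yields
    [|F(u1) - F(u2)|_r <= C (1 + |u1| + |u2|)^(s-2) |w|].  Comparing each
    solution with the zero solution bounds [1 + |u1| + |u2|] by [C M], and the
    theorem follows from these inequalities between real numbers. *)

(** The integral of the statement is an iterated one-dimensional integral. It becomes accessible to
    Hölder's and Minkowski's inequalities and to the convergence theorems once it is identified, for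
    measurable nonnegative integrands, with the integral against a sigma-finite measure on tuples.
    Truncation keeps the primitive finite everywhere: [(e^+)^(r-1)] lies in [L^s], but may fail to
    be integrable on some lines. The bound for the truncations is independent of their level and
    passes to the limit by monotone convergence. Sources of one sign keep the exchanges of integrals
    within Tonelli's theorem. The exponents arise as follows. Let [P = M^(s-2)]. Since
    [r - 1 = 1/(s-1)], the energy inequality bounds [|w|] by a multiple of
    [beta^(r-1) + gamma + (P gamma)^(r-1)]. The pressure costs a further factor [P], whence
    [P^r = M^(r(s-2))] in front of [gamma^(r-1)]; the remaining term [P gamma] is absorbed by that
    one because [gamma <= M]. *)

Section cons_pair.
Variable R : realType.

Definition cons_pair n (z : R * n.-tuple R) : n.+1.-tuple R :=
  cons_tuple z.1 z.2.

Lemma measurable_cons_pair n : measurable_fun [set: R * n.-tuple R] (@cons_pair n).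
Proof. by apply: measurable_cons; [exact: measurable_fst|exact: measurable_snd]. Qed.

Definition uncons_pair n (t : n.+1.-tuple R) : R * n.-tuple R :=
  (thead t, behead_tuple t).

Lemma cons_pairK n : cancel (@cons_pair n) (@uncons_pair n).
Proof. by case=> x t; rewrite /uncons_pair /cons_pair/=; congr pair; apply/val_inj. Qed.

Lemma measurable_uncons_pair n :
  measurable_fun [set: n.+1.-tuple R] (@uncons_pair n).
Proof.
apply/measurable_fun_pair; first exact: measurable_tnth.
exact: measurable_behead.
Qed.

End cons_pair.

(** * Lebesgue measure on tuples, built one coordinate at a time *)

Section product_tuple.
Variables (R : realType) (n : nat).
Variable mu : {sigma_finite_measure set (n.-tuple R) -> \bar R}.

(** The sigma-algebra on tuples is generated by the coordinates, so the binary product measure on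
    pairs is transported along the measurable bijection [cons_pair]. *)
Definition product_tuple : set (n.+1.-tuple R) -> \bar R :=
  pushforward (@lebesgue_measure R \x mu)%E (@cons_pair R n).

Let product_tuple0 : product_tuple set0 = 0%E.
Proof. by rewrite /product_tuple /pushforward preimage_set0 measure0. Qed.

Let product_tuple_ge0 A : (0 <= product_tuple A)%E.
Proof. by rewrite /product_tuple /pushforward; apply: measure_ge0. Qed.

Let product_tuple_sigma_additive : semi_sigma_additive product_tuple.
Proof.
move=> F mF tF mUF; rewrite /product_tuple /pushforward preimage_bigcup.
have mcons A : measurable A -> measurable (@cons_pair R n @^-1` A).
  by move=> mA; rewrite -[X in measurable X]setTI; exact: measurable_cons_pair.
apply: measure_semi_sigma_additive; first by move=> k; exact: mcons.
  apply/trivIsetP => /= i j _ _ ij; rewrite -preimage_setI.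
  by move/trivIsetP : tF => /(_ _ _ _ _ ij) ->//; rewrite preimage_set0.
by rewrite -preimage_bigcup; exact: mcons.
Qed.

HB.instance Definition _ := isMeasure.Build _ _ _ product_tuple
  product_tuple0 product_tuple_ge0 product_tuple_sigma_additive.

(** Sigma-finiteness has to be propagated: forming the product in the next dimension and applying
    Tonelli's theorem both use it. *)
Let sigma_finite_product_tuple : sigma_finite setT product_tuple.
Proof.
have /sigma_finiteP[F [TF ndF Foo]] := sigma_finiteT (@lebesgue_measure R).
have /sigma_finiteP[G [TG ndG Goo]] := sigma_finiteT mu.
exists (fun k => @uncons_pair R n @^-1` (F k `*` G k)).
  apply/seteqP; split => // t _.
  have [k _ Fk] : (\bigcup_k F k) (uncons_pair R n t).1 by rewrite -TF.
  have [l _ Gl] : (\bigcup_k G k) (uncons_pair R n t).2 by rewrite -TG.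
  (* Both exhausting sequences increase, so the rectangles with equal indices already cover
     everything. *)
  exists (maxn k l) => //; split.
    by move: Fk; exact/subsetPset/ndF/leq_maxl.
  by move: Gl; exact/subsetPset/ndG/leq_maxr.
move=> k; have [mF Fk] := Foo k; have [mG Gk] := Goo k; split.
  rewrite -[X in measurable X]setTI; apply: measurable_uncons_pair => //.
  exact: measurableX.
rewrite /product_tuple /pushforward (_ : _ @^-1` _ = F k `*` G k); last first.
  by apply/funext => z; exact: (congr1 (F k `*` G k) (cons_pairK R n z)).
by rewrite product_measure1E// lte_mul_pinfty// ge0_fin_numE.
Qed.

HB.instance Definition _ := Measure_isSigmaFinite.Build _ _ _ product_tuple
  sigma_finite_product_tuple.

Lemma ge0_integral_product_tuple (f : n.+1.-tuple R -> \bar R) :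
  measurable_fun [set: n.+1.-tuple R] f -> (forall t, (0 <= f t)%E) ->
  (\int[product_tuple]_t f t = \int[@lebesgue_measure R]_x \int[mu]_t f (cons_tuple x t))%E.
Proof.
move=> mf f0.
have mc : measurable_fun [set: (measurableTypeR R * n.-tuple R)%type] (@cons_pair R n).
  exact: measurable_cons_pair.
have := @ge0_integral_pushforward _ _ _ _ R _ mc (@lebesgue_measure R \x mu)%E
  setT f measurableT mf (fun t _ => f0 t).
rewrite preimage_setT => E; transitivity (\int[(@lebesgue_measure R \x mu)%E]_z (f \o cons_pair R n) z)%E.
  exact: E.
rewrite fubini_tonelli1//; first exact: (measurableT_comp mf mc).
by move=> z; exact: f0.
Qed.

End product_tuple.

Section lebesgue_tuple.
Variable R : realType.
Local Open Scope ereal_scope.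

(** The Dirac mass at the empty tuple is the measure for which the base case of [intn], evaluation
    at [[tuple]], is an integral. *)
Fixpoint lebesgue_tuple n : {sigma_finite_measure set (n.-tuple R) -> \bar R} :=
  match n with
  | 0 => \d_ [tuple]
  | m.+1 => product_tuple R m (lebesgue_tuple m)
  end.

Lemma ge0_integral_lebesgue_tupleS n (f : n.+1.-tuple R -> \bar R) :
  measurable_fun [set: n.+1.-tuple R] f -> (forall t, 0 <= f t) ->
  \int[lebesgue_tuple n.+1]_t f t =
  \int[@lebesgue_measure R]_x \int[lebesgue_tuple n]_t f (cons_tuple x t).
Proof. exact: ge0_integral_product_tuple. Qed.

(** Slices of a measurable function are measurable, so the induction hypothesis applies to the inner
    integral, and Tonelli's theorem reassembles the two. This is the passage from the integrals of
    the statement to measure theory. *)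
Lemma intnE n (f : n.-tuple R -> \bar R) :
  measurable_fun [set: n.-tuple R] f -> (forall t, 0 <= f t) ->
  intn f = \int[lebesgue_tuple n]_t f t.
Proof.
elim: n f => [|n IH] f mf f0.
  by rewrite /= integral_dirac//= diracT mul1e.
rewrite ge0_integral_lebesgue_tupleS// [LHS]/=; apply: eq_integral => x _.
rewrite IH//; apply: measurableT_comp => //.
apply: measurable_cons; [exact: measurable_cst|exact: measurable_id].
Qed.

End lebesgue_tuple.

(** * Borel measurability on R^n expressed through tuples *)

Section measurable_euclidean.
Variable R : realType.
Implicit Types n : nat.

(* Open sets are countable unions of boxes with rational endpoints. *)
Lemma measurable_open_tuple n (O : set 'rV[R]_n) : open O ->
  measurable [set t : n.-tuple R | O (rV_of_tuple t)].
Proof.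
move=> oO.
pose box (q : {ffun 'I_n -> rat * rat}) : set (n.-tuple R) :=
  [set t | forall i, ratr (q i).1 < tnth t i < ratr (q i).2].
have mbox q : measurable (box q).
  rewrite (_ : box q = \bigcap_(i : 'I_n) [set t | `]ratr (q i).1, ratr (q i).2[%classic (tnth t i)]).
    apply: fin_bigcap_measurable => // i _.
    rewrite -[X in measurable X]setTI.
    exact: (@measurable_tnth _ R n i measurableT _ (measurable_itv _)).
  apply/seteqP; split => t /= H i; first by move=> _ /=; rewrite in_itv/=; exact: H.
  by have := H i I; rewrite /= in_itv.
(* All rational boxes are enumerated through [pickle]; a code of no box, or of a box not inside [O],
   contributes the empty set. *)
pose G k : set (n.-tuple R) :=
  if @unpickle {ffun 'I_n -> rat * rat} k is Some q then
    (if pselect (box q `<=` [set t | O (rV_of_tuple t)]) then box q else set0)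
  else set0.
rewrite (_ : mkset _ = \bigcup_k G k).
  apply: bigcupT_measurable => k; rewrite /G.
  case: unpickle => [q|]; last exact: measurable0.
  by case: pselect => [?|?] /=; [exact: mbox|exact: measurable0].
apply/seteqP; split => [t /= Ot|t [k _]]; last first.
  by rewrite /G; case: unpickle => // q; case: pselect => //= h; exact: h.
have /nbhs_ballP[e /= e0 eO] : nbhs (rV_of_tuple t) O by exact: open_nbhs_nbhs.
have Q i : {ab : rat * rat | tnth t i - e < ratr ab.1 < tnth t i /\
                             tnth t i < ratr ab.2 < tnth t i + e}.
  apply/cid.
  have [a ha] : exists a : rat, ratr a \in `](tnth t i - e), (tnth t i)[.
    by apply: rat_in_itvoo; rewrite ltrBlDr ltrDl.
  have [b hb] : exists b : rat, ratr b \in `](tnth t i), (tnth t i + e)[.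
    by apply: rat_in_itvoo; rewrite ltrDl.
  by exists (a, b); move: ha hb; rewrite !in_itv.
pose q := [ffun i => sval (Q i)].
have bt : box q t.
  by move=> i; rewrite /q ffunE; case: (Q i) => -[a b] /= [/andP[_ ->] /andP[-> _]].
(* Every rational endpoint is within [e] of the corresponding coordinate of [t], and balls of row
   vectors are taken coordinatewise, so the box stays in the ball. *)
have bO : box q `<=` [set t | O (rV_of_tuple t)].
  move=> u bu; apply: eO; split => // i j; rewrite (ord1 i) !mxE.
  rewrite /ball/= ltr_norml; have := bu j; rewrite /q ffunE.
  case: (Q j) => -[a b] /= [/andP[h1 h2] /andP[h3 h4]] /andP[h5 h6].
  by apply/andP; split; lra.
exists (pickle q) => //; rewrite /G pickleK; case: pselect => //.
Qed.

Lemma continuous_measurable_tuple n (g : 'rV[R]_n -> R) : continuous g ->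
  measurable_fun [set: n.-tuple R] (fun t => g (rV_of_tuple t)).
Proof.
move=> /continuousP cg; apply: (measurability _ (RGenOpens.measurableE R)).
move=> _ [_ [a [b ->] <-]]; rewrite setTI.
apply: (@measurable_open_tuple n (g @^-1` `]a, b[%classic)).
by apply: cg; exact: interval_open.
Qed.

(** Measurability is expressed on tuples, so the composition is factored through the tuple of
    coordinates of [U]. It serves for the components of [F] composed with a velocity field. *)
Lemma continuous_measurable_comp n d (T : measurableType d) (g : 'rV[R]_n -> R)
    (U : T -> 'rV[R]_n) : continuous g ->
  (forall i, measurable_fun [set: T] (fun t => U t 0 i)) ->
  measurable_fun [set: T] (fun t => g (U t)).
Proof.
move=> cg mU; pose V t := [tuple U t 0 i | i < n].
have mV : measurable_fun [set: T] V.
  apply/measurable_fun_tnthP => i.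
  by rewrite (_ : _ \o _ = fun t => U t 0 i)//; apply/funext => t /=; rewrite tnth_mktuple.
have := measurableT_comp (continuous_measurable_tuple _ _ cg) mV.
congr measurable_fun; apply/funext => t/=; congr g.
by apply/rowP => i; rewrite mxE tnth_mktuple.
Qed.

End measurable_euclidean.

(** * Real-valued [L^p] norms on a measure space *)

Section Lebesgue_norms.
Context d (T : measurableType d) (R : realType) (mu : {measure set T -> \bar R}).
Implicit Types (f g h : T -> R) (p q : R).

Definition memLp p f := measurable_fun [set: T] f /\
  (\int[mu]_x (`|f x| `^ p)%:E < +oo)%E.

(** The value is real: [fine] sends an infinite integral to 0, hence the hypotheses [memLp] in the
    estimates. *)
Definition nLp p f : R := fine (\int[mu]_x (`|f x| `^ p)%:E) `^ p^-1.

Lemma nLpE p f : nLp p f = fine (\int[mu]_x (`|f x| `^ p)%:E) `^ p^-1.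
Proof. by []. Qed.

Lemma nLp_ge0 p f : 0 <= nLp p f.
Proof. exact: powR_ge0. Qed.

Lemma int_powR_ge0 p f : (0 <= \int[mu]_x (`|f x| `^ p)%:E)%E.
Proof. by apply: integral_ge0 => x _; rewrite lee_fin powR_ge0. Qed.

Lemma memLp_fin p f : memLp p f -> (\int[mu]_x (`|f x| `^ p)%:E)%E \is a fin_num.
Proof. by case=> _ fy; rewrite ge0_fin_numE// int_powR_ge0. Qed.

Lemma nLp_powR p f : 0 < p -> nLp p f `^ p = fine (\int[mu]_x (`|f x| `^ p)%:E).
Proof.
move=> p0; rewrite /nLp -powRrM mulVf ?gt_eqF// powRr1//.
exact/fine_ge0/int_powR_ge0.
Qed.

Lemma LnormE p f : Lnorm mu p%:E (EFin \o f) = ((\int[mu]_x (`|f x| `^ p)%:E) `^ p^-1)%E.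
Proof.
by rewrite unlock.
Qed.

Lemma LnormEnLp p f : memLp p f -> Lnorm mu p%:E (EFin \o f) = (nLp p f)%:E.
Proof. by move=> fp; rewrite LnormE -[in LHS](fineK (memLp_fin p f fp)). Qed.

Lemma measurable_norm_powR p f : measurable_fun [set: T] f ->
  measurable_fun [set: T] (fun x => `|f x| `^ p).
Proof.
move=> mf; apply: (measurableT_comp (measurable_powR p)).
exact: measurableT_comp.
Qed.

Lemma int_powR_le p f g : 0 <= p -> measurable_fun [set: T] f ->
  measurable_fun [set: T] g -> (forall x, `|f x| <= `|g x|) ->
  (\int[mu]_x (`|f x| `^ p)%:E <= \int[mu]_x (`|g x| `^ p)%:E)%E.
Proof.
move=> p0 mf mg fg; apply: ge0_le_integral => //.
- exact/measurable_EFinP/measurable_norm_powR.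
- exact/measurable_EFinP/measurable_norm_powR.
- by move=> x _; rewrite lee_fin ge0_ler_powR// nnegrE.
Qed.

Lemma memLp_le p f g : 0 <= p -> measurable_fun [set: T] f -> memLp p g ->
  (forall x, `|f x| <= `|g x|) -> memLp p f.
Proof.
by move=> p0 mf [mg gy] fg; split; [exact: mf|exact: le_lt_trans (int_powR_le p f g p0 mf mg fg) gy].
Qed.

Lemma nLp_le p f g : 0 <= p -> measurable_fun [set: T] f -> memLp p g ->
  (forall x, `|f x| <= `|g x|) -> nLp p f <= nLp p g.
Proof.
move=> p0 mf gp fg; have fp := memLp_le p f g p0 mf gp fg.
rewrite /nLp ge0_ler_powR ?invr_ge0 ?nnegrE ?fine_ge0 ?int_powR_ge0//.
by rewrite fine_le ?memLp_fin//; apply: int_powR_le => //; case: gp.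
Qed.

Lemma memLpZ p c f : memLp p f -> memLp p (fun x => c * f x).
Proof.
move=> [mf fy]; split; first exact: measurable_funM.
under eq_integral do rewrite normrM powRM// EFinM.
rewrite ge0_integralZl_EFin ?powR_ge0//.
- by rewrite lte_mul_pinfty ?lee_fin ?powR_ge0.
- exact/measurable_EFinP/measurable_norm_powR.
Qed.

Lemma nLpZ p c f : 0 < p -> memLp p f ->
  nLp p (fun x => c * f x) = `|c| * nLp p f.
Proof.
move=> p0 fp; have mf := fp.1; rewrite /nLp.
under eq_integral do rewrite normrM powRM// EFinM.
rewrite ge0_integralZl_EFin ?powR_ge0//.
- rewrite fineM// ?memLp_fin//= powRM ?powR_ge0//.
    by rewrite -powRrM mulfV ?gt_eqF// powRr1.
  exact/fine_ge0/int_powR_ge0.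
- exact/measurable_EFinP/measurable_norm_powR.
Qed.

Lemma nLp_norm p f : nLp p (fun x => `|f x|) = nLp p f.
Proof. by rewrite /nLp; under eq_integral do rewrite normr_id. Qed.

(** Integrability of the product is recorded with the bound because the real-valued integral is
    linear on integrable functions only. *)
Lemma hoelder_integrable p q f g : 0 < p -> 0 < q -> p^-1 + q^-1 = 1 ->
  memLp p f -> memLp q g ->
  mu.-integrable setT (fun x => (f x * g x)%:E) /\
  \int[mu]_x `|f x * g x| <= nLp p f * nLp q g.
Proof.
move=> p0 q0 pq fp gq.
have := hoelder mu fp.1 gq.1 p0 q0 pq.
rewrite Lnorm1 (LnormEnLp p f fp) (LnormEnLp q g gq) -EFinM => H.
split.
  apply/integrableP; split.
    by apply/measurable_EFinP; apply: measurable_funM; [case: fp|case: gq].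
  exact: le_lt_trans H (ltry _).
rewrite -lee_fin /Rintegral fineK//; rewrite ge0_fin_numE.
  exact: le_lt_trans H (ltry _).
by apply: integral_ge0 => x _; rewrite lee_fin.
Qed.

Lemma hoelder_Rintegral p q f g : 0 < p -> 0 < q -> p^-1 + q^-1 = 1 ->
  memLp p f -> memLp q g ->
  `|\int[mu]_x (f x * g x)| <= nLp p f * nLp q g.
Proof.
move=> p0 q0 pq fp gq; have [i H] := hoelder_integrable p q f g p0 q0 pq fp gq.
by apply: le_trans H; exact: le_normr_Rintegral.
Qed.

Lemma minkowski_nLp p f g : 1 <= p -> memLp p f -> memLp p g ->
  memLp p (fun x => f x + g x) /\ nLp p (fun x => f x + g x) <= nLp p f + nLp p g.
Proof.
move=> p1 fp gp; have := minkowski_EFin mu fp.1 gp.1 p1.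
rewrite (LnormEnLp p f fp) (LnormEnLp p g gp) -EFinD => H.
have pfg : memLp p (fun x => f x + g x).
  split; first by apply: measurable_funD; [case: fp|case: gp].
  have : (Lnorm mu p%:E (EFin \o (fun x => f x + g x)%R) < +oo)%E.
    exact: le_lt_trans H (ltry _).
  rewrite LnormE => /lty_poweRy; apply.
  by rewrite invr_eq0 gt_eqF// (lt_le_trans _ p1).
by split => //; rewrite -lee_fin -LnormEnLp.
Qed.

Lemma nLp_powR_fun p k f : 0 < k -> 0 < p ->
  nLp (p / k) (fun x => `|f x| `^ k) = nLp p f `^ k.
Proof.
move=> k0 p0; rewrite /nLp.
under eq_integral do rewrite ger0_norm ?powR_ge0// -powRrM mulrCA mulfV ?gt_eqF// mulr1.
by rewrite -powRrM invf_div mulrC.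
Qed.

Lemma memLp_powR_fun p k f : 0 < k -> 0 < p -> memLp p f ->
  memLp (p / k) (fun x => `|f x| `^ k).
Proof.
move=> k0 p0 [mf fy]; split; first exact: measurable_norm_powR.
by under eq_integral do rewrite ger0_norm ?powR_ge0// -powRrM mulrCA mulfV ?gt_eqF// mulr1.
Qed.

Opaque nLp.

(* Hoelder with exponents s - 1 and (s - 1) / (s - 2), applied to the r-th powers. *)
Lemma hoelder_conj_exp s f h : 2 < s -> memLp s f -> memLp s h ->
  memLp (conj_exp s) (fun x => `|h x| `^ (s - 2) * f x) /\
  nLp (conj_exp s) (fun x => `|h x| `^ (s - 2) * f x) <= nLp s h `^ (s - 2) * nLp s f.
Proof.
move=> s2 fs hs; have s0 : 0 < s by lra.
have s10 : s - 1 != 0 by rewrite gt_eqF; lra.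
have s20 : s - 2 != 0 by rewrite gt_eqF; lra.
have s00 : s != 0 by rewrite gt_eqF.
set r := conj_exp s; have r0 : 0 < r by rewrite divr_gt0; lra.
have fr := memLp_powR_fun s r f r0 s0 fs.
have srE : s / r = s - 1 by rewrite /r /conj_exp invf_div mulrCA mulfV// mulr1.
have kr0 : 0 < (s - 2) * r by rewrite mulr_gt0//; lra.
have hr := memLp_powR_fun s ((s - 2) * r) h kr0 s0 hs.
have skE : s / ((s - 2) * r) = (s - 1) / (s - 2) by rewrite /r /conj_exp; field; rewrite s20 s10.
rewrite srE in fr; rewrite skE in hr.
have [|||i H] := hoelder_integrable _ _ _ _ _ _ _ hr fr.
- by rewrite divr_gt0; lra.
- by lra.
- by field; rewrite s10 s20.
have E x : (`| `|h x| `^ (s - 2) * f x| `^ r) = `|h x| `^ ((s - 2) * r) * `|f x| `^ r.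
  by rewrite normrM ger0_norm ?powR_ge0// powRM ?powR_ge0// -powRrM.
have ifin : (\int[mu]_x (`| `|h x| `^ (s - 2) * f x| `^ r)%:E < +oo)%E.
  under eq_integral do rewrite E.
  by have := integrable_lty measurableT i.
split.
  split => //; apply: measurable_funM; last by case: fs.
  by apply: measurable_norm_powR; case: hs.
(* Writing the target as an [r]-th root reduces the claim to monotonicity of the root, applied to
   the bound [H] on the [r]-th powers. *)
have E2 (a b : R) : 0 <= b -> a `^ (s - 2) * b = (a `^ ((s - 2) * r) * b `^ r) `^ r^-1.
  move=> b0; rewrite powRM ?powR_ge0//.
  have r00 : r != 0 by rewrite gt_eqF.
  by rewrite -!powRrM -mulrA (mulfV r00) mulr1 (powRr1 b0).
have Ef := nLp_powR_fun s r f r0 s0.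
have Eh := nLp_powR_fun s ((s - 2) * r) h kr0 s0.
rewrite srE in Ef; rewrite skE in Eh; rewrite Ef Eh in H.
rewrite (E2 _ _ (nLp_ge0 s f)) [leLHS]nLpE.
apply: ge0_ler_powR.
- by rewrite invr_ge0 ltW.
- by rewrite nnegrE; apply/fine_ge0; apply: int_powR_ge0.
- by rewrite nnegrE mulr_ge0 ?powR_ge0.
apply: le_trans H; rewrite le_eqVlt; apply/orP; left; apply/eqP.
congr fine; apply: eq_integral => x _; rewrite E.
by rewrite [in RHS]ger0_norm// mulr_ge0 ?powR_ge0.
Qed.

End Lebesgue_norms.

(** Tonelli's theorem exchanges adjacent variables, so three exchanges are made: [t] with [y], [x]
    with [y], then [t] with [x]. The primitive in the first variable calls for this, since the other
    coordinates [t] are integrated between [x] and [y]. *)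
Lemma tonelli_exchange13 d1 d3 (T1 : measurableType d1) (T3 : measurableType d3)
    (R : realType) (m1 : {sigma_finite_measure set T1 -> \bar R})
    (m3 : {sigma_finite_measure set T3 -> \bar R}) (k : T1 * T1 * T3 -> \bar R) :
  measurable_fun [set: T1 * T1 * T3] k -> (forall z, (0 <= k z)%E) ->
  (\int[m1]_x \int[m3]_t \int[m1]_y k (x, y, t) =
   \int[m1]_y \int[m3]_t \int[m1]_x k (x, y, t))%E.
Proof.
move=> mk k0.
(* The parameter [h] lets one statement serve for the first and the last exchange, where the two
   variables of type [T1] trade places. *)
have swap1 (h : T1 * T1 -> T3 -> T1 * T1 * T3) (x : T1) :
    measurable_fun setT (fun z : T3 * T1 => h (x, z.2) z.1) ->
    (\int[m3]_t \int[m1]_y k (h (x, y) t) = \int[m1]_y \int[m3]_t k (h (x, y) t))%E.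
  move=> mh; have := @fubini_tonelli _ _ _ _ _ m3 m1 (fun z => k (h (x, z.2) z.1)).
  by apply => //; exact: (measurableT_comp mk mh).
transitivity (\int[m1]_x \int[m1]_y \int[m3]_t k (x, y, t))%E.
  apply: eq_integral => x _; apply: (swap1 (fun a t => (a, t))).
  apply/measurable_fun_pair => /=; last exact: measurable_fst.
  by apply/measurable_fun_pair => /=; [exact: measurable_cst|exact: measurable_snd].
transitivity (\int[m1]_y \int[m1]_x \int[m3]_t k (x, y, t))%E; last first.
  apply: eq_integral => y _; apply/esym.
  apply: (swap1 (fun a t => ((a.2, a.1), t))).
  apply/measurable_fun_pair => /=; last exact: measurable_fst.
  by apply/measurable_fun_pair => /=; [exact: measurable_snd|exact: measurable_cst].
have := @fubini_tonelli _ _ _ _ _ m1 m1 (fun z => \int[m3]_t k (z, t))%E.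
apply.
- exact: (measurable_fun_fubini_tonelli_F (m2 := m3) k mk k0).
- by move=> z; exact: integral_ge0.
Qed.

(** * Boxes have finite measure *)

Section box.
Variables (R : realType) (K : R).

Definition box n : set (n.-tuple R) := [set t | forall i, `|tnth t i| <= K].

Lemma measurable_box n : measurable (box n).
Proof.
rewrite (_ : box n = \bigcap_(i : 'I_n) [set t | `[- K, K]%classic (tnth t i)]).
  apply: fin_bigcap_measurable => // i _.
  rewrite -[X in measurable X]setTI.
  exact: (@measurable_tnth _ R n i measurableT _ (measurable_itv _)).
apply/seteqP; split => t /= H i; first by move=> _ /=; rewrite in_itv/= -ler_norml; exact: H.
by have := H i I; rewrite /= in_itv/= -ler_norml.
Qed.

Lemma box_cons n x (t : n.-tuple R) :
  \1_(box n.+1) (cons_tuple x t) = \1_`[- K, K] x * \1_(box n) t :> R.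
Proof.
rewrite !indicE -natrM mulnb; congr (nat_of_bool _)%:R.
apply/idP/andP; rewrite !inE/= in_itv/= -ler_norml.
  move=> H; split; first exact: (H ord0).
  by move=> i; have := H (lift ord0 i); rewrite tnthS.
by move=> [Kx H] i; case: (unliftP ord0 i) => [j|] ->; rewrite ?tnthS//; exact: H.
Qed.

(** Induction on the dimension: by [box_cons] the indicator is a product, so the inner integral is a
    constant times the indicator of an interval. Bounded functions supported in the box are then
    integrable. *)
Lemma lebesgue_box_lty n : (lebesgue_tuple R n (box n) < +oo)%E.
Proof.
elim: n => [|n IH].
  by rewrite /= diracE; case: (_ \in _); rewrite ltry.
have mb k := measurable_box k.
rewrite -(setIT (box n.+1)) -(integral_indic _ measurableT (mb _)).
have mi k : measurable_fun [set: k.-tuple R] (fun t => (\1_(box k) t)%:E : \bar R).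
  by apply/measurable_EFinP; apply: measurable_indic; exact: mb.
rewrite (ge0_integral_lebesgue_tupleS _ _ _ (mi n.+1))//.
under eq_integral => x _.
  under eq_integral do rewrite box_cons EFinM.
  rewrite (ge0_integralZl_EFin _ measurableT _ (mi n))//.
  rewrite (integral_indic _ measurableT (mb _)) setIT.
  over.
rewrite ge0_integralZr//=; last exact/measurable_EFinP/measurable_indic.
rewrite integral_indic// setIT lte_mul_pinfty//.
have E := lebesgue_measure_itv (`[- K, K] : interval R).
rewrite [X in X \is a fin_num]E /= lte_fin.
by case: ifP.
Qed.

End box.

(** * The primitive of a bounded source in the first variable *)

Section primitive.
Variables (R : realType) (m : nat) (K N : R) (f : m.+1.-tuple R -> R).
Hypothesis mf : measurable_fun [set: m.+1.-tuple R] f.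
Hypothesis K0 : 0 <= K.
Hypothesis f0 : forall t, 0 <= f t.
Hypothesis fN : forall t, f t <= N.
Hypothesis fK : forall t, ~ box R K m.+1 t -> f t = 0.

Local Notation lam := (@lebesgue_measure R).
Local Notation D1 := (measurableTypeR R).

Lemma measurable_cons_comp d (T : measurableType d) (g : m.+1.-tuple R -> R)
    (a : T -> R) (b : T -> m.-tuple R) : measurable_fun [set: m.+1.-tuple R] g ->
  measurable_fun [set: T] a -> measurable_fun [set: T] b ->
  measurable_fun [set: T] (fun z => g (cons_tuple (a z) (b z))).
Proof. by move=> mg ma mb; exact: (measurableT_comp mg (measurable_cons ma mb)). Qed.

Lemma measurable_ltr_nat d (T : measurableType d) (a b : T -> R) :
  measurable_fun [set: T] a -> measurable_fun [set: T] b ->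
  measurable_fun [set: T] (fun z => (a z < b z)%R%:R : R).
Proof.
move=> ma mb; rewrite (_ : (fun z => _) = fun z => if a z < b z then 1 else 0); last first.
  by apply/funext => z; case: ifP.
by apply: measurable_fun_ifT => //; exact: measurable_fun_ltr.
Qed.

Lemma measurable_typeR : measurable_fun [set: D1] (fun x : D1 => x : R).
Proof. exact: (@measurable_id _ D1). Qed.

(** The constraint [y < x] is a factor 0 or 1 of the integrand, not a domain of integration, so that
    the integrand is jointly measurable in all variables and Tonelli's theorem applies. *)
Definition prim_int (x : R) (t : m.-tuple R) : \bar R :=
  (\int[lam]_y (f (cons_tuple y t) * (y < x)%R%:R)%:E)%E.

Definition prim (t : m.+1.-tuple R) : R := fine (prim_int (thead t) (behead_tuple t)).

Lemma prim_cons x t : prim (cons_tuple x t) = fine (prim_int x t).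
Proof. by rewrite /prim; congr (fine (prim_int _ _)); exact: val_inj. Qed.

Lemma lebesgue_itvK : lam `[- K, K]%classic = (K *+ 2)%:E.
Proof.
have E := lebesgue_measure_itv (`[- K, K] : interval R).
rewrite [LHS]E /= lte_fin opprK mulr2n; case: ifPn => //.
rewrite -leNgt => H; suff -> : K = 0 by rewrite addr0.
by apply/eqP; rewrite eq_le K0 andbT; lra.
Qed.

Lemma fcons_out y t : y \notin `[- K, K] -> f (cons_tuple y t) = 0.
Proof.
move=> yK; apply: fK => /(_ ord0) H; move: yK; rewrite in_itv/= -ler_norml.
by rewrite H.
Qed.

Lemma fcons_le_indic y t : f (cons_tuple y t) <= N * \1_`[- K, K] y.
Proof.
rewrite indicE mem_setE; case: (boolP (y \in _)) => yK; first by rewrite mulr1.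
by rewrite mulr0 fcons_out.
Qed.

Lemma prim_int_ge0 x t : (0 <= prim_int x t)%E.
Proof. by apply: integral_ge0 => y _; rewrite lee_fin mulr_ge0. Qed.

Lemma source_bound_ge0 : 0 <= N.
Proof. exact: le_trans (f0 (nseq_tuple _ 0)) (fN _). Qed.

Lemma measurable_slice t : measurable_fun [set: D1] (fun y : D1 => f (cons_tuple y t)).
Proof. by apply: measurable_cons_comp => //; exact: measurable_cst. Qed.

Lemma measurable_lt_indicator (x : R) : measurable_fun [set: D1] (fun y : D1 => (y < x)%R%:R : R).
Proof. exact: (@measurable_ltr_nat _ D1 id (cst x)). Qed.

Lemma prim_int_le x t : (prim_int x t <= (N * K *+ 2)%:E)%E.
Proof.
rewrite -mulrnAr EFinM -lebesgue_itvK.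
rewrite -[X in lam X](setIT `[- K, K]%classic) -(integral_indic _ measurableT)//.
rewrite -ge0_integralZl_EFin ?source_bound_ge0//; last exact/measurable_EFinP/measurable_indic.
apply: ge0_le_integral => //.
- by move=> y _; rewrite lee_fin mulr_ge0.
- by apply/measurable_EFinP/measurable_funM; [exact: measurable_slice|exact: measurable_lt_indicator].
- apply: measurable_funeM; exact/measurable_EFinP/measurable_indic.
move=> y _; rewrite -EFinM lee_fin; apply: le_trans (fcons_le_indic y t).
by rewrite ler_piMr// lern1 leq_b1.
Qed.

Lemma prim_int_fin x t : prim_int x t \is a fin_num.
Proof. by rewrite ge0_fin_numE ?prim_int_ge0//; exact: le_lt_trans (prim_int_le x t) (ltry _). Qed.

Lemma prim_ge0 t : 0 <= prim t.
Proof. exact/fine_ge0/prim_int_ge0. Qed.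

Lemma prim_le t : prim t <= N * K *+ 2.
Proof. by rewrite -lee_fin fineK ?prim_int_fin// prim_int_le. Qed.

(** A partial integral of a nonnegative jointly measurable kernel is measurable in the remaining
    variables; the kernel [k] is arranged with the integration variable last. *)
Lemma measurable_prim : measurable_fun [set: m.+1.-tuple R] prim.
Proof.
pose k (z : D1 * m.-tuple R * D1) : \bar R := (f (cons_tuple z.2 z.1.2) * (z.2 < z.1.1)%R%:R)%:E.
have mk : measurable_fun setT k.
  apply/measurable_EFinP; apply: measurable_funM.
    apply: (measurable_cons_comp _ (D1 * m.-tuple R * D1)%type f snd (snd \o fst)) => //.
    exact: (measurableT_comp measurable_snd measurable_fst).
  apply: (measurable_ltr_nat _ (D1 * m.-tuple R * D1)%type snd (fst \o fst)) => //.
  exact: (measurableT_comp measurable_typeR (measurableT_comp measurable_fst measurable_fst)).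
have k0 z : (0 <= k z)%E by rewrite lee_fin mulr_ge0.
have mF := measurable_fun_fubini_tonelli_F (m2 := lam) k mk k0.
have mu : measurable_fun [set: m.+1.-tuple R]
    (@uncons_pair R m : _ -> (D1 * m.-tuple R)%type).
  exact: measurable_uncons_pair.
have := measurableT_comp (@fine_measurable R setT measurableT) (measurableT_comp mF mu).
by [].
Qed.

(** This is the formal adjoint of [prim_int], as [prim_tonelli] shows. *)
Definition tail_int (psi : m.+1.-tuple R -> R) (y : R) (t : m.-tuple R) : \bar R :=
  (\int[lam]_x (psi (cons_tuple x t) * (y < x)%R%:R)%:E)%E.

Lemma tail_int_ge0 (psi : m.+1.-tuple R -> R) y t : (forall t, 0 <= psi t) -> (0 <= tail_int psi y t)%E.
Proof. by move=> p0; apply: integral_ge0 => x _; rewrite lee_fin mulr_ge0. Qed.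

Lemma measurable_tail_int (psi : m.+1.-tuple R -> R) : measurable_fun [set: m.+1.-tuple R] psi ->
  (forall t, 0 <= psi t) ->
  measurable_fun [set: m.+1.-tuple R] (fun t => tail_int psi (thead t) (behead_tuple t)).
Proof.
move=> mp p0.
pose k (z : D1 * m.-tuple R * D1) : \bar R := (psi (cons_tuple z.2 z.1.2) * (z.1.1 < z.2)%R%:R)%:E.
have mk : measurable_fun setT k.
  apply/measurable_EFinP; apply: measurable_funM.
    apply: (measurable_cons_comp _ (D1 * m.-tuple R * D1)%type psi snd (snd \o fst)) => //.
    exact: (measurableT_comp measurable_snd measurable_fst).
  apply: (measurable_ltr_nat _ (D1 * m.-tuple R * D1)%type (fst \o fst) snd) => //.
  exact: (measurableT_comp measurable_typeR (measurableT_comp measurable_fst measurable_fst)).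
have k0 z : (0 <= k z)%E by rewrite lee_fin mulr_ge0.
have mF := measurable_fun_fubini_tonelli_F (m2 := lam) k mk k0.
have mu : measurable_fun [set: m.+1.-tuple R]
    (@uncons_pair R m : _ -> (D1 * m.-tuple R)%type).
  exact: measurable_uncons_pair.
exact: (measurableT_comp mF mu).
Qed.

Lemma tail_int_cons psi x t :
  tail_int psi (thead (cons_tuple x t)) (behead_tuple (cons_tuple x t)) = tail_int psi x t.
Proof. by congr (tail_int _ _ _); exact: val_inj. Qed.

(** The region [y < x] is swept in the other order. The right-hand side stays in the extended reals
    because the tail of a nonnegative [psi] may be infinite. *)
Lemma prim_tonelli (psi : m.+1.-tuple R -> R) : measurable_fun [set: m.+1.-tuple R] psi ->
  (forall t, 0 <= psi t) ->
  (\int[lebesgue_tuple R m.+1]_t (prim t * psi t)%:E =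
   \int[lebesgue_tuple R m.+1]_t ((f t)%:E * tail_int psi (thead t) (behead_tuple t)))%E.
Proof.
move=> mp p0.
rewrite ge0_integral_lebesgue_tupleS; last first.
- by move=> t; rewrite lee_fin mulr_ge0// prim_ge0.
- by apply/measurable_EFinP/measurable_funM => //; exact: measurable_prim.
rewrite ge0_integral_lebesgue_tupleS; last first.
- by move=> t; rewrite mule_ge0 ?lee_fin// tail_int_ge0.
- by apply: emeasurable_funM; [exact/measurable_EFinP|exact: measurable_tail_int].
pose k (z : D1 * D1 * m.-tuple R) : \bar R :=
  (f (cons_tuple z.1.2 z.2) * (z.1.2 < z.1.1)%R%:R * psi (cons_tuple z.1.1 z.2))%:E.
have k0 z : (0 <= k z)%E by rewrite lee_fin !mulr_ge0.
have m11 : measurable_fun [set: D1 * D1 * m.-tuple R] (fun z => z.1.1 : R).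
  exact: (measurableT_comp measurable_typeR (measurableT_comp measurable_fst measurable_fst)).
have m12 : measurable_fun [set: D1 * D1 * m.-tuple R] (fun z => z.1.2 : R).
  exact: (measurableT_comp measurable_typeR (measurableT_comp measurable_snd measurable_fst)).
have mk : measurable_fun setT k.
  apply/measurable_EFinP; apply: measurable_funM; first apply: measurable_funM.
  - exact: (measurable_cons_comp _ _ f (fun z => z.1.2) snd).
  - exact: (measurable_ltr_nat _ _ (fun z => z.1.2) (fun z => z.1.1)).
  - exact: (measurable_cons_comp _ _ psi (fun z => z.1.1) snd).
transitivity (\int[lam]_x \int[lebesgue_tuple R m]_t \int[lam]_y k (x, y, t))%E.
  apply: eq_integral => x _; apply: eq_integral => t _.
  rewrite prim_cons EFinM fineK ?prim_int_fin// /prim_int.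
  rewrite -ge0_integralZr//.
  - by apply/measurable_EFinP/measurable_funM; [exact: measurable_slice|exact: measurable_lt_indicator].
  - by move=> y _; rewrite lee_fin mulr_ge0.
  by rewrite lee_fin.
rewrite (tonelli_exchange13 _ _ _ _ _ lam (lebesgue_tuple R m) k mk k0).
apply: eq_integral => y _; apply: eq_integral => t _.
rewrite tail_int_cons /tail_int -ge0_integralZl_EFin//; last 2 first.
- by move=> x _; rewrite lee_fin mulr_ge0.
- apply/measurable_EFinP/measurable_funM.
    exact: (measurable_cons_comp _ D1 psi id (cst t)).
  exact: (@measurable_ltr_nat _ D1 (cst y) id).
by apply: eq_integral => x _; rewrite -EFinM /k/= mulrAC mulrA.
Qed.

(** Hölder's inequality on a line against the indicator of [[-K, K]], whose [L^r] norm is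
    [(2K)^(1/r)]; raised to the power [s] it gives [(2K)^(s-1)], since [s / r = s - 1]. *)
Lemma prim_powR_le s x t : 2 < s ->
  fine (prim_int x t) `^ s <=
  (K *+ 2) `^ (s - 1) * fine (\int[lam]_y (f (cons_tuple y t) `^ s)%:E).
Proof.
move=> s2; have s0 : 0 < s by lra.
have s10 : s - 1 != 0 by rewrite gt_eqF; lra.
have s00 : s != 0 by rewrite gt_eqF.
have r0 : 0 < conj_exp s by rewrite divr_gt0; lra.
have K20 : 0 <= K *+ 2 by rewrite mulrn_wge0.
pose g (y : D1) : R := \1_`[- K, K] y.
have gE p : 0 < p -> (\int[lam]_y (`|g y| `^ p)%:E)%E = (K *+ 2)%:E.
  move=> p0; rewrite -lebesgue_itvK -[X in lam X](setIT `[- K, K]%classic).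
  rewrite -(integral_indic _ measurableT)//; apply: eq_integral => y _; congr (_%:E).
  by rewrite /g indicE; case: (_ \in _); rewrite ?normr1 ?powR1// normr0 powR0// gt_eqF.
have mg : measurable_fun setT g by exact: measurable_indic.
have gp p : 0 < p -> memLp _ _ R lam p g by move=> p0; split => //; rewrite gE// ltry.
have fp : memLp _ _ R lam s (fun y : D1 => f (cons_tuple y t)).
  apply: (memLp_le _ _ _ _ _ _ (fun y => N * g y)) => //; [exact: ltW|exact: measurable_slice| |].
    by apply: memLpZ; exact: gp.
  by move=> y; rewrite !ger0_norm ?mulr_ge0 ?source_bound_ge0//; exact: fcons_le_indic.
pose f1 (y : D1) := f (cons_tuple y t) * (y < x)%R%:R.
have f1le y : `|f1 y| <= `|f (cons_tuple y t)|.
  by rewrite normrM ler_piMr// ger0_norm// lern1 leq_b1.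
have mf1 : measurable_fun setT f1 by apply: measurable_funM; [exact: measurable_slice|exact: measurable_lt_indicator].
have f1p : memLp _ _ R lam s f1.
  by apply: (memLp_le _ _ _ _ _ _ _ _ _ fp) => //; exact: ltW.
have [|H1 H2] := hoelder_integrable _ _ R lam s (conj_exp s) f1 g s0 r0 _ f1p (gp _ r0).
  by rewrite /conj_exp; field; rewrite s10.
(* Inserting the indicator changes nothing, since the slice of [f] vanishes outside [[-K, K]]. *)
have f1g y : `|f1 y * g y| = f1 y.
  rewrite ger0_norm ?mulr_ge0//; rewrite /f1 /g indicE mem_setE.
  case: (boolP (y \in _)) => yK; first by rewrite mulr1.
  by rewrite fcons_out// !mul0r.
have -> : fine (prim_int x t) = \int[lam]_y `|f1 y * g y|.
  by rewrite /Rintegral /prim_int; congr fine; apply: eq_integral => y _; rewrite f1g.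
have H3 : nLp _ _ R lam s f1 <= nLp _ _ R lam s (fun y : D1 => f (cons_tuple y t)).
  exact: (nLp_le _ _ R lam s _ _ (ltW s0) mf1 fp f1le).
have gn : nLp _ _ R lam (conj_exp s) g = (K *+ 2) `^ (conj_exp s)^-1 by rewrite nLpE gE.
rewrite gn in H2.
have H4 := le_trans H2 (ler_wpM2r (powR_ge0 _ _) H3).
set A := \int[lam]_y `|f1 y * g y| in H4 *.
have A0 : A \in Num.nneg by rewrite nnegrE Rintegral_ge0.
have E4 := nLp_powR _ _ R lam s (fun y : D1 => f (cons_tuple y t)) s0.
have B0 := nLp_ge0 _ _ R lam s (fun y : D1 => f (cons_tuple y t)).
move: H4 E4 B0; set B := nLp _ _ _ _ _ _ => H4 E4 B0.
have C0 : B * (K *+ 2) `^ (conj_exp s)^-1 \in Num.nneg by rewrite nnegrE mulr_ge0 ?powR_ge0.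
apply: le_trans (ge0_ler_powR (ltW s0) A0 C0 H4) _.
rewrite powRM ?powR_ge0// E4 mulrC -powRrM.
have -> : (conj_exp s)^-1 * s = s - 1 by rewrite /conj_exp; field; rewrite s10 s00.
apply: ler_wpM2l; first exact: powR_ge0.
rewrite (eq_integral (fun y : D1 => (f (cons_tuple y t) `^ s)%:E))//.
by move=> y _; rewrite (ger0_norm (f0 _)).
Qed.

End primitive.

(** * Test functions and their one-dimensional slices *)

Section test_functions.
Variables (R : realType) (n : nat) (O : set 'rV[R]_n) (phi : 'rV[R]_n -> R).
Hypothesis tphi : test_fun O phi.

Lemma test_fun_continuous : continuous phi.
Proof. by case: tphi => sm _; have [] := sm [::]. Qed.

Lemma test_fun_derivable x v : derivable phi x v.
Proof. by case: tphi => sm _; have [_ +] := sm [::]; exact. Qed.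

Lemma test_fun_continuous_derive v : continuous (fun x => 'D_v phi x).
Proof. by case: tphi => sm _; have [] := sm [:: v]. Qed.

Lemma test_fun_out x : ~ O x -> phi x = 0.
Proof. by case: tphi => _ [K [_ [KO K0]]] Ox; apply: K0 => /KO. Qed.

(** The complement of a compact set is open, so [phi] vanishes on a whole neighbourhood of [x]. *)
Lemma derive_compact_support K v x : compact K -> (forall x, ~ K x -> phi x = 0) ->
  ~ K x -> 'D_v phi x = 0.
Proof.
move=> cK K0 Kx; rewrite (@near_eq_derive _ _ _ phi (cst 0)) ?derive_cst//.
have cl : closed K by apply: compact_closed => //; exact: norm_hausdorff.
have oC : open (~` K) by exact: closed_openC.
have : nbhs x (~` K) by exact: open_nbhs_nbhs.
by apply: filterS => y /K0.
Qed.

Lemma test_fun_derive_out v x : ~ O x -> 'D_v phi x = 0.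
Proof.
case: tphi => _ [K [cK [KO K0]]] Ox.
by apply: (derive_compact_support K) => // /KO.
Qed.

Lemma continuous_compact_support_bounded (g : 'rV[R]_n -> R) K : compact K ->
  continuous g -> (forall x, ~ K x -> g x = 0) -> exists L, 0 < L /\ forall x, `|g x| <= L.
Proof.
move=> cK cg g0.
have : compact (g @` K) by apply: continuous_compact => //; exact: continuous_subspaceT.
move=> /compact_bounded /pinfty_ex_gt0 [L L0 HL]; exists L; split => // x.
have [Kx|Kx] := pselect (K x); first by apply: HL; exists x.
by rewrite g0// normr0 ltW.
Qed.

Lemma test_fun_bounded : exists L, 0 < L /\ forall x, `|phi x| <= L.
Proof.
case: tphi => _ [K [cK [_ K0]]].
exact: (continuous_compact_support_bounded _ K cK test_fun_continuous).
Qed.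

Lemma test_fun_derive_bounded v : exists L, 0 < L /\ forall x, `|'D_v phi x| <= L.
Proof.
case: (tphi) => _ [K [cK [_ K0]]].
apply: (continuous_compact_support_bounded _ K cK (test_fun_continuous_derive v)).
by move=> x Kx; exact: derive_compact_support Kx.
Qed.

End test_functions.

Section slice.
Variables (R : realType) (m : nat) (phi : 'rV[R]_m.+1 -> R) (t : m.-tuple R).

Local Notation e0 := (delta_mx 0 0 : 'rV[R]_m.+1).
Let h (x : R) : R := phi (rV_of_tuple (cons_tuple x t)).

Lemma rV_of_tuple_consD (k x : R) : rV_of_tuple (cons_tuple (k + x) t) =
  k *: e0 + rV_of_tuple (cons_tuple x t).
Proof.
apply/rowP => i; rewrite !mxE eqxx/=.
case: (unliftP 0 i) => [j|] ->.
  by rewrite !tnthS (negbTE (_ : lift 0 j != 0)) ?mulr0 ?add0r// eq_sym neq_lift.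
by rewrite eqxx mulr1.
Qed.

(** Since the difference quotients of the slice and of [phi] along the first axis are one and the
    same function, derivability and the derivative transfer by rewriting. *)
Lemma slice_quotient x : (fun k => k^-1 *: (h (k *: 1 + x) - h x)) =
  (fun k => k^-1 *: (phi (k *: e0 + rV_of_tuple (cons_tuple x t)) - phi (rV_of_tuple (cons_tuple x t)))).
Proof.
by apply/funext => k; rewrite /h -rV_of_tuple_consD /GRing.scale/= mulr1.
Qed.

Lemma slice_derivable x : derivable phi (rV_of_tuple (cons_tuple x t)) e0 ->
  derivable h x 1.
Proof. by rewrite /derivable /= slice_quotient. Qed.

Lemma slice_derive x : derive1 h x = 'D_e0 phi (rV_of_tuple (cons_tuple x t)).
Proof. by rewrite derive1E /derive /= slice_quotient. Qed.

Lemma continuous_slice : continuous (fun x : R => rV_of_tuple (cons_tuple x t)).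
Proof.
move=> x; rewrite (_ : (fun _ => _) = fun y => y *: e0 + rV_of_tuple (cons_tuple 0 t)).
  apply: cvgD; last exact: cvg_cst.
  by apply: cvgZr_tmp; exact: cvg_id.
by apply/funext => y; rewrite -rV_of_tuple_consD addr0.
Qed.

End slice.

Lemma finite_support_integrable d (T : measurableType d) (R : realType)
    (mu : {measure set T -> \bar R}) (A : set T) (C : R) (g : T -> R) :
  measurable A -> (mu A < +oo)%E -> measurable_fun [set: T] g ->
  (forall x, `|g x| <= C) -> (forall x, ~ A x -> g x = 0) ->
  mu.-integrable setT (EFin \o g).
Proof.
move=> mA Afin mg gC g0.
have -> : EFin \o g = (EFin \o g) \_ A.
  apply/funext => x; rewrite /patch; case: ifPn => // /negP; rewrite inE => Ax.
  by rewrite /= g0.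
rewrite -integrable_mkcond//; apply: measurable_bounded_integrable => //.
  exact: measurable_funS mg.
by exists C; split; [exact: num_real|move=> M CM x _; exact: le_trans (gC x) (ltW CM)].
Qed.

(** * Norm and weak derivative of the primitive *)

Section divergence.
Variables (R : realType) (m : nat) (K N : R) (f : m.+1.-tuple R -> R).
Hypothesis mf : measurable_fun [set: m.+1.-tuple R] f.
Hypothesis K0 : 0 <= K.
Hypothesis f0 : forall t, 0 <= f t.
Hypothesis fN : forall t, f t <= N.
Hypothesis fK : forall t, ~ box R K m.+1 t -> f t = 0.

Local Notation lam := (@lebesgue_measure R).
Local Notation D1 := (measurableTypeR R).
Local Notation mu := (lebesgue_tuple R m.+1).

Lemma measurable_thead_indic :
  measurable_fun [set: m.+1.-tuple R] (fun t => \1_(`[- K, K]%classic : set R) (thead t) : R).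
Proof.
apply: (@measurableT_comp _ _ _ _ _ _ (\1_(`[- K, K]%classic : set R) : R -> R)).
  by apply: measurable_indic; exact: measurable_itv.
exact: measurable_tnth.
Qed.

(** Beyond [K] the primitive is constant in the first variable, so its norm has to be cut to
    [[-K, K]]. Integrating [prim_powR_le] over that interval contributes the last factor of
    [(2K)^s]. *)
Lemma prim_Ls s : 2 < s ->
  (\int[mu]_t (\1_(`[- K, K]%classic : set R) (thead t) * prim R m f t `^ s)%:E <=
   ((K *+ 2) `^ s)%:E * \int[mu]_t (f t `^ s)%:E)%E.
Proof.
move=> s2; have s0 : 0 < s by lra.
have K20 : 0 <= K *+ 2 by rewrite mulrn_wge0.
have mprim : measurable_fun [set: m.+1.-tuple R] (prim R m f) by exact: measurable_prim.
have mps : measurable_fun [set: m.+1.-tuple R] (fun t => prim R m f t `^ s).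
  exact: (measurableT_comp (measurable_powR s) mprim).
have mfs : measurable_fun [set: m.+1.-tuple R] (fun t => f t `^ s).
  exact: (measurableT_comp (measurable_powR s) mf).
have mth := measurable_thead_indic.
pose I : \bar R := (\int[mu]_t (f t `^ s)%:E)%E.
pose J (t : m.-tuple R) : \bar R := (\int[lam]_y (f (cons_tuple y t) `^ s)%:E)%E.
have mJk : measurable_fun [set: m.-tuple R * D1] (fun z => (f (cons_tuple z.2 z.1) `^ s)%:E).
  apply/measurable_EFinP.
  exact: (measurable_cons_comp _ _ _ (m.-tuple R * D1)%type (fun t => f t `^ s) snd fst).
have k0 (z : m.-tuple R * D1) : (0 <= (f (cons_tuple z.2 z.1) `^ s)%:E)%E.
  by rewrite lee_fin powR_ge0.
have mJ : measurable_fun [set: m.-tuple R] J.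
  exact: (measurable_fun_fubini_tonelli_F (m2 := lam) _ mJk k0).
have J0 t : (0 <= J t)%E by apply: integral_ge0 => y _; rewrite lee_fin powR_ge0.
have IJ : I = (\int[lebesgue_tuple R m]_t J t)%E.
  rewrite /I ge0_integral_lebesgue_tupleS; last first.
  - by move=> t; rewrite lee_fin powR_ge0.
  - exact/measurable_EFinP.
  by apply/esym; exact: (@fubini_tonelli _ _ _ _ _ (lebesgue_tuple R m) lam _ mJk k0).
(* Finiteness allows [fine] to be removed from the line integral in [prim_powR_le]. *)
have Jfin t : J t \is a fin_num.
  rewrite ge0_fin_numE//.
  apply: (@le_lt_trans _ _ (\int[lam]_y (N `^ s * \1_`[- K, K] y)%:E)%E).
    apply: ge0_le_integral => //.
    + by move=> y _; rewrite lee_fin powR_ge0.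
    + apply/measurable_EFinP.
      exact: (measurable_cons_comp _ _ _ D1 (fun t => f t `^ s) id (cst t)).
    + by apply/measurable_EFinP/measurable_funM => //; exact: measurable_indic.
    move=> y _; rewrite lee_fin indicE mem_setE; case: (boolP (y \in _)) => yK.
      by rewrite mulr1 ge0_ler_powR ?nnegrE ?(ltW s0)//; exact: le_trans (fN (cons_tuple y t)).
    by rewrite mulr0 (fcons_out R m K f)// powR0// gt_eqF.
  under eq_integral do rewrite EFinM.
  rewrite ge0_integralZl_EFin ?powR_ge0//; last exact/measurable_EFinP/measurable_indic.
  rewrite integral_indic// setIT.
  have E := lebesgue_itvK R K K0; rewrite [X in (_ * X < _)%E]E.
  by rewrite -EFinM ltry.
rewrite ge0_integral_lebesgue_tupleS; last first.
- by move=> t; rewrite lee_fin mulr_ge0 ?powR_ge0.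
- by apply/measurable_EFinP/measurable_funM.
have I0 : (0 <= I)%E by apply: integral_ge0 => t _; rewrite lee_fin powR_ge0.
apply: (@le_trans _ _ (\int[lam]_x ((\1_`[- K, K] x * (K *+ 2) `^ (s - 1))%:E * I))%E).
  have mcl g x : measurable_fun [set: m.+1.-tuple R] g ->
      measurable_fun [set: m.-tuple R] (fun t => g (cons_tuple x t) : R).
    move=> mg; exact: (measurable_cons_comp _ _ _ _ g (cst x) id).
  pose G t := \1_(`[- K, K]%classic : set R) (thead t) * prim R m f t `^ s.
  have mG : measurable_fun [set: m.+1.-tuple R] G by exact: measurable_funM.
  have G0 t : 0 <= G t by rewrite mulr_ge0 ?powR_ge0.
  apply: ge0_le_integral => //.
  - by move=> x _; apply: integral_ge0 => t _; rewrite lee_fin; exact: G0.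
  - apply: (measurable_fun_fubini_tonelli_F (m2 := lebesgue_tuple R m)
      (fun z : D1 * m.-tuple R => (G (cons_tuple z.1 z.2))%:E)).
      apply/measurable_EFinP.
      exact: (measurable_cons_comp _ _ _ (D1 * m.-tuple R)%type G fst snd).
    by move=> z; rewrite lee_fin; exact: G0.
  - apply: emeasurable_funM; last exact: measurable_cst.
    by apply/measurable_EFinP/measurable_funM => //; exact: measurable_indic.
  move=> x _; rewrite IJ -ge0_integralZl//; last by rewrite lee_fin mulr_ge0 ?powR_ge0.
  apply: ge0_le_integral => //.
  - by move=> t _; rewrite lee_fin; exact: G0.
  - by apply/measurable_EFinP; apply: (mcl G).
  - exact: measurable_funeM.
  move=> t _; rewrite /G prim_cons -(fineK (Jfin t)) -EFinM lee_fin -mulrA.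
  by apply: ler_wpM2l => //; apply: (prim_powR_le R m K N).
rewrite ge0_integralZr//; last 2 first.
- by apply/measurable_EFinP/measurable_funM => //; exact: measurable_indic.
- by move=> x _; rewrite lee_fin mulr_ge0 ?powR_ge0.
apply: lee_wpmul2r => //.
under eq_integral do rewrite mulrC EFinM.
rewrite ge0_integralZl_EFin ?powR_ge0//; last exact/measurable_EFinP/measurable_indic.
rewrite integral_indic// setIT.
have E := lebesgue_itvK R K K0; rewrite [X in (_ * X <= _)%E]E.
by rewrite -EFinM lee_fin mulrC mulr_powRB1.
Qed.

Variables (O : set 'rV[R]_m.+1) (phi : 'rV[R]_m.+1 -> R).
Hypothesis OK : forall t, O (rV_of_tuple t) -> box R K m.+1 t.
Hypothesis tphi : test_fun O phi.

Local Notation e0 := (delta_mx 0 0 : 'rV[R]_m.+1).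
Local Notation dphi := (fun t : m.+1.-tuple R => 'D_e0 phi (rV_of_tuple t)).
Local Notation dp := (fun t : m.+1.-tuple R => Num.max ('D_e0 phi (rV_of_tuple t)) 0).
Local Notation dn := (fun t : m.+1.-tuple R => Num.max (- 'D_e0 phi (rV_of_tuple t)) 0).

Lemma measurable_dphi : measurable_fun [set: m.+1.-tuple R] dphi.
Proof. exact: continuous_measurable_tuple (test_fun_continuous_derive R _ O phi tphi e0). Qed.

Lemma measurable_dp : measurable_fun [set: m.+1.-tuple R] dp.
Proof. by apply: measurable_maxr; [exact: measurable_dphi|exact: measurable_cst]. Qed.

Lemma measurable_dn : measurable_fun [set: m.+1.-tuple R] dn.
Proof.
apply: measurable_maxr; last exact: measurable_cst.
by apply: measurableT_comp => //; exact: measurable_dphi.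
Qed.

Lemma dphi_out t : ~ box R K m.+1 t -> dphi t = 0.
Proof. by move=> bt; apply: (test_fun_derive_out R _ O phi tphi) => /OK. Qed.

Lemma dpn t : dp t - dn t = dphi t.
Proof. by rewrite /Num.max; case: ltP => ?; case: ltP => ?; lra. Qed.

Lemma bounded_slice_integrable (psi : m.+1.-tuple R -> R) C (b : R -> R) t :
  measurable_fun [set: m.+1.-tuple R] psi ->
  (forall t, ~ box R K m.+1 t -> psi t = 0) -> (forall t, `|psi t| <= C) ->
  measurable_fun [set: D1] (b : D1 -> R) -> (forall x, `|b x| <= 1) ->
  lam.-integrable setT (fun x => (psi (cons_tuple x t) * b x)%:E).
Proof.
move=> mp pK pC mb b1.
apply: (@finite_support_integrable _ _ R lam `[- K, K]%classic C
  (fun x => psi (cons_tuple x t) * b x)) => //.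
- have E := lebesgue_itvK R K K0; rewrite [X in (X < _)%E]E ltry//.
- apply: measurable_funM => //; exact: (measurable_cons_comp _ _ _ D1 psi id (cst t)).
- move=> x; rewrite normrM; apply: le_trans (pC (cons_tuple x t)).
  by rewrite ler_piMr.
- move=> x xK; rewrite pK ?mul0r// => /(_ ord0) H; apply: xK.
  by rewrite /= in_itv/= -ler_norml.
Qed.

Lemma measurable_gt_indicator (y : R) : measurable_fun [set: D1] (fun x : D1 => (y < x)%R%:R : R).
Proof. exact: (@measurable_ltr_nat _ _ D1 (cst y) id). Qed.

Lemma norm_nat_bool (b : bool) : `|b%:R : R| <= 1.
Proof. by case: b; rewrite ?normr1 ?normr0. Qed.

(** Fundamental theorem of calculus from [y] up to a point outside the box, where [phi] vanishes. *)
Lemma dphi_tail y t :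
  \int[lam]_x (dphi (cons_tuple x t) * (y < x)%R%:R) = - phi (rV_of_tuple (cons_tuple y t)).
Proof.
pose h (x : R) : R := phi (rV_of_tuple (cons_tuple x t)).
(* The point [b] lies strictly beyond [y], for a nondegenerate interval, and strictly beyond [K],
   for [phi] and its derivative to vanish from [b] on. *)
pose b := Num.max y K + 1.
have yb : y < b by rewrite /b ltr_pwDr// le_max lexx.
have Kb : K < b by rewrite /b ltr_pwDr// le_max lexx orbT.
have out x : K < x -> ~ box R K m.+1 (cons_tuple x t).
  by move=> Kx /(_ ord0); rewrite (tnth_nth 0)/= => /(le_trans (ler_norm _)); rewrite leNgt Kx.
have hb : h b = 0.
  by apply: (test_fun_out R _ O phi tphi) => /OK; exact: out.
have cdh : continuous (fun x => dphi (cons_tuple x t)).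
  move=> x; apply: (@continuous_comp _ _ _ (fun x : R => rV_of_tuple (cons_tuple x t)) ('D_e0 phi)).
    exact: continuous_slice.
  exact: (test_fun_continuous_derive R _ O phi tphi e0).
have ch : continuous h.
  move=> x; apply: (@continuous_comp _ _ _ (fun x : R => rV_of_tuple (cons_tuple x t)) phi).
    exact: continuous_slice.
  exact: (test_fun_continuous R _ O phi tphi).
have FTC : (\int[lam]_(x in `[y, b]) (dphi (cons_tuple x t))%:E = (h b)%:E - (h y)%:E)%E.
  apply: continuous_FTC2 => //.
  - exact: continuous_subspaceT.
  - split.
    + by move=> x _; apply: slice_derivable; exact: (test_fun_derivable R _ O phi tphi).
    + by apply: cvg_at_right_filter; exact: ch.
    + by apply: cvg_at_left_filter; exact: ch.
  - by move=> x _; rewrite -slice_derive.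
have [L [L0 HL]] := test_fun_derive_bounded R _ O phi tphi e0.
have ig : lam.-integrable setT (fun x => (dphi (cons_tuple x t) * (y < x)%R%:R)%:E).
  apply: (bounded_slice_integrable dphi L (fun x => (y < x)%R%:R)).
  - exact: measurable_dphi.
  - exact: dphi_out.
  - by move=> u; exact: HL.
  - exact: measurable_gt_indicator.
  - by move=> x; exact: norm_nat_bool.
have E : forall x, (dphi (cons_tuple x t) * (y < x)%R%:R) = ((fun x => dphi (cons_tuple x t)) \_ `]y, b]) x.
  move=> x; rewrite /patch mem_setE in_itv/=; case: ltP => yx /=; last by rewrite mulr0.
  case: leP => xb; rewrite ?mulr1//.
  by rewrite dphi_out//; apply: out; exact: lt_trans xb.
transitivity (\int[lam]_(x in `]y, b]) dphi (cons_tuple x t)).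
  by rewrite [RHS]Rintegral_mkcond; apply: eq_Rintegral => x _; rewrite E.
(* The endpoint [y] is a null set; the fundamental theorem was applied on the closed interval. *)
rewrite Rintegral_itv_obnd_cbnd; last first.
  apply/integrable_mkcond => //; move: ig; congr (integrable _ _ _).
  by apply/funext => x; rewrite /= E /patch; case: ifP.
by rewrite /Rintegral FTC hb -EFinB/= sub0r.
Qed.

Section one_sign.
Variables (psi : m.+1.-tuple R -> R) (L : R).
Hypothesis mp : measurable_fun [set: m.+1.-tuple R] psi.
Hypothesis p0 : forall t, 0 <= psi t.
Hypothesis pL : forall t, psi t <= L.
Hypothesis pK : forall t, ~ box R K m.+1 t -> psi t = 0.

Local Notation tl t := (fine (tail_int R m psi (thead t) (behead_tuple t))).

Lemma psi_slice_integrable y t :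
  lam.-integrable setT (fun x => (psi (cons_tuple x t) * (y < x)%R%:R)%:E).
Proof.
apply: (bounded_slice_integrable psi L (fun x => (y < x)%R%:R)) => //.
- by move=> u; rewrite ger0_norm.
- exact: measurable_gt_indicator.
- by move=> x; exact: norm_nat_bool.
Qed.

Lemma tail_int_fin y t : tail_int R m psi y t \is a fin_num.
Proof. exact: (integrable_fin_num measurableT (psi_slice_integrable y t)). Qed.

Lemma prim_psi_integrable : mu.-integrable setT (fun t => (prim R m f t * psi t)%:E).
Proof.
apply: (@finite_support_integrable _ _ R mu (box R K m.+1) (N * K *+ 2 * L)
  (fun t => prim R m f t * psi t)).
- exact: measurable_box.
- exact: lebesgue_box_lty.
- by apply: measurable_funM => //; exact: measurable_prim.
- move=> t; rewrite normrM !ger0_norm ?prim_ge0//.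
  by apply: ler_pM => //; [exact: prim_ge0|exact: prim_le].
- by move=> t bt; rewrite pK// mulr0.
Qed.

Lemma int_f_tail : (\int[mu]_t (f t * tl t)%:E = \int[mu]_t (prim R m f t * psi t)%:E)%E.
Proof.
rewrite (prim_tonelli R m K N f)//; apply: eq_integral => t _.
by rewrite EFinM fineK// tail_int_fin.
Qed.

(** Integrability is read off from that of the primitive times [psi], through the equality of
    integrals [int_f_tail], rather than from a bound on the tail. *)
Lemma f_tail_integrable : mu.-integrable setT (fun t => (f t * tl t)%:E).
Proof.
apply/integrableP; split.
  apply/measurable_EFinP/measurable_funM => //.
  exact: (measurableT_comp (@fine_measurable R setT measurableT)
    (measurable_tail_int R m psi mp p0)).
under eq_integral => t _.
  rewrite gee0_abs; last first.
    by rewrite lee_fin mulr_ge0//; apply: fine_ge0; exact: tail_int_ge0.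
  over.
by rewrite int_f_tail; exact: (integrable_lty measurableT prim_psi_integrable).
Qed.

End one_sign.

(** Tonelli's theorem wants one sign, so the derivative is split into [dp] and [dn]; [dphi_tail]
    recombines the difference of their tails into [-phi]. *)
Lemma prim_weak_div :
  \int[mu]_t (prim R m f t * dphi t) = - \int[mu]_t (f t * phi (rV_of_tuple t)).
Proof.
have [L [L0 HL]] := test_fun_derive_bounded R _ O phi tphi e0.
have [L' [L'0 HL']] := test_fun_bounded R _ O phi tphi.
have dp0 t : 0 <= dp t by rewrite le_max lexx orbT.
have dn0 t : 0 <= dn t by rewrite le_max lexx orbT.
have dpL t : dp t <= L.
  by rewrite ge_max (ltW L0) andbT; exact: le_trans (ler_norm _) (HL _).
have dnL t : dn t <= L.
  by rewrite ge_max (ltW L0) andbT; apply: le_trans (HL (rV_of_tuple t)); rewrite -normrN ler_norm.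
have dpK t : ~ box R K m.+1 t -> dp t = 0 by move=> /dphi_out ->; rewrite maxxx.
have dnK t : ~ box R K m.+1 t -> dn t = 0 by move=> /dphi_out ->; rewrite oppr0 maxxx.
have mdp := measurable_dp; have mdn := measurable_dn.
have tailE t : fine (tail_int R m dp (thead t) (behead_tuple t))
    - fine (tail_int R m dn (thead t) (behead_tuple t)) = - phi (rV_of_tuple t).
  have -> : phi (rV_of_tuple t) = phi (rV_of_tuple (cons_tuple (thead t) (behead_tuple t))).
    by congr (phi (rV_of_tuple _)); rewrite [LHS]tuple_eta; exact: val_inj.
  rewrite -dphi_tail -[LHS]RintegralB//.
  - by apply: eq_Rintegral => x _; rewrite -mulrBl dpn.
  - exact: (psi_slice_integrable dp L).
  - exact: (psi_slice_integrable dn L).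
transitivity (\int[mu]_t (prim R m f t * dp t) - \int[mu]_t (prim R m f t * dn t)).
  rewrite -RintegralB//.
  - by apply: eq_Rintegral => t _; rewrite -mulrBr dpn.
  - exact: (prim_psi_integrable dp L).
  - exact: (prim_psi_integrable dn L).
have Ep := int_f_tail dp L mdp dp0 dpL dpK.
have En := int_f_tail dn L mdn dn0 dnL dnK.
rewrite {1}/Rintegral -Ep {1}/Rintegral -En -[LHS]RintegralB//.
- have ifp : mu.-integrable setT (EFin \o (fun t => f t * phi (rV_of_tuple t))).
    apply: (finite_support_integrable _ _ _ _ (box R K m.+1) (N * L')).
    + exact: measurable_box.
    + exact: lebesgue_box_lty.
    + apply: measurable_funM => //; apply: continuous_measurable_tuple.
      exact: (test_fun_continuous R _ O phi tphi).
    + by move=> t; rewrite normrM; apply: ler_pM => //; rewrite ger0_norm.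
    + by move=> t bt; rewrite fK// mul0r.
  rewrite -mulN1r -RintegralZl//; apply: eq_Rintegral => t _.
  by rewrite -mulrBr tailE mulrN mulN1r.
- exact: (f_tail_integrable dp L).
- exact: (f_tail_integrable dn L).
Qed.

End divergence.

(** * The Euclidean norm and continuity of the nonlinearity *)

Section euclidean_norm.
Variables (R : realType) (n : nat).
Implicit Types x y z : 'rV[R]_n.

Lemma dotpC x y : dotp x y = dotp y x.
Proof. by apply: eq_bigr => i _; rewrite mulrC. Qed.

Lemma dotpDl x y z : dotp (x + y) z = dotp x z + dotp y z.
Proof. by rewrite -big_split; apply: eq_bigr => i _; rewrite mxE mulrDl. Qed.

Lemma dotpZl a x y : dotp (a *: x) y = a * dotp x y.
Proof. by rewrite /dotp mulr_sumr; apply: eq_bigr => i _; rewrite mxE mulrA. Qed.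

Lemma dotpBl x y z : dotp (x - y) z = dotp x z - dotp y z.
Proof. by rewrite dotpDl -scaleN1r dotpZl mulN1r. Qed.

Lemma dotpDr x y z : dotp x (y + z) = dotp x y + dotp x z.
Proof. by rewrite dotpC dotpDl !(dotpC x). Qed.

Lemma dotpBr x y z : dotp x (y - z) = dotp x y - dotp x z.
Proof. by rewrite dotpC dotpBl !(dotpC x). Qed.

Lemma dotpZr a x y : dotp x (a *: y) = a * dotp x y.
Proof. by rewrite dotpC dotpZl dotpC. Qed.

Lemma dotp_ge0 x : 0 <= dotp x x.
Proof. by apply: sumr_ge0 => i _; rewrite -expr2 sqr_ge0. Qed.

Lemma dotp_eq0 x : dotp x x = 0 -> x = 0.
Proof.
move=> /eqP; rewrite /dotp psumr_eq0 => [/allP H|i _]; last by rewrite -expr2 sqr_ge0.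
apply/rowP => i; have := H i (mem_index_enum i).
by rewrite -expr2 sqrf_eq0 mxE => /eqP.
Qed.

Lemma enorm_ge0 x : 0 <= enorm x.
Proof. exact: sqrtr_ge0. Qed.

Lemma enorm_sqr x : enorm x ^+ 2 = dotp x x.
Proof. by rewrite sqr_sqrtr// dotp_ge0. Qed.

Lemma enorm0 : enorm (0 : 'rV[R]_n) = 0.
Proof. by rewrite /enorm /dotp big1 ?sqrtr0// => i _; rewrite mxE mul0r. Qed.

Lemma enormZ a x : enorm (a *: x) = `|a| * enorm x.
Proof. by rewrite /enorm dotpZl dotpZr mulrA -expr2 sqrtrM ?sqr_ge0// sqrtr_sqr. Qed.

Lemma cauchy_schwarz x y : `|dotp x y| <= enorm x * enorm y.
Proof.
rewrite -(@ler_pXn2r _ 2) ?nnegrE ?mulr_ge0 ?enorm_ge0//.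
rewrite exprMn !enorm_sqr real_normK ?num_real//.
(* This vector is [dotp y y] times the component of [x] orthogonal to [y]; its squared length is
   [dotp y y] times the defect in the squared inequality. *)
have := dotp_ge0 (dotp y y *: x - dotp x y *: y).
rewrite !(dotpBl, dotpBr, dotpZl, dotpZr) (dotpC y x).
have := dotp_ge0 y; rewrite le_eqVlt => /predU1P[/esym y0 _|].
  by rewrite (dotp_eq0 y y0) -(scale0r (0 : 'rV[R]_n)) !dotpZr !mul0r expr0n mulr0.
move: (dotp x x) (dotp x y) (dotp y y) => X Z Y Y0 H.
rewrite -subr_ge0 -(pmulr_rge0 _ Y0).
by apply: le_trans H _; rewrite le_eqVlt; apply/orP; left; apply/eqP; ring.
Qed.

Lemma enormD x y : enorm (x + y) <= enorm x + enorm y.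
Proof.
rewrite -(@ler_pXn2r _ 2) ?nnegrE ?addr_ge0 ?enorm_ge0// sqrrD !enorm_sqr.
rewrite dotpDl !dotpDr (dotpC y x).
have := le_trans (ler_norm _) (cauchy_schwarz x y).
by move: (enorm x * enorm y) (dotp x x) (dotp y y) => a b c; lra.
Qed.

Lemma norm_coord_le_enorm x i : `|x 0 i| <= enorm x.
Proof.
rewrite -(@ler_pXn2r _ 2) ?nnegrE ?enorm_ge0// enorm_sqr real_normK ?num_real//.
rewrite /dotp (bigD1 i)//= -expr2 lerDl; apply: sumr_ge0 => j _.
by rewrite -expr2 sqr_ge0.
Qed.

Lemma enorm_le_sum x : enorm x <= \sum_i `|x 0 i|.
Proof.
have S0 : 0 <= \sum_i `|x 0 i| by apply: sumr_ge0.
rewrite -(@ler_pXn2r _ 2) ?nnegrE ?enorm_ge0// enorm_sqr expr2 mulr_suml.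
apply: ler_sum => i _; rewrite -expr2 -real_normK ?num_real// expr2.
apply: ler_wpM2l => //; rewrite (bigD1 i)//= lerDl.
by apply: sumr_ge0.
Qed.

Lemma norm_coord_le_norm x i : `|x 0 i| <= `|x|.
Proof. by rewrite [leRHS]mx_normrE; exact: (le_bigmax _ (fun ij => `|x ij.1 ij.2|) (0, i)). Qed.

Lemma enorm_le_norm x : enorm x <= n%:R * `|x|.
Proof.
apply: le_trans (enorm_le_sum x) _.
apply: (@le_trans _ _ (\sum_(i < n) `|x|)).
  by apply: ler_sum => i _; exact: norm_coord_le_norm.
by rewrite sumr_const card_ord mulr_natl.
Qed.

Lemma measurable_enorm d (T : measurableType d) (U : T -> 'rV[R]_n) :
  (forall i, measurable_fun [set: T] (fun t => U t 0 i)) ->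
  measurable_fun [set: T] (fun t => enorm (U t)).
Proof.
move=> mU; rewrite (_ : (fun t => _) = fun t => dotp (U t) (U t) `^ 2^-1); last first.
  by apply/funext => t; rewrite powR12_sqrt// dotp_ge0.
apply: (measurableT_comp (measurable_powR _)); apply: measurable_sum => i.
exact: measurable_funM.
Qed.

(** The growth condition makes [F] Lipschitz on bounded sets. What is wanted from continuity is the
    measurability of [F (u x)]. *)
Lemma polynomial_growth_continuous (F : 'rV[R]_n -> 'rV[R]_n) (s c1 : R) : 2 < s -> 0 < c1 ->
  (forall x y, enorm (F x - F y)
     <= c1 * (1 + enorm x `^ (s - 2) + enorm y `^ (s - 2)) * enorm (x - y)) ->
  forall i, continuous (fun x => F x 0 i).
Proof.
move=> s2 c10 Flip i x; apply/(@cvgrPdist_le _ _ _ (nbhs x)) => e e0.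
(* [B] bounds the Euclidean norm on the sup-norm ball of radius 1 around [x]; [D] is a Lipschitz
   constant there with respect to the sup norm, increased by 1 to be positive. *)
pose B := enorm x + n%:R.
pose D := c1 * (1 + B `^ (s - 2) + B `^ (s - 2)) * n%:R + 1.
have B0 : 0 <= B by rewrite addr_ge0 ?enorm_ge0.
have Bs : 0 <= B `^ (s - 2) by exact: powR_ge0.
have D0 : 0 < D by rewrite ltr_wpDl// !mulr_ge0 ?(ltW c10)// !addr_ge0.
rewrite -nbhs_nearE; apply/(@nbhs_normP R _ x); exists (Num.min 1 (e / D)); first by rewrite /= lt_min ltr01 divr_gt0.
move=> y /=; rewrite lt_min => /andP[xy1 xyD].
have := norm_coord_le_enorm (F x - F y) i; rewrite !mxE => /le_trans; apply.
apply: le_trans (Flip x y) _.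
have xB : enorm x <= B by rewrite lerDl.
have yB : enorm y <= B.
  rewrite -[y](subrK x) addrC; apply: le_trans (enormD _ _) _; rewrite lerD2l.
  apply: le_trans (enorm_le_norm _) _; rewrite -[leRHS]mulr1 ler_wpM2l//.
  by rewrite distrC ltW.
have pm (z : R) : 0 <= z -> z <= B -> z `^ (s - 2) <= B `^ (s - 2).
  by move=> z0 zB; apply: ge0_ler_powR; rewrite ?nnegrE//; lra.
apply: (@le_trans _ _ (c1 * (1 + B `^ (s - 2) + B `^ (s - 2)) * (n%:R * `|x - y|))).
  apply: ler_pM; rewrite ?enorm_ge0 ?enorm_le_norm//.
    by rewrite mulr_ge0 ?(ltW c10)// !addr_ge0 ?powR_ge0.
  by rewrite ler_wpM2l ?(ltW c10)// !lerD ?pm ?enorm_ge0.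
apply: (@le_trans _ _ (D * `|x - y|)).
  by rewrite mulrA ler_wpM2r// lerDl.
by rewrite mulrC -ler_pdivlMr// ltW.
Qed.

End euclidean_norm.

(** * Extension by zero: from integrals over the domain to integrals on tuples *)

Section extension.
Variables (R : realType) (n : nat) (O : set 'rV[R]_n).
Local Notation mu := (lebesgue_tuple R n).

(** The body is the one used in [measO], so that [measO O f] unfolds to the measurability of
    [zext f]. *)
Definition zext (f : 'rV[R]_n -> R) (t : n.-tuple R) : R :=
  if rV_of_tuple t \in O then f (rV_of_tuple t) else 0.

Definition zextv (u : 'rV[R]_n -> 'rV[R]_n) (t : n.-tuple R) : 'rV[R]_n :=
  if rV_of_tuple t \in O then u (rV_of_tuple t) else 0.

Lemma extv_coord u t i : zextv u t 0 i = zext (fun x => u x 0 i) t.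
Proof. by rewrite /zextv /zext; case: ifP => // _; rewrite mxE. Qed.

Lemma ext_enorm u t : zext (fun x => enorm (u x)) t = enorm (zextv u t).
Proof. by rewrite /zextv /zext; case: ifP => // _; rewrite enorm0. Qed.

Lemma ext_dotp u v t : zext (fun x => dotp (u x) (v x)) t = dotp (zextv u t) (zextv v t).
Proof.
rewrite /zextv /zext; case: ifP => // _.
by rewrite /dotp big1// => i _; rewrite mxE mul0r.
Qed.

Lemma ext_mul f g t : zext (fun x => f x * g x) t = zext f t * zext g t.
Proof. by rewrite /zext; case: ifP => // _; rewrite mulr0. Qed.

(** The exponent must be nonzero, since the power 0 of 0 is 1 and would not extend by zero. *)
Lemma ext_powR p f t : p != 0 -> zext (fun x => `|f x| `^ p) t = `|zext f t| `^ p.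
Proof. by move=> p0; rewrite /zext; case: ifP => // _; rewrite normr0 powR0. Qed.

Lemma intOE (g : 'rV[R]_n -> R) : measO O g -> (forall x, 0 <= g x) ->
  intO O (fun x => (g x)%:E) = (\int[mu]_t (zext g t)%:E)%E.
Proof.
move=> mg g0; rewrite -intnE; last 2 first.
- exact/measurable_EFinP.
- by move=> t; rewrite lee_fin /zext; case: ifP.
by rewrite /intO; congr intn; apply/funext => t; rewrite /zext; case: ifP.
Qed.

Lemma measO_norm_powR p f : p != 0 -> measO O f -> measO O (fun x => `|f x| `^ p).
Proof.
move=> p0 mf; have := measurable_norm_powR _ _ _ p (zext f) mf.
by rewrite /measO; congr measurable_fun; apply/funext => t; rewrite -ext_powR.
Qed.

Lemma intO_powR p f : p != 0 -> measO O f ->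
  intO O (fun x => (`|f x| `^ p)%:E) = (\int[mu]_t (`|zext f t| `^ p)%:E)%E.
Proof.
move=> p0 mf; rewrite intOE//; first by apply: eq_integral => t _; rewrite ext_powR.
  exact: measO_norm_powR.
Qed.

Lemma inLpP p f : 0 < p -> inLp O p f <-> memLp _ _ R mu p (zext f).
Proof.
move=> p0; have p00 : p != 0 by rewrite gt_eqF.
by split=> -[mf fy]; split => //; move: fy; rewrite intO_powR.
Qed.

Lemma LpnormE p f : 0 < p -> inLp O p f -> Lpnorm O p f = nLp _ _ R mu p (zext f).
Proof.
move=> p0 [mf _]; have p00 : p != 0 by rewrite gt_eqF.
by rewrite /Lpnorm intO_powR// nLpE.
Qed.

Lemma measO_enorm (u : 'rV[R]_n -> 'rV[R]_n) : (forall i, measO O (fun x => u x 0 i)) -> measO O (fun x => enorm (u x)).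
Proof.
move=> mu'; have := measurable_enorm _ _ _ _ (zextv u).
have H i : measurable_fun [set: n.-tuple R] (fun t => zextv u t 0 i).
  by under eq_fun do rewrite extv_coord; exact: mu'.
move=> /(_ H); rewrite /measO; congr measurable_fun.
by apply/funext => t; rewrite -ext_enorm.
Qed.

(** Vector fields are reduced to the scalar theory applied to [enorm (u x)], while measurability
    stays coordinatewise. *)
Lemma inLpvecE p (u : 'rV[R]_n -> 'rV[R]_n) : inLpvec O p u <->
  (forall i, measO O (fun x => u x 0 i)) /\ inLp O p (fun x => enorm (u x)).
Proof.
have E : (fun x => (enorm (u x) `^ p)%:E) = (fun x => (`|enorm (u x)| `^ p)%:E).
  by apply/funext => x; rewrite ger0_norm// enorm_ge0.
rewrite /inLpvec E; split; last by move=> [? []].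
by move=> [mu' uy]; split => //; split => //; exact: measO_enorm.
Qed.

Lemma LpvecnormE p (u : 'rV[R]_n -> 'rV[R]_n) : Lpvecnorm O p u = Lpnorm O p (fun x => enorm (u x)).
Proof.
rewrite /Lpvecnorm /Lpnorm; congr (fine (intO O _) `^ _).
by apply/funext => x; rewrite ger0_norm// enorm_ge0.
Qed.

(** [RintO] is a difference of two [fine] values, each 0 when its integral is infinite;
    integrability excludes this case. *)
Lemma RintOE g : mu.-integrable setT (EFin \o zext g) -> RintO O g = \int[mu]_t zext g t.
Proof.
move=> ig; have mg : measO O g by apply/measurable_EFinP; have /integrableP[] := ig.
have extmax (h : 'rV[R]_n -> R) t : zext (fun x => Num.max (h x) 0) t = Num.max (zext h t) 0.
  by rewrite /zext; case: ifP => // _; rewrite maxxx.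
have extN t : zext (fun x => - g x) t = - zext g t.
  by rewrite /zext; case: ifP => // _; rewrite oppr0.
have mmax h : measO O h -> measO O (fun x => Num.max (h x) 0).
  move=> mh; suff : measurable_fun [set: n.-tuple R] (fun t => Num.max (zext h t) 0).
    by congr measurable_fun; apply/funext => t; rewrite -extmax.
  by apply: measurable_maxr => //; exact: measurable_cst.
have mN : measO O (fun x => - g x).
  suff : measurable_fun [set: n.-tuple R] (fun t => - zext g t).
    by congr measurable_fun; apply/funext => t; rewrite -extN.
  exact: measurableT_comp.
have imax (h : n.-tuple R -> R) : measurable_fun setT h -> (forall t, `|h t| <= `|zext g t|) ->
    mu.-integrable setT (fun t => (Num.max (h t) 0)%:E).
  move=> mh hg; apply: (le_integrable _ _ _ ig) => //.
    by apply/measurable_EFinP/measurable_maxr => //; exact: measurable_cst.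
  move=> t _; rewrite lee_fin; apply: le_trans (hg t).
  rewrite /Num.max; case: ltP => // _; by rewrite normr0.
rewrite /RintO !intOE; [|exact: mmax|by move=> x; rewrite le_max lexx orbT
  |exact: mmax|by move=> x; rewrite le_max lexx orbT].
rewrite (eq_integral (fun t => (Num.max (zext g t) 0)%:E)); last by move=> t _; rewrite extmax.
rewrite (eq_integral (fun t => (Num.max (- zext g t) 0)%:E) (fun t => (zext (fun x => Num.max (- g x) 0) t)%:E)); last first.
  by move=> t _; rewrite extmax extN.
rewrite -[LHS]RintegralB//; last 2 first.
- exact: imax.
- by apply: imax => [|t]; [exact: measurableT_comp|rewrite normrN].
apply: eq_Rintegral => t _; rewrite /Num.max; case: ltP => ?; case: ltP => ?; lra.
Qed.

End extension.

(** * Linear structure, Hölder's inequality and test functions in [L^p] of the domain *)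

Section function_spaces.
Variables (R : realType) (n : nat) (O : set 'rV[R]_n) (K : R).
Hypothesis OK : forall t, O (rV_of_tuple t) -> box R K n t.
Hypothesis oO : open O.
Local Notation mu := (lebesgue_tuple R n).
Local Notation ext := (zext R n O).
Local Notation extv := (zextv R n O).
Local Notation memL := (memLp _ _ R mu).
Local Notation nL := (nLp _ _ R mu).
Implicit Types (f g q : 'rV[R]_n -> R) (u v w : 'rV[R]_n -> 'rV[R]_n).

Lemma ext_lin a f g t : ext (fun x => a * f x + g x) t = a * ext f t + ext g t.
Proof. by rewrite /zext; case: ifP => // _; rewrite mulr0 addr0. Qed.

Lemma inLp_lin p a f g : 1 <= p -> inLp O p f -> inLp O p g ->
  inLp O p (fun x => a * f x + g x).
Proof.
move=> p1; have p0 : 0 < p by exact: lt_le_trans p1.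
move=> /(inLpP _ _ _ _ _ p0) fp /(inLpP _ _ _ _ _ p0) gp; apply/(inLpP _ _ _ _ _ p0).
have [+ _] := minkowski_nLp _ _ R mu p _ _ p1 (memLpZ _ _ R mu p a _ fp) gp.
by congr memLp; apply/funext => t; rewrite ext_lin.
Qed.

Lemma Lpnorm_lin p a f g : 1 <= p -> inLp O p f -> inLp O p g ->
  Lpnorm O p (fun x => a * f x + g x) <= `|a| * Lpnorm O p f + Lpnorm O p g.
Proof.
move=> p1; have p0 : 0 < p by exact: lt_le_trans p1.
move=> fp gp; have fgp := inLp_lin p a f g p1 fp gp.
rewrite !LpnormE//.
have fp' := (inLpP _ _ _ _ _ p0).1 fp; have gp' := (inLpP _ _ _ _ _ p0).1 gp.
have H := (minkowski_nLp _ _ R mu p _ _ p1 (memLpZ _ _ R mu p a _ fp') gp').2.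
have E := nLpZ _ _ R mu p a (ext f) p0 fp'.
have E2 : ext (fun x => a * f x + g x) = (fun t => a * ext f t + ext g t).
  by apply/funext => t; rewrite ext_lin.
by rewrite E2 -E.
Qed.

Lemma inLpZ p a f : 0 < p -> inLp O p f -> inLp O p (fun x => a * f x).
Proof.
move=> p0 /(inLpP _ _ _ _ _ p0) fp; apply/(inLpP _ _ _ _ _ p0).
have := memLpZ _ _ R mu p a _ fp.
by congr memLp; apply/funext => t; rewrite /zext; case: ifP => // _; rewrite mulr0.
Qed.

Lemma LpnormZ p a f : 0 < p -> inLp O p f ->
  Lpnorm O p (fun x => a * f x) = `|a| * Lpnorm O p f.
Proof.
move=> p0 fp; rewrite !LpnormE//; last exact: inLpZ.
have fp' := (inLpP _ _ _ _ _ p0).1 fp.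
rewrite -(nLpZ _ _ R mu p a (ext f) p0 fp').
by congr nLp; apply/funext => t; rewrite /zext; case: ifP => // _; rewrite mulr0.
Qed.

Lemma Lpnorm_ge0 p f : 0 <= Lpnorm O p f.
Proof. exact: powR_ge0. Qed.

Lemma inLp0 p : 0 < p -> inLp O p (fun=> 0).
Proof.
move=> p0; have E : ext (fun=> 0) = cst 0 by apply/funext => t; rewrite /zext; case: ifP.
apply/inLpP => //; rewrite E; split; first exact: measurable_cst.
by under eq_integral do rewrite normr0 powR0 ?gt_eqF//; rewrite integral0 ltry.
Qed.

Lemma Lpnorm0 p : 0 < p -> Lpnorm O p (fun=> 0) = 0.
Proof.
move=> p0; have := LpnormZ p 0 (fun=> 0) p0 (inLp0 p p0); rewrite normr0 (mul0r (Lpnorm _ _ _)) => E.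
by rewrite -[RHS]E; congr Lpnorm; apply/funext => x; rewrite mulr0.
Qed.

Lemma Lpnorm_le p f g : 0 < p -> measO O f -> inLp O p g ->
  (forall x, `|f x| <= `|g x|) -> inLp O p f /\ Lpnorm O p f <= Lpnorm O p g.
Proof.
move=> p0 mf gp fg; have gp' := (inLpP _ _ _ _ _ p0).1 gp.
have fgE t : `|ext f t| <= `|ext g t|.
  by rewrite /zext; case: ifP => // _; rewrite normr0.
have fp : inLp O p f.
  by apply/(inLpP _ _ _ _ _ p0); exact: (memLp_le _ _ R mu p (ext f) (ext g) (ltW p0) mf gp' fgE).
split; first exact: fp.
rewrite (LpnormE _ _ _ _ _ p0 fp) (LpnormE _ _ _ _ _ p0 gp).
exact: (nLp_le _ _ R mu p (ext f) (ext g) (ltW p0) mf gp' fgE).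
Qed.

Lemma hoelder_O (p q : R) f g : 0 < p -> 0 < q -> p^-1 + q^-1 = 1 ->
  inLp O p f -> inLp O q g ->
  mu.-integrable setT (EFin \o ext (fun x => f x * g x)) /\
  `|RintO O (fun x => f x * g x)| <= Lpnorm O p f * Lpnorm O q g.
Proof.
move=> p0 q0 pq fp gq.
have fp' := (inLpP _ _ _ _ _ p0).1 fp; have gq' := (inLpP _ _ _ _ _ q0).1 gq.
have [i _] := hoelder_integrable _ _ R mu p q _ _ p0 q0 pq fp' gq'.
have i' : mu.-integrable setT (EFin \o ext (fun x => f x * g x)).
  by move: i; congr integrable; apply/funext => t /=; rewrite ext_mul.
split => //; rewrite (RintOE _ _ _ _ i') (LpnormE _ _ _ _ _ p0 fp) (LpnormE _ _ _ _ _ q0 gq).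
have E : ext (fun x => f x * g x) = fun t => ext f t * ext g t.
  by apply/funext => t; rewrite ext_mul.
by rewrite E; exact: (hoelder_Rintegral _ _ R mu p q _ _ p0 q0 pq fp' gq').
Qed.

Lemma measurable_extv u i : measO O (fun x => u x 0 i) ->
  measurable_fun [set: n.-tuple R] (fun t => extv u t 0 i).
Proof. by move=> mu'; under eq_fun do rewrite extv_coord; exact: mu'. Qed.

Lemma measurable_ext_dotp u v : (forall i, measO O (fun x => u x 0 i)) ->
  (forall i, measO O (fun x => v x 0 i)) -> measO O (fun x => dotp (u x) (v x)).
Proof.
move=> mu' mv.
have : measurable_fun [set: n.-tuple R] (fun t => dotp (extv u t) (extv v t)).
  by apply: measurable_sum => i; apply: measurable_funM; exact: measurable_extv.
by congr measurable_fun; apply/funext => t; rewrite -ext_dotp.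
Qed.

(** Pointwise Cauchy-Schwarz reduces this to the scalar inequality for the functions [enorm (u x)]
    and [enorm (v x)]. *)
Lemma hoelder_vec (p q : R) u v : 0 < p -> 0 < q -> p^-1 + q^-1 = 1 ->
  inLpvec O p u -> inLpvec O q v ->
  mu.-integrable setT (EFin \o ext (fun x => dotp (u x) (v x))) /\
  `|RintO O (fun x => dotp (u x) (v x))| <= Lpvecnorm O p u * Lpvecnorm O q v.
Proof.
move=> p0 q0 pq /inLpvecE[mu' up] /inLpvecE[mv vq]; rewrite !LpvecnormE.
have [i _] := hoelder_O p q _ _ p0 q0 pq up vq.
have mD : measurable_fun [set: n.-tuple R] (ext (fun x => dotp (u x) (v x))).
  exact: measurable_ext_dotp.
have le t : `|ext (fun x => dotp (u x) (v x)) t| <= ext (fun x => enorm (u x) * enorm (v x)) t.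
  rewrite /zext; case: ifP => // _; last by rewrite normr0.
  exact: cauchy_schwarz.
have i' : mu.-integrable setT (EFin \o ext (fun x => dotp (u x) (v x))).
  apply: (le_integrable measurableT _ _ i); first exact/measurable_EFinP.
  by move=> t _; rewrite lee_fin; apply: le_trans (le t) (ler_norm _).
split; first exact: i'.
apply: le_trans _ (hoelder_O p q _ _ p0 q0 pq up vq).2.
rewrite (RintOE _ _ _ _ i') (RintOE _ _ _ _ i).
apply: le_trans (le_normr_Rintegral measurableT i') _.
apply: le_trans _ (ler_norm _); apply: (le_Rintegral measurableT) => //.
exact: (integrable_norm i').
Qed.

Lemma RintO_lin a f g : mu.-integrable setT (EFin \o ext f) ->
  mu.-integrable setT (EFin \o ext g) ->
  RintO O (fun x => a * f x + g x) = a * RintO O f + RintO O g.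
Proof.
move=> fi gi; have afi : mu.-integrable setT (EFin \o (fun t => a * ext f t)).
  exact: (integrableZl measurableT a fi).
have E : ext (fun x => a * f x + g x) = fun t => a * ext f t + ext g t.
  by apply/funext => t; rewrite ext_lin.
rewrite (RintOE _ _ _ _ fi) (RintOE _ _ _ _ gi) RintOE E; last first.
  exact: (integrableD measurableT afi gi).
by rewrite (RintegralD measurableT afi gi) (RintegralZl a measurableT fi).
Qed.

Lemma bounded_inLp p f C : 0 < p -> measO O f -> (forall x, `|f x| <= C) -> inLp O p f.
Proof.
move=> p0 mf fC; apply/(inLpP _ _ _ _ _ p0); split => //.
have C0 : 0 <= C by exact: le_trans (normr_ge0 _) (fC 0).
have : mu.-integrable setT (EFin \o (fun t => `|ext f t| `^ p)).
  apply: (finite_support_integrable _ _ R mu (box R K n) (C `^ p)).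
  - exact: measurable_box.
  - exact: lebesgue_box_lty.
  - exact: measurable_norm_powR.
  - move=> t; rewrite ger0_norm ?powR_ge0// ge0_ler_powR ?nnegrE ?(ltW p0)//.
    by rewrite /zext; case: ifP => // _; rewrite normr0.
  - move=> t bt; rewrite /zext ifF ?normr0 ?powR0 ?gt_eqF//.
    by apply/negP; rewrite inE => /OK.
by move=> /(integrable_lty measurableT).
Qed.

Lemma continuous_measO f : continuous f -> (forall x, ~ O x -> f x = 0) -> measO O f.
Proof.
move=> cf f0; have := continuous_measurable_tuple _ _ _ cf.
congr measurable_fun; apply/funext => t; case: ifPn => // /negP; rewrite inE => /f0.
by [].
Qed.

Lemma test_fun_inLp p phi : 0 < p -> test_fun O phi -> inLp O p phi.
Proof.
move=> p0 tphi; have [L [_ HL]] := test_fun_bounded _ _ _ _ tphi.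
apply: (bounded_inLp p phi L p0) => //; apply: continuous_measO.
  exact: (test_fun_continuous _ _ _ _ tphi).
exact: (test_fun_out _ _ _ _ tphi).
Qed.

Lemma grad_inLpvec p phi : 0 < p -> test_fun O phi -> inLpvec O p (grad phi).
Proof.
move=> p0 tphi.
have mg i : measO O (fun x => grad phi x 0 i).
  rewrite (_ : (fun x => _) = fun x => 'D_(delta_mx 0 i) phi x); last first.
    by apply/funext => x; rewrite mxE.
  apply: continuous_measO; first exact: (test_fun_continuous_derive _ _ _ _ tphi).
  exact: (test_fun_derive_out _ _ _ _ tphi).
apply/inLpvecE; split => //.
have [L HL] := choice (fun i : 'I_n => test_fun_derive_bounded _ _ _ _ tphi (delta_mx 0 i)).
apply: (bounded_inLp p _ (\sum_i L i) p0); first exact: measO_enorm.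
move=> x; rewrite ger0_norm ?enorm_ge0//; apply: le_trans (enorm_le_sum _ _ _) _.
by apply: ler_sum => i _; rewrite mxE; exact: (HL i).2.
Qed.

Lemma inLpvec_lin p a u v : 1 <= p -> inLpvec O p u -> inLpvec O p v ->
  inLpvec O p (fun x => a *: u x + v x).
Proof.
move=> p1; have p0 : 0 < p by exact: lt_le_trans p1.
move=> /inLpvecE[mu' up] /inLpvecE[mv vp]; apply/inLpvecE.
have mw i : measO O (fun x => (a *: u x + v x) 0 i).
  have : measurable_fun [set: n.-tuple R] (fun t => a * ext (fun x => u x 0 i) t + ext (fun x => v x 0 i) t).
    apply: measurable_funD; last exact: mv.
    by apply: measurable_funM => //; exact: mu'.
  congr measurable_fun; apply/funext => t; rewrite -ext_lin /zext.
  by case: ifP => // _; rewrite !mxE.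
split; first exact: mw.
apply: (Lpnorm_le p _ (fun x => `|a| * enorm (u x) + enorm (v x)) p0 _ _ _).1.
- exact: measO_enorm.
- exact: inLp_lin.
- move=> x; rewrite (ger0_norm (enorm_ge0 _ _ _)).
  by apply: le_trans (enormD _ _ _ _) (le_trans _ (ler_norm _)); rewrite enormZ.
Qed.

Lemma LpvecnormZ p a u : 0 < p -> inLpvec O p u ->
  Lpvecnorm O p (fun x => a *: u x) = `|a| * Lpvecnorm O p u.
Proof.
move=> p0 /inLpvecE[_ up]; rewrite !LpvecnormE -[in RHS](normr_id a) -(LpnormZ p `|a| _ p0 up).
by congr Lpnorm; apply/funext => x; rewrite enormZ.
Qed.

Lemma inLpvec0 p : 0 < p -> inLpvec O p (fun=> 0).
Proof.
move=> p0; apply/inLpvecE; split=> [i|].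
  rewrite (_ : (fun x => _) = fun=> 0); first by case: (inLp0 p p0).
  by apply/funext => x; rewrite mxE.
rewrite (_ : (fun x => _) = fun=> 0); first exact: inLp0.
by apply/funext => x; rewrite enorm0.
Qed.

Lemma Lpvecnorm0 p : 0 < p -> Lpvecnorm O p (fun=> 0) = 0.
Proof.
move=> p0; rewrite LpvecnormE -[RHS](Lpnorm0 p p0).
by congr Lpnorm; apply/funext => x; rewrite enorm0.
Qed.

End function_spaces.

(** * Identities for the conjugate exponent *)

Section conjugate_exponent.
Variables (R : realType) (s : R).
Hypothesis s2 : 2 < s.

Lemma conj_exp_gt1 : 1 < conj_exp s.
Proof. by move: s2 => s2'; rewrite /conj_exp ltr_pdivlMr; lra. Qed.

Lemma conj_exp_sum : s^-1 + (conj_exp s)^-1 = 1.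
Proof. have s2' := s2; rewrite /conj_exp; field; rewrite !gt_eqF//; lra. Qed.

Lemma conj_expB1 : conj_exp s - 1 = (s - 1)^-1.
Proof. have s2' := s2; rewrite /conj_exp; field; rewrite gt_eqF//; lra. Qed.

(** Equivalently [r (s - 2) = (s - 2) + (2 - r)], the form in which this exponent arises in
    [stability_bound]. *)
Lemma conj_exp_mul : conj_exp s * (s - 2) = s - conj_exp s.
Proof. have s2' := s2; rewrite /conj_exp; field; rewrite gt_eqF//; lra. Qed.

End conjugate_exponent.

(** * The spaces of the statement and the dual norms *)

Section dual_norms.
Variables (R : realType) (n : nat) (O : set 'rV[R]_n) (K s : R).
Hypothesis OK : forall t, O (rV_of_tuple t) -> box R K n t.
Hypothesis s2 : 2 < s.
Local Notation mu := (lebesgue_tuple R n).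
Local Notation r := (conj_exp s).
Implicit Types (q dv : 'rV[R]_n -> R) (v w : 'rV[R]_n -> 'rV[R]_n) (G : functional R n).

Let s0 : 0 < s. Proof. have s2' := s2; lra. Qed.
Let s1 : 1 <= s. Proof. have s2' := s2; lra. Qed.
Let r0 : 0 < r. Proof. exact: lt_trans (conj_exp_gt1 _ _ s2). Qed.
Let r1 : 1 <= r. Proof. exact/ltW/conj_exp_gt1. Qed.
Let sr := conj_exp_sum R s s2.

(** Additivity of the real integral requires integrable terms; it comes from pairing [L^s] with
    [L^r], where [phi] and its gradient lie. *)
Lemma weak_div_lin a v dv w dw : inLpvec O s v -> inLp O s dv -> inLpvec O s w -> inLp O s dw ->
  weak_div O v dv -> weak_div O w dw ->
  weak_div O (fun x => a *: v x + w x) (fun x => a * dv x + dw x).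
Proof.
move=> vs dvs ws dws wv ww phi tphi.
have gphi := grad_inLpvec R n O K OK r phi r0 tphi.
have pphi := test_fun_inLp R n O K OK r phi r0 tphi.
have [i1 _] := hoelder_vec R n O s r _ _ s0 r0 sr vs gphi.
have [i2 _] := hoelder_vec R n O s r _ _ s0 r0 sr ws gphi.
have [i3 _] := hoelder_O R n O s r _ _ s0 r0 sr dvs pphi.
have [i4 _] := hoelder_O R n O s r _ _ s0 r0 sr dws pphi.
have -> : (fun x => dotp (a *: v x + w x) (grad phi x)) =
    (fun x => a * dotp (v x) (grad phi x) + dotp (w x) (grad phi x)).
  by apply/funext => x; rewrite dotpDl dotpZl.
have -> : (fun x => (a * dv x + dw x) * phi x) = (fun x => a * (dv x * phi x) + dw x * phi x).
  by apply/funext => x; rewrite mulrDl mulrA.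
by rewrite (RintO_lin _ _ _ _ _ _ i1 i2) (RintO_lin _ _ _ _ _ _ i3 i4) (wv _ tphi) (ww _ tphi) mulrN -opprD.
Qed.

Lemma RintO0 : RintO O (fun=> 0 : R) = 0.
Proof. by rewrite /RintO oppr0 subrr. Qed.

Lemma inV0 : inV O s (fun=> 0) (fun=> 0).
Proof.
split; first exact: inLpvec0.
split; first exact: inLp0.
move=> phi _; rewrite (_ : (fun x => _) = fun=> 0); last first.
  by apply/funext => x; rewrite /dotp big1// => i _; rewrite mxE mul0r.
rewrite [in RHS](_ : (fun x => _) = fun=> 0); last by apply/funext => x; rewrite mul0r.
by rewrite RintO0 oppr0.
Qed.

Lemma inV_lin a v dv w dw : inV O s v dv -> inV O s w dw ->
  inV O s (fun x => a *: v x + w x) (fun x => a * dv x + dw x).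
Proof.
move=> [vs [dvs wv]] [ws [dws ww]]; split; first exact: inLpvec_lin.
by split; [exact: inLp_lin|exact: weak_div_lin].
Qed.

Lemma inW_lin a v dv q w dw q' : inW O s v dv q -> inW O s w dw q' ->
  inW O s (fun x => a *: v x + w x) (fun x => a * dv x + dw x) (fun x => a * q x + q' x).
Proof. by move=> [Vv qr] [Vw qr']; split; [exact: inV_lin|exact: inLp_lin]. Qed.

Lemma inW0 v dv : inV O s v dv -> inW O s v dv (fun=> 0).
Proof. by move=> Vv; split => //; exact: inLp0. Qed.

Lemma inW_Z q : inLp O r q -> inW O s (fun=> 0) (fun=> 0) q.
Proof. by move=> qr; split => //; exact: inV0. Qed.

Lemma inVZ a v dv : inV O s v dv -> inV O s (fun x => a *: v x) (fun x => a * dv x).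
Proof.
move=> Vv; have := inV_lin a v dv (fun=> 0) (fun=> 0) Vv inV0.
have E1 : (fun x => a *: v x + 0) = (fun x => a *: v x) by apply/funext => x; rewrite addr0.
have E2 : (fun x => a * dv x + 0) = (fun x => a * dv x) by apply/funext => x; rewrite addr0.
by rewrite E1 E2.
Qed.

Lemma normV_ge0 v dv : 0 <= normV O s v dv.
Proof. exact: powR_ge0. Qed.

Lemma normVZ a v dv : inV O s v dv ->
  normV O s (fun x => a *: v x) (fun x => a * dv x) = `|a| * normV O s v dv.
Proof.
move=> [vs [dvs _]]; rewrite /normV LpvecnormZ// LpnormZ//.
have : 0 <= Lpvecnorm O s v by rewrite LpvecnormE; exact: Lpnorm_ge0.
have := Lpnorm_ge0 R n O s dv.
move: (Lpvecnorm O s v) (Lpnorm O s dv) => x y y0 x0.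
rewrite !powRM// -mulrDr powRM ?powR_ge0 ?addr_ge0 ?powR_ge0//.
by rewrite -powRrM mulfV ?gt_eqF// powRr1.
Qed.

(** [x^s = x x^(s-1) <= x (x+y)^(s-1)], likewise for [y], and the two bounds add up to [(x+y)^s]. *)
Lemma powR_sum_le (x y : R) : 0 <= x -> 0 <= y -> (x `^ s + y `^ s) `^ s^-1 <= x + y.
Proof.
move=> x0 y0; have xy0 : 0 <= x + y by rewrite addr_ge0.
have s2' := s2.
have -> : x + y = ((x + y) `^ s) `^ s^-1 by rewrite -powRrM mulfV ?gt_eqF// powRr1.
apply: ge0_ler_powR; rewrite ?invr_ge0 ?nnegrE ?addr_ge0 ?powR_ge0 ?(ltW s0)//.
have -> : x `^ s = x * x `^ (s - 1) by rewrite mulr_powRB1.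
have -> : y `^ s = y * y `^ (s - 1) by rewrite mulr_powRB1.
have -> : (x + y) `^ s = (x + y) * (x + y) `^ (s - 1) by rewrite mulr_powRB1.
rewrite mulrDl; apply: lerD; apply: ler_wpM2l => //; apply: ge0_ler_powR;
  rewrite ?nnegrE// ?lerDl ?lerDr//; lra.
Qed.

Lemma normV_le v dv : normV O s v dv <= Lpvecnorm O s v + Lpnorm O s dv.
Proof. by apply: powR_sum_le; [rewrite LpvecnormE|]; exact: Lpnorm_ge0. Qed.

Lemma le_powR_sum (x y : R) : 0 <= x -> x <= (x `^ s + y `^ s) `^ s^-1.
Proof.
move=> x0; have {1}-> : x = (x `^ s) `^ s^-1 by rewrite -powRrM mulfV ?gt_eqF// powRr1.
by apply: ge0_ler_powR; rewrite ?invr_ge0 ?nnegrE ?addr_ge0 ?powR_ge0 ?(ltW s0)// lerDl powR_ge0.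
Qed.

Lemma Lpvecnorm_le_normV v dv : Lpvecnorm O s v <= normV O s v dv.
Proof. by apply: le_powR_sum; rewrite LpvecnormE; exact: Lpnorm_ge0. Qed.

Lemma normW0 v dv : normW O s v dv (fun=> 0) = normV O s v dv.
Proof. by rewrite /normW Lpnorm0// addr0. Qed.

Lemma normV0 : normV O s (fun=> 0) (fun=> 0) = 0.
Proof. by rewrite /normV Lpvecnorm0// Lpnorm0// powR0 ?gt_eqF// addr0 powR0// invr_eq0 gt_eqF. Qed.

Lemma normW_Z q : normW O s (fun=> 0) (fun=> 0) q = Lpnorm O r q.
Proof. by rewrite /normW normV0 add0r. Qed.

Section one_functional.
Variable G : functional R n.
Hypothesis dG : in_Wdual O s G.

(** Linearity at the zero pair with [a = 1] gives [G(0) = 2 G(0)]. *)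
Lemma functional00 : G (fun=> 0) (fun=> 0) = 0.
Proof.
have := dG.1 1 _ _ _ _ _ _ (inW0 _ _ inV0) (inW0 _ _ inV0).
rewrite (_ : (fun x => _) = fun=> 0); last by apply/funext => x; rewrite scaler0 addr0.
rewrite (_ : (fun x => _) = fun=> 0); last by apply/funext => x; rewrite mulr0 addr0.
by move=> H; move: H; lra.
Qed.

Lemma functionalZ a v dv q : inW O s v dv q ->
  G (fun x => a *: v x) (fun x => a * q x) = a * G v q.
Proof.
move=> Wv; have := dG.1 a _ _ _ _ _ _ Wv (inW0 _ _ inV0).
rewrite functional00 addr0 => <-.
by congr G; apply/funext => x; rewrite addr0.
Qed.

Lemma dual_constant : exists2 C, 0 <= C &
  forall v dv q, inW O s v dv q -> `|G v q| <= C * normW O s v dv q.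
Proof.
have [_ [C HC]] := dG; exists `|C| => // v dv q Wv; apply: le_trans (HC _ _ _ Wv) _.
by apply: ler_wpM2r; [rewrite addr_ge0 ?normV_ge0 ?Lpnorm_ge0|exact: ler_norm].
Qed.

(** A set without supremum has [sup] equal to 0, so a dual norm gives bounds only once its set is
    known to be nonempty and bounded. *)
Lemma has_sup_Wd : has_sup [set y | exists v dv q, inW O s v dv q /\ normW O s v dv q <= 1
                              /\ y = `|G v q| ].
Proof.
have [C C0 HC] := dual_constant; split.
  exists `|G (fun=> 0) (fun=> 0)|, (fun=> 0), (fun=> 0), (fun=> 0).
  by split; [exact/inW0/inV0|rewrite normW0 normV0 ler01].
exists C => _ [v [dv [q [Wv [n1 ->]]]]]; apply: le_trans (HC _ _ _ Wv) _.
by rewrite -[leRHS]mulr1 ler_wpM2l.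
Qed.

Lemma Wd_le v dv q : inW O s v dv q -> normW O s v dv q <= 1 -> `|G v q| <= normWd O s G.
Proof. by move=> Wv n1; apply: sup_upper_bound; [exact: has_sup_Wd|exists v, dv, q]. Qed.

Lemma has_sup_Vd : has_sup [set y | exists v dv, inV O s v dv /\ normV O s v dv <= 1
                            /\ y = `|G v (fun=> 0)| ].
Proof.
split.
  exists `|G (fun=> 0) (fun=> 0)|, (fun=> 0), (fun=> 0).
  by split; [exact/inV0|rewrite normV0 ler01].
exists (normWd O s G) => _ [v [dv [Vv [n1 ->]]]].
by apply: (Wd_le v dv); [exact: inW0|rewrite normW0].
Qed.

Lemma has_sup_Zd : has_sup [set y | exists q, inLp O r q /\ Lpnorm O r q <= 1
                         /\ y = `|G (fun=> 0) q| ].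
Proof.
split.
  exists `|G (fun=> 0) (fun=> 0)|, (fun=> 0).
  by split; [exact: inLp0|rewrite Lpnorm0// ler01].
exists (normWd O s G) => _ [q [qr [n1 ->]]].
by apply: (Wd_le _ (fun=> 0)); [exact: inW_Z|rewrite normW_Z].
Qed.

Lemma normVd_le_normWd : normVd O s G <= normWd O s G.
Proof.
apply: ge_sup; first by case: has_sup_Vd.
move=> _ [v [dv [Vv [n1 ->]]]].
by apply: (Wd_le v dv); [exact: inW0|rewrite normW0].
Qed.

Lemma normZd_le_normWd : normZd O s G <= normWd O s G.
Proof.
apply: ge_sup; first by case: has_sup_Zd.
move=> _ [q [qr [n1 ->]]].
by apply: (Wd_le _ (fun=> 0)); [exact: inW_Z|rewrite normW_Z].
Qed.

(** Normalise [v]. If its norm vanishes this is impossible, although the representative need not be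
    identically zero; the continuity constant then forces [G] to vanish there. *)
Lemma normVd_bound v dv : inV O s v dv ->
  `|G v (fun=> 0)| <= normVd O s G * normV O s v dv.
Proof.
move=> Vv; have Wv := inW0 _ _ Vv.
have := normV_ge0 v dv; rewrite le_eqVlt => /predU1P[/esym A0|A0].
  have [C C0 HC] := dual_constant; apply: le_trans (HC _ _ _ Wv) _.
  by rewrite normW0 A0 !mulr0.
rewrite -ler_pdivrMr// mulrC -[X in X * _](ger0_norm (_ : 0 <= (normV O s v dv)^-1)); last first.
  by rewrite invr_ge0 ltW.
rewrite -normrM -(functionalZ _ _ _ _ Wv).
rewrite (_ : (fun x => _ * 0) = fun=> 0); last by apply/funext => x; rewrite mulr0.
apply: sup_upper_bound; first exact: has_sup_Vd.
exists (fun x => (normV O s v dv)^-1 *: v x), (fun x => (normV O s v dv)^-1 * dv x); split.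
  exact: inVZ.
by split => //; rewrite normVZ// ger0_norm ?invr_ge0 ?(ltW A0)// mulVf ?gt_eqF.
Qed.

Lemma normZd_bound q : inLp O r q ->
  `|G (fun=> 0) q| <= normZd O s G * Lpnorm O r q.
Proof.
move=> qr; have Wq := inW_Z _ qr.
have := Lpnorm_ge0 R n O r q; rewrite le_eqVlt => /predU1P[/esym A0|A0].
  have [C C0 HC] := dual_constant; apply: le_trans (HC _ _ _ Wq) _.
  by rewrite normW_Z A0 !mulr0.
rewrite -ler_pdivrMr// mulrC -[X in X * _](ger0_norm (_ : 0 <= (Lpnorm O r q)^-1)); last first.
  by rewrite invr_ge0 ltW.
rewrite -normrM -(functionalZ _ _ _ _ Wq).
rewrite (_ : (fun x => _ *: 0) = fun=> 0); last by apply/funext => x; rewrite scaler0.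
apply: sup_upper_bound; first exact: has_sup_Zd.
exists (fun x => (Lpnorm O r q)^-1 * q x); split; first exact: inLpZ.
by split => //; rewrite LpnormZ// ger0_norm ?invr_ge0 ?(ltW A0)// mulVf ?gt_eqF.
Qed.

Lemma normVd_ge0 : 0 <= normVd O s G.
Proof.
apply: (le_trans (normr_ge0 (G (fun=> 0) (fun=> 0)))); apply: sup_upper_bound.
  exact: has_sup_Vd.
by exists (fun=> 0), (fun=> 0); split; [exact: inV0|rewrite normV0 ler01].
Qed.

Lemma normZd_ge0 : 0 <= normZd O s G.
Proof.
apply: (le_trans (normr_ge0 (G (fun=> 0) (fun=> 0)))); apply: sup_upper_bound.
  exact: has_sup_Zd.
by exists (fun=> 0); split; [exact: inLp0|rewrite Lpnorm0// ler01].
Qed.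

End one_functional.

Lemma in_Wdual_fsub G1 G2 : in_Wdual O s G1 -> in_Wdual O s G2 -> in_Wdual O s (fsub G1 G2).
Proof.
move=> dG1 dG2; have [C1 C10 H1] := dual_constant _ dG1; have [C2 C20 H2] := dual_constant _ dG2.
split.
  move=> a v1 dv1 q1 v2 dv2 q2 W1 W2; rewrite /fsub (dG1.1 _ _ _ _ _ _ _ W1 W2) (dG2.1 _ _ _ _ _ _ _ W1 W2).
  by ring.
exists (C1 + C2) => v dv q W; rewrite mulrDl; apply: le_trans (ler_normB _ _) _.
by apply: lerD; [exact: H1|exact: H2].
Qed.

Lemma in_Wdual0 : in_Wdual O s (fun _ _ => 0 : R).
Proof.
split; first by move=> *; rewrite mulr0 addr0.
by exists 0 => *; rewrite normr0 mul0r.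
Qed.

(* Testing with |D|^(s-2) D. *)
Lemma Lpnorm_dual (D : 'rV[R]_n -> R) C : inLp O s D -> 0 <= C ->
  (forall q, inLp O r q -> `|RintO O (fun x => D x * q x)| <= C * Lpnorm O r q) ->
  Lpnorm O s D <= C.
Proof.
move=> Ds C0 H.
have s2' := s2.
have Ds' := (inLpP _ _ _ _ _ s0).1 Ds.
have s10 : 0 < s - 1 by lra.
(* Here [|q| = |D|^(s-1)] and [(s-1) r = s], so the [L^r] norm of [q] is the power [s-1] of the
   [L^s] norm of [D], while [D q = |D|^s]. *)
pose q x := `|D x| `^ (s - 2) * D x.
have qE t : zext R n O q t = `|zext R n O D t| `^ (s - 2) * zext R n O D t.
  by rewrite /zext; case: ifP => // _; rewrite mulr0.
have nq (y : R) : `| `|y| `^ (s - 2) * y| = `|y| `^ (s - 1).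
  rewrite normrM ger0_norm ?powR_ge0// mulrC.
  by rewrite (_ : s - 2 = s - 1 - 1) ?mulr_powRB1//; ring.
have mq : measurable_fun [set: n.-tuple R] (zext R n O q).
  have : measurable_fun [set: n.-tuple R] (fun t => `|zext R n O D t| `^ (s - 2) * zext R n O D t).
    by apply: measurable_funM; [apply: measurable_norm_powR; case: Ds'|case: Ds'].
  by congr measurable_fun; apply/funext => t; rewrite qE.
have pr := memLp_powR_fun _ _ R mu s (s - 1) (zext R n O D) s10 s0 Ds'.
have nqE : (fun t => `|zext R n O q t|) = (fun t => `|zext R n O D t| `^ (s - 1)).
  by apply/funext => t; rewrite qE nq.
have qr : inLp O r q.
  apply/(inLpP _ _ _ _ _ r0).
  apply: (memLp_le _ _ R mu r _ _ (ltW r0) mq pr) => t.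
  by rewrite qE nq; exact: ler_norm.
have nqr : Lpnorm O r q = Lpnorm O s D `^ (s - 1).
  rewrite (LpnormE _ _ _ _ _ r0 qr) (LpnormE _ _ _ _ _ s0 Ds).
  rewrite -(nLp_norm _ _ R mu r (zext R n O q)) nqE.
  exact: (nLp_powR_fun _ _ R mu s (s - 1) (zext R n O D) s10 s0).
have [i _] := hoelder_O R n O s r D q s0 r0 sr Ds qr.
have RE : RintO O (fun x => D x * q x) = Lpnorm O s D `^ s.
  rewrite (RintOE _ _ _ _ i) (LpnormE _ _ _ _ _ s0 Ds) (nLp_powR _ _ R mu s _ s0).
  congr fine; apply: eq_integral => t _; congr (_%:E).
  rewrite ext_mul qE mulrCA -expr2 -(real_normK (num_real _)) expr2 mulrA.
  rewrite (mulrC (_ `^ _)) -mulrA (mulrC (_ `^ _)) (_ : s - 2 = s - 1 - 1); last by ring.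
  by rewrite mulr_powRB1// mulr_powRB1.
have := H q qr; rewrite nqr RE => H1.
(* The case of norm zero is separated because the power [s-1] of the norm is cancelled. *)
have := Lpnorm_ge0 R n O s D; rewrite le_eqVlt => /predU1P[<-//|A0].
move: H1; rewrite ger0_norm ?powR_ge0// -(mulr_powRB1 (ltW A0) s0).
by rewrite ler_pM2r// powR_gt0.
Qed.

End dual_norms.

(** * The inf-sup inequality for the pressure *)

Section inf_sup.
Variables (R : realType) (m : nat).
Local Notation n := m.+1.
Variables (O : set 'rV[R]_n) (K s : R).
Hypothesis OK : forall t, O (rV_of_tuple t) -> box R K n t.
Hypothesis K0 : 0 <= K.
Hypothesis oO : open O.
Hypothesis s2 : 2 < s.
Local Notation mu := (lebesgue_tuple R n).
Local Notation ext := (zext R n O).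
Local Notation r := (conj_exp s).

Let s0 : 0 < s. Proof. have s2' := s2; lra. Qed.
Let r0 : 0 < r. Proof. exact: lt_trans (conj_exp_gt1 _ _ s2). Qed.
Let sr := conj_exp_sum R s s2.

Definition tuple_of_rV (x : 'rV[R]_n) : n.-tuple R := [tuple x 0 i | i < n].

Lemma rV_of_tupleK t : tuple_of_rV (rV_of_tuple t) = t.
Proof. by apply: eq_from_tnth => i; rewrite tnth_mktuple mxE. Qed.

(** The source is extended by zero before integration, so the field is defined along the entire line
    through [x], also when that line leaves the domain and re-enters it. *)
Definition prim_field (g : 'rV[R]_n -> R) (x : 'rV[R]_n) : 'rV[R]_n :=
  prim R m (ext g) (tuple_of_rV x) *: delta_mx 0 0.

Section bounded_source.
Variables (g : 'rV[R]_n -> R) (N : R).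
Hypothesis mg : measO O g.
Hypothesis g0 : forall x, 0 <= g x.
Hypothesis gN : forall x, g x <= N.

Lemma truncation_level_ge0 : 0 <= N.
Proof. exact: le_trans (g0 0) (gN 0). Qed.

Lemma ext_source_ge0 t : 0 <= ext g t.
Proof. by rewrite /zext; case: ifP. Qed.

Lemma ext_source_le t : ext g t <= N.
Proof. by rewrite /zext; case: ifP => // _; exact: truncation_level_ge0. Qed.

Lemma ext_source_out t : ~ box R K n t -> ext g t = 0.
Proof. by move=> bt; rewrite /zext ifF//; apply/negP; rewrite inE => /OK. Qed.

Let mprim := measurable_prim R m (ext g) mg ext_source_ge0.
Let prim0 := prim_ge0 R m (ext g) ext_source_ge0.

Lemma ext_prim_field_coord i t : ext (fun x => prim_field g x 0 i) t =
  if rV_of_tuple t \in O then prim R m (ext g) t * (i == 0)%:R else 0.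
Proof. by rewrite /zext; case: ifP => // _; rewrite mxE rV_of_tupleK !mxE eqxx. Qed.

Lemma enorm_prim_field x : enorm (prim_field g x) = prim R m (ext g) (tuple_of_rV x).
Proof.
rewrite enormZ ger0_norm ?prim0// (_ : enorm _ = 1) ?mulr1//.
rewrite /enorm (_ : dotp _ _ = 1) ?sqrtr1// /dotp (bigD1 0)//= big1 ?addr0.
  by rewrite !mxE !eqxx mulr1.
by move=> i /negbTE i0; rewrite !mxE i0 andbF mul0r.
Qed.

Lemma prim_field_inLpvec : inLpvec O s (prim_field g).
Proof.
have mc i : measO O (fun x => prim_field g x 0 i).
  rewrite /measO.
  have : measurable_fun [set: n.-tuple R]
      (fun t => if rV_of_tuple t \in O then prim R m (ext g) t * (i == 0)%:R else 0).
    apply: measurable_fun_ifT.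
    - apply: (measurable_fun_bool true); rewrite setTI.
      rewrite (_ : _ @^-1` _ = [set t | O (rV_of_tuple t)]); first exact: measurable_open_tuple.
      by apply/seteqP; split => t /= => [/set_mem|/mem_set].
    - by apply: measurable_funM => //; exact: mprim.
    - exact: measurable_cst.
  by congr measurable_fun; apply/funext => t; rewrite -ext_prim_field_coord.
apply/inLpvecE; split => //.
apply: (bounded_inLp R n O K OK s _ (N * K *+ 2) s0); first exact: measO_enorm.
move=> x; rewrite enorm_prim_field ger0_norm ?prim0//.
exact: (prim_le R m K N (ext g) mg K0 ext_source_ge0 ext_source_le ext_source_out).
Qed.

Lemma source_inLp : inLp O s g.
Proof.
apply: (bounded_inLp R n O K OK s _ N s0) => // x.
by rewrite ger0_norm.
Qed.

Lemma prim_field_inV : inV O s (prim_field g) g.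
Proof.
split; first exact: prim_field_inLpvec.
split; first exact: source_inLp.
move=> phi tphi.
have gphi := grad_inLpvec R n O K OK r phi r0 tphi.
have pphi := test_fun_inLp R n O K OK r phi r0 tphi.
have [i1 _] := hoelder_vec R n O s r _ _ s0 r0 sr prim_field_inLpvec gphi.
have [i2 _] := hoelder_O R n O s r _ _ s0 r0 sr source_inLp pphi.
rewrite (RintOE _ _ _ _ i1) (RintOE _ _ _ _ i2).
have := prim_weak_div R m K N (ext g) mg K0 ext_source_ge0 ext_source_le ext_source_out
  O phi OK tphi.
congr (_ = - _); apply: eq_Rintegral => t _.
  rewrite /zext; case: ifPn => [_|/negP]; last first.
    by rewrite inE => tO; rewrite (test_fun_derive_out _ _ _ _ tphi)// mulr0.
  rewrite dotpZl rV_of_tupleK; congr (_ * _).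
  rewrite /dotp (bigD1 0)//= big1 ?addr0; first by rewrite !mxE !eqxx mul1r.
  by move=> i /negbTE i0; rewrite !mxE i0 andbF mul0r.
rewrite [in RHS]/zext; case: ifPn => [tO|tO]; first by rewrite /zext tO.
by rewrite /zext (negbTE tO) mul0r.
Qed.

(** On the domain the first coordinate lies in [[-K, K]], where [prim_Ls] bounds the field by
    [(2K)^s] times the [s]-th power of the norm of [g]; the summand 1 accounts for the divergence,
    which is [g] itself. *)
Lemma normV_prim_field : normV O s (prim_field g) g <=
  ((K *+ 2) `^ s + 1) `^ s^-1 * Lpnorm O s g.
Proof.
have gs := source_inLp; have gs' := (inLpP _ _ _ _ _ s0).1 gs.
have vs := prim_field_inLpvec; have /inLpvecE[mv es] := vs.
have es' := (inLpP _ _ _ _ _ s0).1 es.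
have Afin := memLp_fin _ _ R mu s _ gs'.
have AE : Lpnorm O s g `^ s = fine (\int[mu]_t (`|ext g t| `^ s)%:E).
  by rewrite (LpnormE _ _ _ _ _ s0 gs) (nLp_powR _ _ R mu s _ s0).
have XE : (Lpvecnorm O s (prim_field g) `^ s)%:E =
    (\int[mu]_t (`|ext (fun x => enorm (prim_field g x)) t| `^ s)%:E)%E.
  rewrite LpvecnormE (LpnormE _ _ _ _ _ s0 es) (nLp_powR _ _ R mu s _ s0).
  by rewrite (fineK (memLp_fin _ _ R mu s _ es')).
have {}AE : (Lpnorm O s g `^ s)%:E = (\int[mu]_t (`|ext g t| `^ s)%:E)%E.
  by rewrite AE; exact: (fineK Afin).
rewrite /normV; move: (Lpvecnorm O s (prim_field g)) XE => X XE.
move: (Lpnorm O s g) (Lpnorm_ge0 R n O s g) AE => A A0 AE.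
have mth := measurable_thead_indic R m K.
have XA : X `^ s <= (K *+ 2) `^ s * A `^ s.
  rewrite -lee_fin EFinM XE AE.
  have H := prim_Ls R m K N (ext g) mg K0 ext_source_ge0 ext_source_le ext_source_out s s2.
  rewrite (eq_integral (fun t => (ext g t `^ s)%:E) (fun t => (`|ext g t| `^ s)%:E)); last first.
    by move=> t _; rewrite (ger0_norm (ext_source_ge0 t)).
  apply: le_trans _ H; apply: ge0_le_integral => //.
  - by apply/measurable_EFinP; apply: measurable_norm_powR; case: es'.
  - apply/measurable_EFinP/measurable_funM => //.
    exact: (measurableT_comp (measurable_powR s) mprim).
  move=> t _; rewrite lee_fin /zext; case: ifPn => [/set_mem tO|_].
    rewrite enorm_prim_field rV_of_tupleK (ger0_norm (prim0 t)).
    rewrite indicE mem_set ?mul1r//.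
    by rewrite /= in_itv/= -ler_norml; exact: (OK t tO ord0).
  by rewrite normr0 powR0 ?gt_eqF// mulr_ge0 ?powR_ge0.
have -> : ((K *+ 2) `^ s + 1) `^ s^-1 * A = (((K *+ 2) `^ s + 1) * A `^ s) `^ s^-1.
  by rewrite powRM ?powR_ge0 ?addr_ge0 ?powR_ge0// -[in RHS]powRrM mulfV ?gt_eqF// powRr1.
apply: ge0_ler_powR; rewrite ?invr_ge0 ?(ltW s0) ?nnegrE ?mulr_ge0 ?addr_ge0 ?powR_ge0//.
by rewrite mulrDl mul1r lerD2r.
Qed.

End bounded_source.

(** Bound for the right inverse [prim_field] of the divergence on bounded nonnegative sources. *)
Definition inf_sup_constant := ((K *+ 2) `^ s + 1) `^ s^-1.
Local Notation C0 := inf_sup_constant.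

Lemma inf_sup_constant_ge0 : 0 <= C0.
Proof. exact: powR_ge0. Qed.

Section one_side.
Variables (e : 'rV[R]_n -> R) (C : R).
Hypothesis er : inLp O r e.
Hypothesis C_ge0 : 0 <= C.
Hypothesis He : forall v dv, inV O s v dv -> RintO O (fun x => dv x * e x) <= C * normV O s v dv.

(** Untruncated, this is the extremal source [g = (e^+)^(r-1)], for which [g^s = g e = (e^+)^r].
    Truncation makes it bounded, as [prim_field_inV] requires. *)
Definition trunc_source (N : nat) (x : 'rV[R]_n) : R :=
  Num.min (Num.max (e x) 0 `^ (r - 1)) N%:R.

Lemma ext_trunc N t : ext (trunc_source N) t = Num.min (Num.max (ext e t) 0 `^ (r - 1)) N%:R.
Proof.
have r1 := conj_exp_gt1 _ _ s2.
rewrite /zext; case: ifP => // _; rewrite maxxx powR0 ?min_l//.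
by rewrite gt_eqF// subr_gt0.
Qed.

Lemma trunc_meas N : measO O (trunc_source N).
Proof.
have : measurable_fun [set: n.-tuple R] (fun t => Num.min (Num.max (ext e t) 0 `^ (r - 1)) N%:R).
  apply: measurable_minr; last exact: measurable_cst.
  apply: (measurableT_comp (measurable_powR _)).
  by apply: measurable_maxr; [case: er|exact: measurable_cst].
by congr measurable_fun; apply/funext => t; rewrite -ext_trunc.
Qed.

Lemma trunc_ge0 N x : 0 <= trunc_source N x.
Proof. by rewrite le_min powR_ge0 ler0n. Qed.

Lemma trunc_le N x : trunc_source N x <= N%:R.
Proof. by rewrite ge_min lexx orbT. Qed.

(* [f^(s-1) <= e+] because [(r-1)(s-1) = 1]. *)
Lemma trunc_powR_le N x : trunc_source N x `^ s <= trunc_source N x * e x.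
Proof.
have s2' := s2; have s10 : 0 < s - 1 by lra.
have f0 := trunc_ge0 N x.
have [e0|e0] := leP (e x) 0.
  have r1 := conj_exp_gt1 _ _ s2.
  have -> : trunc_source N x = 0.
    rewrite /trunc_source max_r// powR0 ?min_l// gt_eqF//; lra.
  by rewrite powR0 ?gt_eqF// mul0r.
rewrite -(mulr_powRB1 f0 s0); apply: ler_wpM2l => //.
have -> : e x = (e x `^ (r - 1)) `^ (s - 1).
  by rewrite -powRrM conj_expB1// mulVf ?gt_eqF// powRr1// ltW.
apply: ge0_ler_powR; rewrite ?nnegrE ?powR_ge0 ?(ltW s10)//.
by rewrite /trunc_source max_l ?(ltW e0)// ge_min lexx.
Qed.

(** With [A] the norm of the source, [A^s] is at most the integral of source times [e], hence at
    most [C C0 A]. Dividing by [A] and raising to the power [r] gives a bound free of [N]. *)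
Lemma trunc_bound N :
  (\int[mu]_t (ext (trunc_source N) t `^ s)%:E <= ((C * C0) `^ r)%:E)%E.
Proof.
have s2' := s2; have s10 : 0 < s - 1 by lra.
pose g := trunc_source N.
have mg := trunc_meas N; have g0 := trunc_ge0 N; have gN := trunc_le N.
have gs := source_inLp g N%:R mg g0 gN; have gs' := (inLpP _ _ _ _ _ s0).1 gs.
have Afin := memLp_fin _ _ R mu s _ gs'.
have AE : Lpnorm O s g `^ s = fine (\int[mu]_t (`|ext g t| `^ s)%:E).
  by rewrite (LpnormE _ _ _ _ _ s0 gs) (nLp_powR _ _ R mu s _ s0).
have -> : (\int[mu]_t (ext g t `^ s)%:E = (Lpnorm O s g `^ s)%:E)%E.
  rewrite AE; apply: (eq_trans _ (esym (fineK Afin))); apply: eq_integral => t _.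
  by rewrite (ger0_norm (ext_source_ge0 g g0 t)).
have H1 : RintO O (fun x => g x * e x) <= C * (C0 * Lpnorm O s g).
  apply: le_trans (He _ _ (prim_field_inV g N%:R mg g0 gN)) _.
  by apply: ler_wpM2l => //; exact: (normV_prim_field g N%:R mg g0 gN).
have [i _] := hoelder_O R n O s r _ _ s0 r0 sr gs er.
have H2 : Lpnorm O s g `^ s <= RintO O (fun x => g x * e x).
  rewrite (RintOE _ _ _ _ i) AE; apply: (le_Rintegral measurableT) => //.
    apply/integrableP; split.
      by apply/measurable_EFinP; apply: measurable_norm_powR; case: gs'.
    case: gs' => _; apply: le_lt_trans; rewrite le_eqVlt; apply/orP; left; apply/eqP.
    by apply: eq_integral => t _ /=; rewrite (ger0_norm (powR_ge0 _ _)).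
  move=> t _; rewrite (ger0_norm (ext_source_ge0 g g0 t)) /zext; case: ifP => _.
    exact: trunc_powR_le.
  by rewrite powR0// gt_eqF.
have A0 := Lpnorm_ge0 R n O s g; rewrite lee_fin.
move: (Lpnorm O s g) A0 (le_trans H2 H1) => A A0 H.
have CC0 : 0 <= C * C0 by rewrite mulr_ge0 ?inf_sup_constant_ge0.
move: A0; rewrite le_eqVlt => /predU1P[<-|A0]; first by rewrite powR0 ?gt_eqF// powR_ge0.
have H3 : A `^ (s - 1) <= C * C0.
  by rewrite -(ler_pM2l A0) mulr_powRB1 ?(ltW A0)// mulrC -mulrA.
have -> : A `^ s = (A `^ (s - 1)) `^ r.
  by rewrite -powRrM /conj_exp mulrC divfK// gt_eqF.
by apply: ge0_ler_powR; rewrite ?nnegrE ?powR_ge0 ?(ltW r0).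
Qed.

(** Monotone convergence in the truncation level; the limit has exponent [r] because
    [(r-1) s = r]. *)
Lemma pos_part_bound :
  (\int[mu]_t (Num.max (ext e t) 0 `^ r)%:E <= ((C * C0) `^ r)%:E)%E.
Proof.
have s2' := s2; have s10 : 0 < s - 1 by lra.
have r1 := conj_exp_gt1 _ _ s2.
pose h (N : nat) t : \bar R := (ext (trunc_source N) t `^ s)%:E.
have h0 N t : (0 <= h N t)%E by rewrite lee_fin powR_ge0.
have mh N : measurable_fun [set: n.-tuple R] (h N).
  apply/measurable_EFinP; apply: (measurableT_comp (measurable_powR s)).
  exact: trunc_meas.
have ndh t : {homo h ^~ t : N M / (N <= M)%N >-> (N <= M)%E}.
  move=> N M NM; rewrite lee_fin; apply: ge0_ler_powR;
    rewrite ?(ltW s0) ?nnegrE ?(ext_source_ge0 _ (trunc_ge0 _))// !ext_trunc.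
  by rewrite le_min !ge_min lexx/= ler_nat NM orbT.
have hlim t : limn (h ^~ t) = (Num.max (ext e t) 0 `^ r)%:E.
  apply: lim_near_cst => //.
  (* At a fixed point the truncation is inactive from this level on, so the sequence is eventually
     constant. *)
  exists (Num.truncn (Num.max (ext e t) 0 `^ (r - 1))).+1 => // N /= HN.
  rewrite /h ext_trunc min_l.
    by rewrite -powRrM (_ : (r - 1) * s = r)// /conj_exp; field; rewrite gt_eqF.
  apply/ltW/(lt_le_trans (truncnS_gt _)); by rewrite ler_nat.
have := @monotone_convergence _ _ R mu setT measurableT h mh (fun N t _ => h0 N t) (fun t _ => ndh t).
rewrite (eq_integral (fun t => (Num.max (ext e t) 0 `^ r)%:E)); last by move=> t _; rewrite hlim.
move=> ->; apply: lime_le; last by near=> N; exact: trunc_bound.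
apply: ereal_nondecreasing_is_cvgn => N M NM.
by apply: ge0_le_integral => // t _; exact: ndh.
Unshelve. all: by end_near. Qed.

End one_side.

Lemma norm_powR_le_parts (y : R) : `|y| `^ r <= Num.max y 0 `^ r + Num.max (- y) 0 `^ r.
Proof.
have [y0|y0] := ger0P y.
  by rewrite lerDl powR_ge0.
by rewrite (@max_l _ _ (- y)) ?lerDr ?powR_ge0// oppr_ge0 ltW.
Qed.

(** The one-sided bound is applied to [e] and to [-e]; for the latter the fields [v] are replaced by
    [-v], which have the same norm. *)
Lemma inf_sup e C : inLp O r e -> 0 <= C ->
  (forall v dv, inV O s v dv -> `|RintO O (fun x => dv x * e x)| <= C * normV O s v dv) ->
  Lpnorm O r e <= 2 * C0 * C.
Proof.
move=> er C_ge0 He.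
have er' := (inLpP _ _ _ _ _ r0).1 er.
have H1 : (\int[mu]_t (Num.max (ext e t) 0 `^ r)%:E <= ((C * C0) `^ r)%:E)%E.
  by apply: pos_part_bound => // v dv Vv; exact: le_trans (ler_norm _) (He _ _ Vv).
have extN t : ext (fun x => - e x) t = - ext e t.
  by rewrite /zext; case: ifP => // _; rewrite oppr0.
have H2 : (\int[mu]_t (Num.max (- ext e t) 0 `^ r)%:E <= ((C * C0) `^ r)%:E)%E.
  rewrite (eq_integral (fun t => (Num.max (ext (fun x => - e x) t) 0 `^ r)%:E)); last first.
    by move=> t _; rewrite extN.
  have EN : (fun x => -1 * e x) = (fun x => - e x) by apply/funext => x; rewrite mulN1r.
  have Nr := inLpZ R n O r (-1) e r0 er; rewrite EN in Nr.
  apply: (pos_part_bound _ _ Nr C_ge0) => v dv Vv; have := He _ _ (inVZ R n O K s OK s2 (-1) v dv Vv).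
  rewrite (normVZ R n O s s2 (-1) v dv Vv) normrN1 mul1r; apply: le_trans.
  apply: le_trans (ler_norm _) _; rewrite le_eqVlt; apply/orP; left; apply/eqP.
  by congr `|RintO O _|; apply/funext => x; rewrite mulN1r mulrN mulNr.
have mp (h : n.-tuple R -> R) : measurable_fun [set: n.-tuple R] h ->
    measurable_fun [set: n.-tuple R] (fun t => (Num.max (h t) 0 `^ r)%:E).
  move=> mh; apply/measurable_EFinP; apply: (measurableT_comp (measurable_powR r)).
  by apply: measurable_maxr => //; exact: measurable_cst.
have me : measurable_fun [set: n.-tuple R] (ext e) by case: er.
have mNe : measurable_fun [set: n.-tuple R] (fun t => - ext e t) by exact: measurableT_comp.
have H3 : (\int[mu]_t (`|ext e t| `^ r)%:E <= ((2 * C0 * C) `^ r)%:E)%E.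
  apply: (@le_trans _ _ (\int[mu]_t ((Num.max (ext e t) 0 `^ r)%:E + (Num.max (- ext e t) 0 `^ r)%:E))%E).
    apply: ge0_le_integral => //.
    - by apply/measurable_EFinP; exact: measurable_norm_powR.
    - by apply: emeasurable_funD; exact: mp.
    - by move=> t _; rewrite -EFinD lee_fin norm_powR_le_parts.
  have pz (y : R) : (0 <= (Num.max y 0 `^ r)%:E)%E by rewrite lee_fin powR_ge0.
  rewrite (ge0_integralD mu measurableT (fun t _ => pz (ext e t)) (mp _ me)
    (fun t _ => pz (- ext e t)) (mp _ mNe)).
  apply: le_trans (leeD H1 H2) _; rewrite -EFinD lee_fin.
  rewrite -mulrA (mulrC C0) powRM ?mulr_ge0 ?inf_sup_constant_ge0//.
  rewrite -[X in X + _]mul1r -[X in _ + X]mul1r -mulrDl; apply: ler_wpM2r; first exact: powR_ge0.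
  (* The two parts contribute a factor 2, which is at most [2^r]; this is where the 2 in the
     constant comes from. *)
  by rewrite (_ : 1 + 1 = 2)//; apply: le1r_powR; [lra|exact/ltW/conj_exp_gt1].
have B0 : 0 <= 2 * C0 * C by rewrite !mulr_ge0 ?inf_sup_constant_ge0.
rewrite (LpnormE _ _ _ _ _ r0 er) nLpE -[leRHS](powRr1 B0) -[X in _ <= _ `^ X](mulfV (lt0r_neq0 r0)) powRrM.
apply: ge0_ler_powR; rewrite ?invr_ge0 ?(ltW r0) ?nnegrE ?powR_ge0//.
  exact/fine_ge0/int_powR_ge0.
by rewrite -lee_fin (fineK (memLp_fin _ _ R mu r _ er')).
Qed.

End inf_sup.

(** * The inequalities between real numbers *)

Section real_inequalities.
Variables (R : realType) (s : R).
Hypothesis s2 : 2 < s.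
Local Notation r := (conj_exp s).

Let s10 : 0 < s - 1. Proof. have s2' := s2; lra. Qed.
Let s20 : 0 < s - 2. Proof. have s2' := s2; lra. Qed.

Lemma powR_conjK (b : R) : 0 <= b -> (b `^ (r - 1)) `^ (s - 1) = b.
Proof. by move=> b0; rewrite -powRrM conj_expB1// mulVf ?gt_eqF// powRr1. Qed.

Lemma powR_mono (p x y : R) : 0 <= p -> 0 <= x -> x <= y -> x `^ p <= y `^ p.
Proof.
by move=> p0 x0 xy; apply: ge0_ler_powR; rewrite ?nnegrE//; exact: le_trans xy.
Qed.

Lemma powR_split1 (x : R) : 0 <= x -> x `^ (s - 1) = x * x `^ (s - 2).
Proof. by move=> x0; rewrite (_ : s - 2 = s - 1 - 1) ?mulr_powRB1//; ring. Qed.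

Lemma powR_split2 (x : R) : 0 <= x -> x `^ s = x * x `^ (s - 1).
Proof. by move=> x0; rewrite mulr_powRB1//; have s2' := s2; lra. Qed.

(** Here [u], [E], [Phi] stand for the norms of velocity, pressure and nonlinear term, [b] and [g]
    for dual norms. If [u] does not exceed [X = 1 + b^(r-1) + g], the bound is immediate. Otherwise
    [u > X >= 1], every term on the right of the energy inequality is at most a multiple of
    [X u^(s-1)], and division by [u^(s-1)] concludes. *)
Lemma apriori_bound (c2 k C1 C3 b g u E Phi : R) : 0 < c2 -> 0 <= k -> 0 <= C1 -> 0 <= C3 ->
  0 <= b -> 0 <= g -> 0 <= u ->
  c2 * u `^ s <= b * (u + g) + g * E -> E <= C1 * (b + Phi) ->
  Phi <= C3 * (k + u) `^ (s - 2) * u ->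
  u <= (1 + (2 + C1 + C1 * C3 * (k + 1) `^ (s - 2)) / c2) * (1 + b `^ (r - 1) + g).
Proof.
move=> c20 k0 C10 C30 b0 g0 u0 H HE HP.
set Y := (k + 1) `^ (s - 2); have Y0 : 0 <= Y by exact: powR_ge0.
set X := 1 + b `^ (r - 1) + g.
have B0 : 0 <= b `^ (r - 1) by exact: powR_ge0.
have X1 : 1 <= X by rewrite /X; lra.
have X0 : 0 <= X by lra.
have gX : g <= X by rewrite /X; lra.
set D := 2 + C1 + C1 * C3 * Y.
have D0 : 0 <= D by rewrite /D !addr_ge0 ?mulr_ge0.
have Dc : 0 <= D / c2 by rewrite divr_ge0// ltW.
have [uX|Xu] := leP u X; first by rewrite mulrDl mul1r ler_wpDr// mulr_ge0.
have bX : b <= X `^ (s - 1).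
  rewrite -[leLHS](powR_conjK b b0); apply: powR_mono => //; first exact: ltW.
  by rewrite /X; lra.
have Xp : X `^ (s - 2) <= u `^ (s - 2) by apply: powR_mono; rewrite ?(ltW s20) ?(ltW Xu).
have Xq : X `^ (s - 1) <= u `^ (s - 1) by apply: powR_mono; rewrite ?(ltW s10) ?(ltW Xu).
(* Since [u > 1], [k + u <= (k + 1) u]: this is where [k + 1] in the constant comes from. *)
have ku : (k + u) `^ (s - 2) <= Y * u `^ (s - 2).
  rewrite -powRM//; last by lra.
  apply: powR_mono; rewrite ?(ltW s20)//; first by lra.
  by rewrite mulrDl mul1r lerD2r; nra.
have U0 : 0 <= u `^ (s - 1) by exact: powR_ge0.
have V0 : 0 <= u `^ (s - 2) by exact: powR_ge0.
have HP' : Phi <= C3 * Y * u `^ (s - 1).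
  apply: le_trans HP _; rewrite powR_split1// (mulrC u) mulrA.
  by apply: ler_wpM2r => //; rewrite -mulrA; exact: ler_wpM2l.
have HE' : E <= C1 * (1 + C3 * Y) * u `^ (s - 1).
  apply: le_trans HE _; rewrite -mulrA; apply: ler_wpM2l => //.
  by rewrite mulrDl mul1r; apply: lerD => //; exact: le_trans Xq.
have T1 : b * (u + g) <= 2 * X * u `^ (s - 1).
  have A1 : b <= X * u `^ (s - 2).
    by apply: le_trans bX _; rewrite powR_split1//; exact: ler_wpM2l.
  apply: (@le_trans _ _ (X * u `^ (s - 2) * (2 * u))).
    by apply: ler_pM => //; [rewrite addr_ge0|lra].
  by rewrite powR_split1// le_eqVlt; apply/orP; left; apply/eqP; ring.
have T2 : g * E <= X * (C1 * (1 + C3 * Y) * u `^ (s - 1)).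
  apply: le_trans (ler_wpM2l g0 HE') _; apply: ler_wpM2r => //.
  by rewrite !mulr_ge0 ?addr_ge0 ?mulr_ge0.
have up : 0 < u by lra.
have T3 : c2 * u <= D * X.
  rewrite -(ler_pM2r (powR_gt0 (s - 1) up)) -mulrA -powR_split2 ?(ltW up)//.
  apply: le_trans H (le_trans (lerD T1 T2) _).
  by rewrite /D le_eqVlt; apply/orP; left; apply/eqP; ring.
rewrite mulrDl mul1r; apply: ler_wpDl => //.
by rewrite mulrAC ler_pdivlMr// mulrC.
Qed.

(** Here [y], [d], [E] are the norms of the differences of velocity, divergence and pressure.
    Inserting the pressure bound makes the energy inequality [c2 y^s <= A (b y + b g + P g y)] with
    [P = M^(s-2)]. This bounds [y] by a multiple of [Z = b^(r-1) + g + (P g)^(r-1)], and the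
    pressure by multiples of [b] and [P y], so it remains to expand [P Z]. *)
Lemma stability_bound (c2 C1 C2 M b g y d E Phi : R) : 0 < c2 -> 0 <= C1 -> 0 <= C2 ->
  1 <= M -> 0 <= b -> 0 <= g -> g <= M -> 0 <= y -> 0 <= d -> d <= g ->
  c2 * y `^ s <= b * (y + g) + g * E -> E <= C1 * (b + Phi) ->
  Phi <= C2 * M `^ (s - 2) * y ->
  y + d + E <= (1 + C1 + 2 * ((1 + C1 * C2) * (1 + 3 * (1 + C1 + C1 * C2) / c2))) *
    (b + M `^ (s - 2) * b `^ (r - 1) + g + M `^ (r * (s - 2)) * g `^ (r - 1)).
Proof.
move=> c20 C10 C20 M1 b0 g0 gM y0 d0 dg H HE HP.
have M0 : 0 < M by lra.
set P := M `^ (s - 2); have P1 : 1 <= P.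
  by rewrite -[leLHS](powRr0 M); apply: ler_powR; [exact: M1|exact: (ltW s20)].
have r1 := conj_exp_gt1 _ _ s2.
have r2 : r <= 2 by rewrite /conj_exp ler_pdivrMr//; have s2' := s2; lra.
set A := 1 + C1 + C1 * C2.
have CC : 0 <= C1 * C2 by rewrite mulr_ge0.
have A0 : 0 <= A by rewrite /A; lra.
set bb := b `^ (r - 1); set gg := g `^ (r - 1).
have bb0 : 0 <= bb by exact: powR_ge0.
have gg0 : 0 <= gg by exact: powR_ge0.
set Q := P `^ (r - 1).
have Q0 : 0 <= Q by exact: powR_ge0.
(* [Q * gg] is [(P g)^(r-1)]: the threshold is chosen so that [Z^(s-1)] dominates both [b] and
   [P g]. *)
set Z := bb + g + Q * gg.
have Z0 : 0 <= Z by rewrite /Z !addr_ge0 ?mulr_ge0.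
have E' : E <= C1 * b + C1 * C2 * P * y.
  by apply: le_trans HE _; rewrite mulrDr -!mulrA lerD2l; apply: ler_wpM2l => //; rewrite mulrA.
have yZ : y <= (1 + 3 * A / c2) * Z.
  have Ac : 0 <= 3 * A / c2 by rewrite divr_ge0 ?mulr_ge0// ltW.
  have [yZ|Zy] := leP y Z; first by rewrite mulrDl mul1r ler_wpDr// mulr_ge0.
  set W := Z `^ (s - 1); have W0 : 0 <= W by exact: powR_ge0.
  have bW : b <= W.
    rewrite -[leLHS](powR_conjK b b0); apply: powR_mono => //; first exact: ltW.
    by rewrite /Z -/bb; have := mulr_ge0 Q0 gg0; lra.
  have gPW : P * g <= W.
    have Pg0 : 0 <= P * g by rewrite mulr_ge0//; lra.
    rewrite -[leLHS](powR_conjK _ Pg0); apply: powR_mono; rewrite ?powR_ge0 ?(ltW s10)//.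
    by rewrite powRM//; [rewrite -/Q -/gg /Z; lra|lra].
  have gZ : g <= Z by rewrite /Z; have := mulr_ge0 Q0 gg0; lra.
  have T1 : b * (y + g) + g * E <= A * (b * y + b * g + P * g * y).
    have B1 := ler_wpM2l g0 E'.
    have Hby : 0 <= b * y by rewrite mulr_ge0.
    have Hbg : 0 <= b * g by rewrite mulr_ge0.
    have HPgy : 0 <= P * g * y by rewrite !mulr_ge0//; lra.
    have X1 := mulr_ge0 C10 Hby; have X2 := mulr_ge0 CC Hby.
    have X3 := mulr_ge0 CC Hbg; have X4 := mulr_ge0 C10 HPgy.
    apply: le_trans (lerD (lexx _) B1) _.
    rewrite -subr_ge0.
    have -> : A * (b * y + b * g + P * g * y) - (b * (y + g) + g * (C1 * b + C1 * C2 * P * y)) =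
      C1 * (b * y) + C1 * C2 * (b * y) + C1 * C2 * (b * g) + P * g * y + C1 * (P * g * y).
      by rewrite /A; ring.
    by rewrite !addr_ge0.
  have T2 : b * y + b * g + P * g * y <= 3 * (W * y).
    have U1 := ler_wpM2r y0 bW; have U2 := ler_wpM2r y0 gPW.
    have U3 : b * g <= W * y by apply: ler_pM => //; exact: le_trans gZ (ltW Zy).
    by lra.
  have yp : 0 < y by exact: le_lt_trans Zy.
  (* For [y > Z], only one factor [Z] of [W = Z^(s-1)] is kept and the others are replaced by [y],
     so that [y^(s-1)] can be cancelled. *)
  have T3 : W * y <= Z * y `^ (s - 1).
    rewrite /W !powR_split1// -mulrA; apply: ler_wpM2l => //.
    rewrite mulrC; apply: ler_wpM2l => //.
    by apply: powR_mono; rewrite ?(ltW s20) ?(ltW Zy).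
  have T4 : c2 * y <= 3 * A * Z.
    rewrite -(ler_pM2r (powR_gt0 (s - 1) yp)) -(mulrA c2) -powR_split2//.
    apply: le_trans H (le_trans T1 (le_trans (ler_wpM2l A0 T2) _)).
    apply: (@le_trans _ _ (A * (3 * (Z * y `^ (s - 1))))).
      by apply: ler_wpM2l => //; apply: ler_wpM2l.
    by rewrite le_eqVlt; apply/orP; left; apply/eqP; ring.
  rewrite mulrDl mul1r; apply: ler_wpDl => //.
  by rewrite mulrAC ler_pdivlMr// mulrC.
set B := 1 + 3 * A / c2 in yZ *.
have B0 : 0 <= B by rewrite addr_ge0// divr_ge0// ?mulr_ge0// (ltW c20).
set T := M `^ (r * (s - 2)).
have PQ : P * Q = T.
  rewrite /Q /P /T -powRrM -powRD; last by rewrite (gt_eqF M0) implybT.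
  by congr (M `^ _); ring.
(* Split [g = g^(r-1) g^(2-r)] and bound the second factor by [M^(2-r)], using [g <= M] and
   [r <= 2]; the exponents of [M] add up to [r (s - 2)]. *)
have PgT : P * g <= T * gg.
  have [->|g1] := eqVneq g 0; first by rewrite mulr0 mulr_ge0 ?powR_ge0.
  have gp : 0 < g by rewrite lt0r g1.
  have -> : g = g `^ (r - 1) * g `^ (2 - r).
    rewrite -powRD; last by rewrite (gt_eqF gp) implybT.
    by rewrite (_ : r - 1 + (2 - r) = 1) ?powRr1//; ring.
  rewrite -/gg mulrCA mulrC; apply: ler_wpM2r => //.
  apply: (@le_trans _ _ (P * M `^ (2 - r))).
    by apply: ler_wpM2l; [lra|apply: powR_mono => //; lra].
  rewrite /P /T -powRD; last by rewrite (gt_eqF M0) implybT.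
  by rewrite (conj_exp_mul R s s2) (_ : s - 2 + (2 - r) = s - r)//; ring.
have PZ : P * Z <= 2 * (P * bb + T * gg).
  have -> : P * Z = P * bb + P * g + T * gg by rewrite /Z -PQ; ring.
  have := mulr_ge0 (le_trans ler01 P1) bb0; lra.
have S1 : y + d + E <= (1 + C1 * C2) * (P * y) + g + C1 * b.
  have : y <= P * y by rewrite ler_peMl.
  have : 0 <= P * y by rewrite mulr_ge0//; lra.
  by rewrite -(mulrA _ P) in E'; lra.
have S2 : P * y <= B * (2 * (P * bb + T * gg)).
  apply: (@le_trans _ _ (P * (B * Z))); first by apply: ler_wpM2l => //; lra.
  by rewrite mulrCA; exact: ler_wpM2l.
have S3 := ler_wpM2l (_ : 0 <= 1 + C1 * C2) S2.
have {}S3 : (1 + C1 * C2) * (P * y) <= (1 + C1 * C2) * (B * (2 * (P * bb + T * gg))).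
  by apply: S3; lra.
have T0 : 0 <= T by exact: powR_ge0.
have Pbb : 0 <= P * bb by rewrite mulr_ge0//; lra.
have Tgg : 0 <= T * gg by rewrite mulr_ge0.
set L := (1 + C1 * C2) * B.
have L0 : 0 <= L by rewrite /L mulr_ge0//; lra.
apply: le_trans S1 _.
have -> : (1 + C1 + 2 * L) * (b + P * bb + g + T * gg) =
  (1 + C1 * C2) * (B * (2 * (P * bb + T * gg))) + g + C1 * b +
  (b + (1 + C1) * (P * bb + T * gg) + C1 * g + 2 * L * (b + g)).
  by rewrite /L; ring.
have W1 : 0 <= (1 + C1) * (P * bb + T * gg) by apply: mulr_ge0; lra.
have W2 : 0 <= C1 * g by rewrite mulr_ge0.
have W3 : 0 <= 2 * L * (b + g) by apply: mulr_ge0; lra.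
by lra.
Qed.

(** As [M >= 1] and [s - 2 <= r (s - 2)], both powers of [M] are at most [M^(r(s-2))]. Each of the
    four terms is then at most [S d] or [S D], with [S = (5k)^(r(s-2)) >= 1], which explains the
    factor 2. *)
Lemma dual_norm_bound (N1 N2 D M b g b1 g1 b2 g2 : R) :
  0 <= b -> b <= D -> 0 <= g -> g <= D ->
  0 <= b1 -> b1 <= N1 -> 0 <= g1 -> g1 <= N1 ->
  0 <= b2 -> b2 <= N2 -> 0 <= g2 -> g2 <= N2 ->
  M = 1 + ((b1 `^ (r - 1) + g1) + (b2 `^ (r - 1) + g2)) ->
  b + M `^ (s - 2) * b `^ (r - 1) + g + M `^ (r * (s - 2)) * g `^ (r - 1) <=
  2 * 5 `^ (r * (s - 2)) * (1 + N1 + N2) `^ (r * (s - 2)) * (D `^ (r - 1) + D).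
Proof.
move=> b0 bD g0 gD b10 b1N g10 g1N b20 b2N g20 g2N ME.
have r1 := conj_exp_gt1 _ _ s2.
have r2 : r <= 2 by rewrite /conj_exp ler_pdivrMr//; have s2' := s2; lra.
set k := 1 + N1 + N2; set p := r * (s - 2).
have k1 : 1 <= k by rewrite /k; lra.
have p0 : 0 <= p by rewrite mulr_ge0//; [lra|exact: ltW].
have sp : s - 2 <= p by rewrite /p ler_peMl//; [exact: ltW|lra].
have pk x : 0 <= x -> x <= k -> x `^ (r - 1) <= k.
  move=> x0 xk; apply: le_trans (powR_mono (r - 1) x k _ x0 xk) _; first by lra.
  by apply: ler1_powR => //; lra.
have B1 : b1 `^ (r - 1) <= k by apply: pk => //; rewrite /k; lra.
have B2 : b2 `^ (r - 1) <= k by apply: pk => //; rewrite /k; lra.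
have G1 : g1 <= k by rewrite /k; lra.
have G2 : g2 <= k by rewrite /k; lra.
have M1 : 1 <= M by have := powR_ge0 b1 (r - 1); have := powR_ge0 b2 (r - 1); rewrite ME; lra.
(* [M] has five summands, each at most [k = 1 + N1 + N2]; for the powers this uses [r - 1 <= 1] and
   [k >= 1]. *)
have M5 : M <= 5 * k by rewrite ME; lra.
have k0 : 0 <= k by lra.
set S := 5 `^ p * k `^ p.
have MS : M `^ p <= S.
  by rewrite /S -powRM//; apply: powR_mono => //; lra.
have MS' : M `^ (s - 2) <= S by apply: le_trans MS; exact: ler_powR.
have S1 : 1 <= S by apply: le_trans MS; rewrite -[leLHS](powRr0 M); exact: ler_powR.
set d := D `^ (r - 1); have d0 : 0 <= d by exact: powR_ge0.
have D0 : 0 <= D by lra.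
have bd : b `^ (r - 1) <= d by apply: powR_mono => //; lra.
have gd : g `^ (r - 1) <= d by apply: powR_mono => //; lra.
have T1 : M `^ (s - 2) * b `^ (r - 1) <= S * d by apply: ler_pM => //; exact: powR_ge0.
have T2 : M `^ p * g `^ (r - 1) <= S * d by apply: ler_pM => //; exact: powR_ge0.
have T3 : D <= S * D by rewrite ler_peMl.
have -> : 2 * 5 `^ p * k `^ p * (d + D) = S * d + S * d + S * D + S * D by rewrite /S; ring.
by lra.
Qed.

End real_inequalities.

(** * Estimates for the solutions and their differences *)

Section stability.
Variables (R : realType) (m : nat).
Local Notation n := m.+1.
Variables (O : set 'rV[R]_n) (K s c1 c2 : R) (F : 'rV[R]_n -> 'rV[R]_n).
Hypothesis OK : forall t, O (rV_of_tuple t) -> box R K n t.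
Hypothesis K0 : 0 <= K.
Hypothesis oO : open O.
Hypothesis s2 : 2 < s.
Hypothesis hc1 : 0 < c1.
Hypothesis hc2 : 0 < c2.
Hypothesis F0 : F 0 = 0.
Hypothesis F_lip : forall x y, enorm (F x - F y)
  <= c1 * (1 + enorm x `^ (s - 2) + enorm y `^ (s - 2)) * enorm (x - y).
Hypothesis F_mon : forall x y, c2 * enorm (x - y) `^ s <= dotp (F x - F y) (x - y).
Local Notation mu := (lebesgue_tuple R n).
Local Notation r := (conj_exp s).
Implicit Types u v w : 'rV[R]_n -> 'rV[R]_n.

Let s0 : 0 < s. Proof. have s2' := s2; lra. Qed.
Let s1 : 1 <= s. Proof. have s2' := s2; lra. Qed.
Let r0 : 0 < r. Proof. exact: lt_trans (conj_exp_gt1 _ _ s2). Qed.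
Let r1 : 1 <= r. Proof. exact/ltW/conj_exp_gt1. Qed.
Let sr := conj_exp_sum R s s2.
Let rs : r^-1 + s^-1 = 1. Proof. by rewrite addrC. Qed.

(** The measure of the domain to the power [1/s]: the contribution of the constant 1 in the growth
    condition on [F]. *)
Definition domain_norm : R := Lpnorm O s (fun=> 1).

Lemma one_inLp : inLp O s (fun=> 1 : R).
Proof.
apply: (bounded_inLp R n O K OK s _ 1 s0); last by move=> x; rewrite normr1.
apply: measurable_fun_ifT; [|exact: measurable_cst|exact: measurable_cst].
apply: (measurable_fun_bool true); rewrite setTI.
rewrite (_ : _ @^-1` _ = [set t | O (rV_of_tuple t)]); first exact: measurable_open_tuple.
by apply/seteqP; split => t /= => [/set_mem|/mem_set].
Qed.

(** [F 0 = 0] makes extension by zero commute with [F], so continuity of [F] suffices. *)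
Lemma measO_nonlinear u i : (forall i, measO O (fun x => u x 0 i)) ->
  measO O (fun x => F (u x) 0 i).
Proof.
move=> mu'.
have := continuous_measurable_comp R n _ _ (fun x => F x 0 i) (zextv R n O u)
  (polynomial_growth_continuous R n F s c1 s2 hc1 F_lip i)
  (fun j => measurable_extv R n O u j (mu' j)).
congr measurable_fun; apply/funext => t; rewrite /zextv; case: ifP => // _.
by rewrite F0 mxE.
Qed.

(** Each of the three terms is at most the power of the sum. The factors [1 *] give the base the
    shape [a * f + g] of [inLp_lin]. *)
Lemma growth_factor_le (x y : 'rV[R]_n) :
  1 + enorm x `^ (s - 2) + enorm y `^ (s - 2) <=
  3 * (1 * enorm x + (1 * enorm y + 1)) `^ (s - 2).
Proof.
have s20 : 0 <= s - 2 by have s2' := s2; lra.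
have := enorm_ge0 _ _ x; have := enorm_ge0 _ _ y; rewrite !mul1r.
move: (enorm x) (enorm y) => a b b0 a0.
have D1 : 1 <= (a + (b + 1)) `^ (s - 2).
  by rewrite -[leLHS](powRr0 (a + (b + 1))); apply: ler_powR => //; lra.
have D2 : a `^ (s - 2) <= (a + (b + 1)) `^ (s - 2) by apply: powR_mono => //; lra.
have D3 : b `^ (s - 2) <= (a + (b + 1)) `^ (s - 2) by apply: powR_mono => //; lra.
lra.
Qed.

(** The growth condition bounds the difference pointwise by [3 c1 h^(s-2) |u1 - u2|] with
    [h = |u1| + |u2| + 1], to which [hoelder_conj_exp] applies. *)
Lemma nonlinear_difference u1 u2 : inLpvec O s u1 -> inLpvec O s u2 ->
  inLpvec O r (fun x => F (u1 x) - F (u2 x)) /\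
  Lpvecnorm O r (fun x => F (u1 x) - F (u2 x)) <=
  3 * c1 * (domain_norm + (Lpvecnorm O s u1 + Lpvecnorm O s u2)) `^ (s - 2)
  * Lpvecnorm O s (fun x => u1 x - u2 x).
Proof.
move=> u1s u2s.
have s20 : 0 <= s - 2 by have s2' := s2; lra.
have ws : inLpvec O s (fun x => u1 x - u2 x).
  have := inLpvec_lin R n O s (-1) u2 u1 s1 u2s u1s.
  by congr inLpvec; apply/funext => x; rewrite scaleN1r addrC.
have /inLpvecE[mw ewS] := ws; have /inLpvecE[m1 e1] := u1s; have /inLpvecE[m2 e2] := u2s.
pose h x := 1 * enorm (u1 x) + (1 * enorm (u2 x) + 1).
have h2s := inLp_lin R n O s 1 _ _ s1 e2 one_inLp.
have hS : inLp O s h := inLp_lin R n O s 1 _ _ s1 e1 h2s.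
have h0 x : 0 <= h x by rewrite /h !mul1r !addr_ge0 ?enorm_ge0.
have hN : Lpnorm O s h <= domain_norm + (Lpvecnorm O s u1 + Lpvecnorm O s u2).
  have A1 := Lpnorm_lin R n O s 1 _ _ s1 e1 h2s.
  have A2 := Lpnorm_lin R n O s 1 _ _ s1 e2 one_inLp.
  rewrite normr1 mul1r in A1; rewrite normr1 mul1r in A2.
  rewrite !LpvecnormE addrCA; apply: le_trans A1 _; rewrite lerD2l.
  by rewrite /domain_norm [leRHS]addrC; exact: A2.
have mF i : measO O (fun x => (F (u1 x) - F (u2 x)) 0 i).
  have : measurable_fun [set: n.-tuple R] (fun t => zext R n O (fun x => F (u1 x) 0 i) t
      - zext R n O (fun x => F (u2 x) 0 i) t).
    by apply: measurable_funB; exact: measO_nonlinear.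
  congr measurable_fun; apply/funext => t; rewrite /zext; case: ifP => _; rewrite ?subrr//.
  by rewrite !mxE.
have [P1 P2] := hoelder_conj_exp _ _ R mu s _ _ s2 ((inLpP _ _ _ _ _ s0).1 ewS)
  ((inLpP _ _ _ _ _ s0).1 hS).
pose g x := `|h x| `^ (s - 2) * enorm (u1 x - u2 x).
have gE : zext R n O g = (fun t => `|zext R n O h t| `^ (s - 2) * zext R n O (fun x => enorm (u1 x - u2 x)) t).
  by apply/funext => t; rewrite /zext; case: ifP => // _; rewrite mulr0.
rewrite -gE in P1 P2.
have gr : inLp O r g by exact/(inLpP _ _ _ _ _ r0).
have c30 : 0 <= 3 * c1 by rewrite mulr_ge0// ltW.
have ptw x : `|enorm (F (u1 x) - F (u2 x))| <= `|3 * c1 * g x|.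
  rewrite (ger0_norm (enorm_ge0 _ _ _)); apply: le_trans (F_lip _ _) (le_trans _ (ler_norm _)).
  rewrite /g (ger0_norm (h0 x)) mulrA; apply: ler_wpM2r; first exact: enorm_ge0.
  rewrite (mulrC 3) -mulrA; apply: ler_wpM2l; first exact: ltW.
  exact: growth_factor_le.
have [Fr FN] := Lpnorm_le R n O r _ _ r0 (measO_enorm _ _ _ _ mF) (inLpZ R n O r (3 * c1) g r0 gr) ptw.
split; first by apply/inLpvecE.
rewrite !LpvecnormE in hN *; apply: le_trans FN _.
rewrite (LpnormZ R n O r (3 * c1) g r0 gr) (ger0_norm c30) -(mulrA (3 * c1)); apply: ler_wpM2l => //.
rewrite (LpnormE _ _ _ _ _ r0 gr); apply: le_trans P2 _.
rewrite -(LpnormE _ _ _ _ _ s0 hS) -(LpnormE _ _ _ _ _ s0 ewS).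
apply: ler_wpM2r; first exact: Lpnorm_ge0.
by apply: powR_mono => //; exact: Lpnorm_ge0.
Qed.

Lemma nonlinear_inLpvec u : inLpvec O s u -> inLpvec O r (fun x => F (u x)).
Proof.
move=> us; have [+ _] := nonlinear_difference u (fun=> 0) us (inLpvec0 R n O s s0).
by congr inLpvec; apply/funext => x; rewrite F0 subr0.
Qed.

Local Notation C1 := (2 * inf_sup_constant R K s).

Section two_solutions.
Variables (G1 G2 : functional R n) (u1 u2 : 'rV[R]_n -> 'rV[R]_n)
  (du1 du2 p1 p2 : 'rV[R]_n -> R).
Hypothesis dG1 : in_Wdual O s G1.
Hypothesis dG2 : in_Wdual O s G2.
Hypothesis S1 : solves O s F u1 du1 p1 G1.
Hypothesis S2 : solves O s F u2 du2 p2 G2.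

Local Notation w := (fun x => u1 x - u2 x).
Local Notation dw := (fun x => du1 x - du2 x).
Local Notation e := (fun x => p1 x - p2 x).
Local Notation beta := (normVd O s (fsub G1 G2)).
Local Notation gamma := (normZd O s (fsub G1 G2)).
Local Notation Phi := (Lpvecnorm O r (fun x => F (u1 x) - F (u2 x))).

Let dG : in_Wdual O s (fsub G1 G2). Proof. exact: (in_Wdual_fsub R n O s). Qed.

Lemma sub_lin (a b : R) : a - b = -1 * b + a. Proof. by rewrite mulN1r addrC. Qed.

Lemma RintO_sub f g : mu.-integrable setT (EFin \o zext R n O f) ->
  mu.-integrable setT (EFin \o zext R n O g) ->
  RintO O (fun x => f x - g x) = RintO O f - RintO O g.
Proof.
move=> fi gi; rewrite (_ : (fun x => _) = fun x => -1 * g x + f x); last first.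
  by apply/funext => x; exact: sub_lin.
by rewrite (RintO_lin _ _ _ _ _ _ gi fi) -sub_lin.
Qed.

Lemma difference_inW : inW O s w dw e.
Proof.
have H := inW_lin R n O K s OK s2 (-1) u2 du2 p2 u1 du1 p1 S2.1 S1.1.
have E1 : (fun x => -1 *: u2 x + u1 x) = w by apply/funext => x; rewrite scaleN1r addrC.
have E2 : (fun x => -1 * du2 x + du1 x) = dw by apply/funext => x; rewrite mulN1r addrC.
have E3 : (fun x => -1 * p2 x + p1 x) = e by apply/funext => x; rewrite mulN1r addrC.
by rewrite E1 E2 E3 in H.
Qed.

Lemma difference_Z q : inLp O r q -> RintO O (fun x => dw x * q x) = fsub G1 G2 (fun=> 0) q.
Proof.
move=> qr; have Wq := inW_Z R n O s s2 q qr.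
have R0 := RintO0 R n O.
have red du u p G : solves O s F u du p G -> RintO O (fun x => du x * q x) = G (fun=> 0) q.
  move=> [_ H]; rewrite -(H _ _ _ Wq).
  rewrite [X in _ = X - _ + _](_ : _ = 0); last first.
    rewrite -[RHS]R0; congr RintO; apply/funext => x.
    by rewrite /dotp big1// => i _; rewrite mxE mulr0.
  rewrite [X in _ = _ - X + _](_ : _ = 0) ?subrr ?add0r//.
  by rewrite -[RHS]R0; congr RintO; apply/funext => x; rewrite mul0r.
rewrite /fsub -(red _ _ _ _ S1) -(red _ _ _ _ S2) -RintO_sub.
- by congr RintO; apply/funext => x; rewrite mulrBl.
- have [[[_ [du1s _]] _] _] := S1.
  by have [] := hoelder_O R n O s r _ _ s0 r0 sr du1s qr.
- have [[[_ [du2s _]] _] _] := S2.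
  by have [] := hoelder_O R n O s r _ _ s0 r0 sr du2s qr.
Qed.

(** [F] is not linear, so each equation is tested with [(v, 0)] on its own and the integrals are
    subtracted; Hölder's inequality provides the integrability this takes. *)
Lemma difference_V v dv : inV O s v dv ->
  RintO O (fun x => dotp (F (u1 x) - F (u2 x)) (v x)) - RintO O (fun x => dv x * e x)
  = fsub G1 G2 v (fun=> 0).
Proof.
move=> Vv; have Wv := inW0 R n O s s2 v dv Vv.
have [vs [dvs _]] := Vv.
have R0 := RintO0 R n O.
have red du u p G : solves O s F u du p G ->
    RintO O (fun x => dotp (F (u x)) (v x)) - RintO O (fun x => dv x * p x) = G v (fun=> 0).
  move=> [_ H]; rewrite -(H _ _ _ Wv) [X in _ = _ + X](_ : _ = 0) ?addr0//.
  by rewrite -[RHS]R0; congr RintO; apply/funext => x; rewrite mulr0.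
have [[[u1s _] p1r] _] := S1; have [[[u2s _] p2r] _] := S2.
have [i1 _] := hoelder_vec R n O r s _ _ r0 s0 rs (nonlinear_inLpvec _ u1s) vs.
have [i2 _] := hoelder_vec R n O r s _ _ r0 s0 rs (nonlinear_inLpvec _ u2s) vs.
have [i3 _] := hoelder_O R n O s r _ _ s0 r0 sr dvs p1r.
have [i4 _] := hoelder_O R n O s r _ _ s0 r0 sr dvs p2r.
rewrite /fsub -(red _ _ _ _ S1) -(red _ _ _ _ S2).
rewrite (_ : (fun x => dotp (F (u1 x) - F (u2 x)) (v x)) =
  fun x => dotp (F (u1 x)) (v x) - dotp (F (u2 x)) (v x)); last first.
  by apply/funext => x; rewrite dotpBl.
rewrite (_ : (fun x => dv x * e x) = fun x => dv x * p1 x - dv x * p2 x); last first.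
  by apply/funext => x; rewrite mulrBr.
by rewrite (RintO_sub _ _ i1 i2) (RintO_sub _ _ i3 i4); ring.
Qed.

Lemma divergence_estimate : Lpnorm O s dw <= gamma.
Proof.
have [[_ [dws _]] _] := difference_inW.
apply: (Lpnorm_dual R n O s s2 _ _ dws); first exact: (normZd_ge0 R n O s s2).
by move=> q qr; rewrite difference_Z//; exact: (normZd_bound R n O s s2).
Qed.

Lemma pressure_estimate : Lpnorm O r e <= C1 * (beta + Phi).
Proof.
have [_ er] := difference_inW.
have [[[u1s _] _] _] := S1; have [[[u2s _] _] _] := S2.
have [Fr _] := nonlinear_difference u1 u2 u1s u2s.
have b0 : 0 <= beta by exact: (normVd_ge0 R n O s s2).
have P0 : 0 <= Phi by rewrite LpvecnormE; exact: Lpnorm_ge0.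
apply: (inf_sup R m O K s) => //; first by rewrite addr_ge0.
move=> v dv Vv; have E := difference_V v dv Vv.
have [_ B1] := hoelder_vec R n O r s _ _ r0 s0 rs Fr Vv.1.
have B2 := normVd_bound R n O K s OK s2 _ dG v dv Vv.
have B3 := ler_wpM2l P0 (Lpvecnorm_le_normV R n O s s2 v dv).
rewrite (_ : RintO O (fun x => dv x * e x) =
  RintO O (fun x => dotp (F (u1 x) - F (u2 x)) (v x)) - fsub G1 G2 v (fun=> 0)); last first.
  by rewrite -E; ring.
apply: le_trans (ler_normB _ _) _; rewrite mulrDl addrC; apply: lerD => //.
exact: le_trans B1 B3.
Qed.

Lemma energy_estimate : c2 * Lpvecnorm O s w `^ s <=
  beta * (Lpvecnorm O s w + gamma) + gamma * Lpnorm O r e.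
Proof.
have Ww := difference_inW; have [Vw er] := Ww; have [ws _] := Vw.
have [[[u1s _] _] _] := S1; have [[[u2s _] _] _] := S2.
have [Fr _] := nonlinear_difference u1 u2 u1s u2s.
have b0 : 0 <= beta by exact: (normVd_ge0 R n O s s2).
(* The coupling term is the same in the equations tested with [(w, 0)] and with [(0, e)], so the
   second one replaces it by the action of the functional on [e]. *)
have E := difference_V w dw Vw; rewrite (difference_Z e er) in E.
have [i _] := hoelder_vec R n O r s _ _ r0 s0 rs Fr ws.
have B1 := normVd_bound R n O K s OK s2 _ dG w dw Vw.
have B2 := normZd_bound R n O s s2 _ dG e er.
have B3 := normV_le R n O s s2 w dw.
have B4 := divergence_estimate.
have B5 : beta * normV O s w dw <= beta * (Lpvecnorm O s w + gamma).
  by apply: ler_wpM2l => //; apply: le_trans B3 _; rewrite lerD2l.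
have mono : c2 * Lpvecnorm O s w `^ s <= RintO O (fun x => dotp (F (u1 x) - F (u2 x)) (w x)).
  have /inLpvecE[mw ews] := ws; have ews' := (inLpP _ _ _ _ _ s0).1 ews.
  have X : Lpvecnorm O s w `^ s = \int[mu]_t (`|zext R n O (fun x => enorm (w x)) t| `^ s).
    by rewrite LpvecnormE (LpnormE _ _ _ _ _ s0 ews) (nLp_powR _ _ R mu s _ s0).
  have Y : mu.-integrable setT (EFin \o (fun t => `|zext R n O (fun x => enorm (w x)) t| `^ s)).
    apply/integrableP; split.
      by apply/measurable_EFinP; apply: measurable_norm_powR; case: ews'.
    case: ews' => _; apply: le_lt_trans; rewrite le_eqVlt; apply/orP; left; apply/eqP.
    by apply: eq_integral => t _ /=; rewrite (ger0_norm (powR_ge0 _ _)).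
  rewrite X -(RintegralZl c2 measurableT Y) (RintOE _ _ _ _ i).
  apply: (le_Rintegral measurableT) => //; first exact: (integrableZl measurableT c2 Y).
  move=> t _; rewrite /zext; case: ifP => _.
    by rewrite (ger0_norm (enorm_ge0 _ _ _)); exact: F_mon.
  by rewrite normr0 powR0 ?gt_eqF// mulr0.
apply: le_trans mono _.
rewrite (_ : RintO O _ = fsub G1 G2 w (fun=> 0) + fsub G1 G2 (fun=> 0) e); last first.
  by rewrite -E; ring.
by apply: lerD; [exact: le_trans (ler_norm _) (le_trans B1 B5)|exact: le_trans (ler_norm _) B2].
Qed.

End two_solutions.

Lemma zero_solves : solves O s F (fun=> 0) (fun=> 0) (fun=> 0) (fun _ _ => 0).
Proof.
split; first exact: (inW0 R n O s s2 _ _ (inV0 R n O s s2)).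
move=> v dv q _; have R0 := RintO0 R n O.
rewrite [X in X - _ + _](_ : _ = 0); last first.
  rewrite -[RHS]R0; congr RintO; apply/funext => x.
  by rewrite F0 /dotp big1// => i _; rewrite mxE mul0r.
rewrite [X in _ - X + _](_ : _ = 0); last first.
  by rewrite -[RHS]R0; congr RintO; apply/funext => x; rewrite mulr0.
rewrite [X in _ + X](_ : _ = 0) ?subrr ?addr0//.
by rewrite -[RHS]R0; congr RintO; apply/funext => x; rewrite mul0r.
Qed.

(** The constant of [apriori_bound] for [k = domain_norm] and [C3 = 3 * c1]. *)
Definition apriori_constant : R :=
  1 + (2 + C1 + C1 * (3 * c1) * (domain_norm + 1) `^ (s - 2)) / c2.

Lemma C1_ge0 : 0 <= C1.
Proof. by rewrite mulr_ge0// inf_sup_constant_ge0. Qed.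

Lemma domain_norm_ge0 : 0 <= domain_norm.
Proof. exact: Lpnorm_ge0. Qed.

Lemma triple_c1_ge0 : 0 <= 3 * c1.
Proof. by rewrite mulr_ge0// ltW. Qed.

Lemma apriori_constant_ge0 : 0 <= apriori_constant.
Proof.
have := C1_ge0; have := triple_c1_ge0; rewrite /apriori_constant.
move: C1 (3 * c1) => a b b0 a0.
rewrite addr_ge0// divr_ge0 ?(ltW hc2)// !addr_ge0// mulr_ge0 ?powR_ge0//.
by rewrite mulr_ge0.
Qed.

Let drop_zero (a c k U z W p : R) : z = 0 ->
  a <= c * (k + (U + z)) `^ p * W -> a <= c * (k + U) `^ p * W.
Proof. by move=> ->; rewrite addr0. Qed.

Lemma apriori_estimate G u du p : in_Wdual O s G -> solves O s F u du p G ->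
  Lpvecnorm O s u <= apriori_constant * (1 + normVd O s G `^ (r - 1) + normZd O s G).
Proof.
move=> dG S; have d0 := in_Wdual0 R n O s; have S0 := zero_solves.
have GE : fsub G (fun _ _ => 0) = G.
  by apply/funext => v; apply/funext => q; rewrite /fsub subr0.
have uE : (fun x => u x - 0) = u by apply/funext => x; rewrite subr0.
have [[[us _] _] _] := S.
have E1 := energy_estimate _ _ _ _ _ _ _ _ dG d0 S S0.
have E2 := pressure_estimate _ _ _ _ _ _ _ _ dG d0 S S0.
have [_ E3] := nonlinear_difference u (fun=> 0) us (inLpvec0 R n O s s0).
lazy beta in E1, E2, E3.
rewrite GE uE in E1; rewrite GE in E2; rewrite uE in E3.
have {}E3 := drop_zero _ _ _ _ _ _ _ (Lpvecnorm0 R n O s s0) E3.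
have b0 : 0 <= normVd O s G by exact: (normVd_ge0 R n O s s2).
have g0 : 0 <= normZd O s G by exact: (normZd_ge0 R n O s s2).
have u0 : 0 <= Lpvecnorm O s u by rewrite LpvecnormE; exact: Lpnorm_ge0.
exact: (apriori_bound R s s2 _ _ _ _ _ _ _ _ _ hc2 domain_norm_ge0 C1_ge0 triple_c1_ge0 b0 g0 u0 E1 E2 E3).
Qed.

(** Constant of [nonlinear_difference] after the norms of both solutions have been bounded by
    [apriori_constant] times [M]. *)
Definition growth_constant : R :=
  3 * c1 * (domain_norm + 2 * apriori_constant) `^ (s - 2).

Definition stability_constant : R :=
  1 + C1 + 2 * ((1 + C1 * growth_constant) *
                (1 + 3 * (1 + C1 + C1 * growth_constant) / c2)).

Lemma growth_constant_ge0 : 0 <= growth_constant.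
Proof. by rewrite mulr_ge0 ?powR_ge0 ?triple_c1_ge0. Qed.

Lemma stability_constant_gt0 : 0 < stability_constant.
Proof.
have := C1_ge0; have := growth_constant_ge0; rewrite /stability_constant.
move: C1 growth_constant => a b b0 a0.
have ab : 0 <= a * b by rewrite mulr_ge0.
have X : 0 <= 3 * (1 + a + a * b) / c2 by rewrite divr_ge0 ?(ltW hc2)//; lra.
have Y : 0 <= (1 + a * b) * (1 + 3 * (1 + a + a * b) / c2) by rewrite mulr_ge0//; lra.
by lra.
Qed.

(** Since [M >= 1], [k <= k M], and both [U1] and [U2] are at most [c M]; hence the base is at most
    [(k + 2c) M]. *)
Lemma nonlinear_apriori (k c a1 a2 U1 U2 M : R) : 0 <= k -> 0 <= c -> 0 <= a1 -> 0 <= a2 ->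
  0 <= U1 -> 0 <= U2 -> U1 <= c * (1 + a1) -> U2 <= c * (1 + a2) -> M = 1 + (a1 + a2) ->
  (k + (U1 + U2)) `^ (s - 2) <= (k + 2 * c) `^ (s - 2) * M `^ (s - 2).
Proof.
move=> k0 c0 a10 a20 U10 U20 H1 H2 ME.
have s20 : 0 <= s - 2 by have s2' := s2; lra.
have M1 : 1 <= M by rewrite ME; lra.
rewrite -powRM; [|by lra|by lra].
apply: powR_mono => //; first by lra.
have X1 : c * (1 + a1) <= c * M by apply: ler_wpM2l => //; rewrite ME; lra.
have X2 : c * (1 + a2) <= c * M by apply: ler_wpM2l => //; rewrite ME; lra.
have X3 : k <= k * M by rewrite ler_peMr.
by rewrite mulrDl -mulrA; lra.
Qed.

(** The triangle inequality yields [gamma <= M], which [stability_bound] uses to absorb the term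
    linear in [gamma]. *)
Lemma normZd_fsub G1 G2 : in_Wdual O s G1 -> in_Wdual O s G2 ->
  normZd O s (fsub G1 G2) <= normZd O s G1 + normZd O s G2.
Proof.
move=> dG1 dG2; apply: ge_sup.
  by case: (has_sup_Zd R n O s s2 _ (in_Wdual_fsub R n O s _ _ dG1 dG2)).
move=> _ [q [qr [q1 ->]]]; apply: le_trans (ler_normB _ _) _.
apply: lerD.
  by apply: sup_upper_bound; [exact: (has_sup_Zd R n O s s2 _ dG1)|exists q].
by apply: sup_upper_bound; [exact: (has_sup_Zd R n O s s2 _ dG2)|exists q].
Qed.

Lemma stability_estimate G1 G2 u1 u2 du1 du2 p1 p2 (M beta gamma : R) :
  in_Wdual O s G1 -> in_Wdual O s G2 ->
  solves O s F u1 du1 p1 G1 -> solves O s F u2 du2 p2 G2 ->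
  M = 1 + ((normVd O s G1 `^ (r - 1) + normZd O s G1)
         + (normVd O s G2 `^ (r - 1) + normZd O s G2)) ->
  beta = normVd O s (fsub G1 G2) -> gamma = normZd O s (fsub G1 G2) ->
  normW O s (fun x => u1 x - u2 x) (fun x => du1 x - du2 x) (fun x => p1 x - p2 x)
  <= stability_constant * (beta + M `^ (s - 2) * beta `^ (r - 1)
       + gamma + M `^ (r * (s - 2)) * gamma `^ (r - 1)).
Proof.
move=> dG1 dG2 S1 S2 ME betaE gammaE.
have dG := in_Wdual_fsub R n O s _ _ dG1 dG2.
have E1 := energy_estimate _ _ _ _ _ _ _ _ dG1 dG2 S1 S2.
have E2 := pressure_estimate _ _ _ _ _ _ _ _ dG1 dG2 S1 S2.
have E4 := divergence_estimate _ _ _ _ _ _ _ _ dG1 dG2 S1 S2.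
have [[[u1s _] _] _] := S1; have [[[u2s _] _] _] := S2.
have [_ E3] := nonlinear_difference u1 u2 u1s u2s.
have A1 := apriori_estimate _ _ _ _ dG1 S1.
have A2 := apriori_estimate _ _ _ _ dG2 S2.
have v0 u : 0 <= Lpvecnorm O s u by rewrite LpvecnormE; exact: Lpnorm_ge0.
have b10 := powR_ge0 (normVd O s G1) (r - 1); have b20 := powR_ge0 (normVd O s G2) (r - 1).
have g10 := normZd_ge0 R n O s s2 _ dG1; have g20 := normZd_ge0 R n O s s2 _ dG2.
have b0 := normVd_ge0 R n O s s2 _ dG; have g0 := normZd_ge0 R n O s s2 _ dG.
rewrite -betaE in b0; rewrite -gammaE in g0.
rewrite -betaE -gammaE in E1; rewrite -betaE in E2; rewrite -gammaE in E4.
have gM : gamma <= M.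
  rewrite gammaE; apply: le_trans (normZd_fsub _ _ dG1 dG2) _; rewrite ME.
  by apply: ler_wpDl => //; apply: lerD; exact: ler_wpDl.
have M1 : 1 <= M by rewrite ME lerDl; apply: addr_ge0; exact: addr_ge0.
have NA : (domain_norm + (Lpvecnorm O s u1 + Lpvecnorm O s u2)) `^ (s - 2) <=
    (domain_norm + 2 * apriori_constant) `^ (s - 2) * M `^ (s - 2).
  apply: (nonlinear_apriori _ _ (normVd O s G1 `^ (r - 1) + normZd O s G1)
    (normVd O s G2 `^ (r - 1) + normZd O s G2)).
  - exact: domain_norm_ge0.
  - exact: apriori_constant_ge0.
  - exact: addr_ge0.
  - exact: addr_ge0.
  - exact: v0.
  - exact: v0.
  - by rewrite addrA.
  - by rewrite addrA.
  - exact: ME.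
have E3' : Lpvecnorm O r (fun x => F (u1 x) - F (u2 x)) <=
    growth_constant * M `^ (s - 2) * Lpvecnorm O s (fun x => u1 x - u2 x).
  apply: le_trans E3 _; apply: ler_wpM2r; first exact: v0.
  by rewrite /growth_constant -(mulrA (3 * c1)); apply: ler_wpM2l => //; exact: triple_c1_ge0.
apply: le_trans (stability_bound R s s2 c2 C1 growth_constant M beta gamma
  (Lpvecnorm O s (fun x => u1 x - u2 x)) (Lpnorm O s (fun x => du1 x - du2 x))
  (Lpnorm O r (fun x => p1 x - p2 x)) _ hc2 C1_ge0 growth_constant_ge0 M1 b0 g0 gM
  (v0 _) (Lpnorm_ge0 R n O s _) E4 E1 E2 E3').
by rewrite /normW lerD2r; exact: (normV_le R n O s s2).
Qed.

End stability.

Theorem mainTheorem18 (R : realType) (n : nat) (hn : (2 <= n)%N)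
  (O : set 'rV[R]_n) (O_open : open O) (O_bdd : bounded_set O)
  (O_C1 : C1_boundary O)
  (F : 'rV[R]_n -> 'rV[R]_n) (s c1 c2 : R)
  (hs : 2 < s) (hc1 : 0 < c1) (hc2 : 0 < c2) (F0 : F 0 = 0)
  (F_lip : forall x y, enorm (F x - F y)
             <= c1 * (1 + enorm x `^ (s - 2) + enorm y `^ (s - 2)) * enorm (x - y))
  (F_mon : forall x y, c2 * enorm (x - y) `^ s <= dotp (F x - F y) (x - y)) :
  let r := conj_exp s in
  exists c10 c11 : R, 0 < c10 /\ 0 < c11 /\
  forall (G1 G2 : functional R n) (u1 u2 : 'rV[R]_n -> 'rV[R]_n)
         (du1 du2 p1 p2 : 'rV[R]_n -> R),
    in_Wdual O s G1 -> in_Wdual O s G2 ->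
    solves O s F u1 du1 p1 G1 -> solves O s F u2 du2 p2 G2 ->
    let M := 1 + ((normVd O s G1 `^ (r - 1) + normZd O s G1)
                + (normVd O s G2 `^ (r - 1) + normZd O s G2)) in
    let beta := normVd O s (fsub G1 G2) in
    let gamma := normZd O s (fsub G1 G2) in
    let dist := normW O s (fun x => u1 x - u2 x) (fun x => du1 x - du2 x)
                          (fun x => p1 x - p2 x) in
    dist <= c10 * (beta + M `^ (s - 2) * beta `^ (r - 1)
                   + gamma + M `^ (r * (s - 2)) * gamma `^ (r - 1))
    /\
    dist <= c11 * (1 + normWd O s G1 + normWd O s G2) `^ (r * (s - 2))
                * (normWd O s (fsub G1 G2) `^ (r - 1) + normWd O s (fsub G1 G2)).
Proof.
case: n hn O O_open O_bdd O_C1 F F0 F_lip F_mon => // m _ O oO /pinfty_ex_gt0[K K0 OK'] _ F F0 F_lip F_mon r.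
(* The norm of a row vector dominates each coordinate, so the bound [K] on the domain confines it to
   a box. *)
have OK t : O (rV_of_tuple t) -> box R K m.+1 t.
  move=> Ot i; have := le_trans (norm_coord_le_norm _ _ (rV_of_tuple t) i) (OK' _ Ot).
  by rewrite mxE.
pose c := stability_constant R m O K s c1 c2.
have c0 : 0 < c by exact: stability_constant_gt0.
have f0 : 0 < 5 `^ (r * (s - 2)) :> R by exact: powR_gt0.
(* The extra factor in the second constant is the one produced by [dual_norm_bound]. *)
exists c, (c * (2 * 5 `^ (r * (s - 2)))); split => //; split.
  by rewrite mulr_gt0// mulr_gt0.
move=> G1 G2 u1 u2 du1 du2 p1 p2 dG1 dG2 S1 S2 M beta gamma dist.
have H : dist <= c * (beta + M `^ (s - 2) * beta `^ (r - 1)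
                   + gamma + M `^ (r * (s - 2)) * gamma `^ (r - 1)).
  exact: (stability_estimate R m O K s c1 c2 F OK (ltW K0) oO hs hc1 hc2 F0 F_lip F_mon
    _ _ _ _ _ _ _ _ M beta gamma dG1 dG2 S1 S2 erefl erefl erefl).
split; first exact: H.
apply: le_trans H _.
have dG := in_Wdual_fsub R m.+1 O s _ _ dG1 dG2.
have v0 G (d : in_Wdual O s G) := normVd_ge0 R m.+1 O s hs G d.
have z0 G (d : in_Wdual O s G) := normZd_ge0 R m.+1 O s hs G d.
have v1 G (d : in_Wdual O s G) := normVd_le_normWd R m.+1 O s hs G d.
have z1 G (d : in_Wdual O s G) := normZd_le_normWd R m.+1 O s hs G d.
rewrite -!mulrA; apply: ler_wpM2l; first exact: ltW.
rewrite !mulrA.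
exact: (dual_norm_bound R s hs (normWd O s G1) (normWd O s G2) (normWd O s (fsub G1 G2))
  M beta gamma _ _ _ _ (v0 _ dG) (v1 _ dG) (z0 _ dG) (z1 _ dG)
  (v0 _ dG1) (v1 _ dG1) (z0 _ dG1) (z1 _ dG1) (v0 _ dG2) (v1 _ dG2) (z0 _ dG2) (z1 _ dG2) erefl).
Qed.
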